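(* Let $G=(X,w,\kappa,\mu)$ be a graph that does not satisfy stochastic completeness at infinity. Then, for every $u_0\in\ell^\infty(X)$ and every $\phi\in\mathcal I$, there exists an infinite family $\{u^\alpha\}_\alpha$ of global bounded pointwise solutions of (GPME) with initial datum $u_0$ such that, for every $S>0$, the restrictions $u^\alpha|_{[0,S]\times X}$ are pairwise distinct. In particular, for every $T>0$, the Cauchy problem (GPME) with initial datum $u_0$ has infinitely many bounded pointwise solutions on $[0,T]\times X$.
   Context: Graph: $G=(X,w,\kappa,\mu)$ where $X$ is a countable set, $\mu\colon X\to(0,\infty)$, $w\colon X\times X\to[0,\infty)$ is symmetric with $w(x,x)=0$ and $\sum_{y\in X}w(x,y)<\infty$ for every $x\in X$, and $\kappa\colon X\to[0,\infty)$ (killing term). Graphs are always assumed connected: any $x,y\in X$ are joined by a finite path $x=x_0,\dots,x_N=y$ with $w(x_i,x_{i+1})>0$ for all $i$. No local finiteness is assumed. $\ell^\infty(X)$ denotes the bounded functions $X\to\mathbb R$. Laplacian: $\mathcal F$ is the set of $f\colon X\to\mathbb R$ with $\sum_{y}w(x,y)|f(y)|<\infty$ for every $x$; for $f\in\mathcal F$, $\Delta f(x)=\frac1{\mu(x)}\sum_{y\in X}w(x,y)(f(x)-f(y))+\frac{\kappa(x)}{\mu(x)}f(x)$. Stochastic completeness at infinity: let $L$ be the positive self-adjoint operator on $\ell^2(X,\mu)$ associated with the closure of the form $Q(f,g)=\frac12\sum_{x,y}w(x,y)(f(x)-f(y))(g(x)-g(y))+\sum_x\kappa(x)f(x)g(x)$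 defined on finitely supported functions. The semigroup $e^{-tL}$ is positivity preserving and is extended to functions $f\ge0$ by $e^{-tL}f=\lim_n e^{-tL}f_n\in[0,\infty]$ for finitely supported $0\le f_n\uparrow f$. $G$ satisfies stochastic completeness at infinity if for some (and hence all) $t>0$, $e^{-tL}1+\int_0^te^{-sL}(\kappa/\mu)\,ds=1$ pointwise on $X$. Nonlinearities: $\mathcal I$ is the set of continuous, increasing (in the weak sense: $s_1<s_2$ implies $\phi(s_1)\le\phi(s_2)$), nonconstant $\phi\colon\mathbb R\to\mathbb R$ with $\phi(0)=0$. Pointwise solutions: (GPME) is the Cauchy problem $\partial_tu+\Delta(\phi\circ u)=0$, $u|_{t=0}=u_0$. A pointwise solution on $[0,T]\times X$ with initial datum $u_0\colon X\to\mathbb R$ is a function $u\colon[0,T]\times X\to\mathbb R$ such that $\phi\circ u(t,\cdot)\in\mathcal F$ for every $t\in(0,T)$; $u(\cdot,x)\in C([0,T])\cap C^1((0,T))$ for every $x$; $\partial_tu(t,x)+\Delta(\phi\circ u(t,\cdot))(x)=0$ for all $(t,x)\in(0,T)\times X$; and $u(0,x)=u_0(x)$ for all $x$. It is bounded if $u$ is a bounded function. A function $u\colon[0,\infty)\times X\to\mathbb R$ is a global pointwise solution if its restriction to $[0,T]\times X$ is a pointwise solution for every $T>0$; it is a global bounded pointwise solution if in addition $u$ is bounded on $[0,\infty)\times X$. *)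

(* Defs.v *)
From HB Require Import structures.
From mathcomp Require Import all_boot all_order all_algebra.
From mathcomp Require Import all_classical all_reals all_analysis.
Import Order.TTheory GRing.Theory Num.Theory.
Import numFieldNormedType.Exports.

Set Implicit Arguments.
Unset Strict Implicit.
Unset Printing Implicit Defensive.

Local Open Scope classical_set_scope.
Local Open Scope ring_scope.

Definition abs_summable (R : realType) (I : choiceType) (f : I -> R) : Prop :=
  summable [set: I] (EFin \o f).

(* Meaningful when [abs_summable f] holds; every use below is either in that
   case or comes with an explicit summability hypothesis. *)
Definition rsum (R : realType) (I : choiceType) (f : I -> R) : R :=
  fine (\esum_(i in [set: I]) (Num.max (f i) 0)%:E
        - \esum_(i in [set: I]) (Num.max (- f i) 0)%:E)%E.

Record graph (R : realType) (X : countType) := Graph {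
  weight : X -> X -> R;
  killing : X -> R;
  vmeas : X -> R;
  vmeas_gt0 : forall x, 0 < vmeas x;
  killing_ge0 : forall x, 0 <= killing x;
  weight_ge0 : forall x y, 0 <= weight x y;
  weight_sym : forall x y, weight x y = weight y x;
  weight_diag : forall x, weight x x = 0;
  weight_summable : forall x,
    (\esum_(y in [set: X]) (weight x y)%:E < +oo)%E;
  graph_connected : forall x y, exists p : seq X,
    path (fun a b => 0 < weight a b) x p /\ last x p = y }.

Section Laplacian.
Variables (R : realType) (X : countType) (G : graph R X).
Local Notation w := (weight G).
Local Notation kappa := (killing G).
Local Notation mu := (vmeas G).

Definition lap_dom : set (X -> R) :=
  [set f | forall x, abs_summable (fun y => w x y * f y)].

Definition lap (f : X -> R) (x : X) : R :=
  (mu x)^-1 * rsum (fun y => w x y * (f x - f y)) + kappa x / mu x * f x.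

End Laplacian.

Section HeatSemigroup.
Variables (R : realType) (X : countType) (G : graph R X).
Local Notation w := (weight G).
Local Notation kappa := (killing G).
Local Notation mu := (vmeas G).

(* Since [mu] is everywhere positive, elements of l^2(X, mu) are honest
   functions, not classes. *)
Definition l2 : set (X -> R) :=
  [set f | abs_summable (fun x => f x ^+ 2 * mu x)].

Definition l2_inner (f g : X -> R) : R := rsum (fun x => f x * g x * mu x).

Definition l2_norm (f : X -> R) : R := Num.sqrt (l2_inner f f).

Definition fin_supp : set (X -> R) :=
  [set f | finite_set [set x | f x != 0]].

Definition energy_form (f g : X -> R) : R :=
  2^-1 * rsum (fun p : X * X =>
    w p.1 p.2 * (f p.1 - f p.2) * (g p.1 - g p.2))
  + rsum (fun x => kappa x * f x * g x).

Definition form_approx (fn : nat -> X -> R) (f : X -> R) : Prop :=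
  [/\ l2 f, forall n, fin_supp (fn n),
      l2_norm (fn n - f) @[n --> \oo] --> (0 : R)
    & forall e : R, 0 < e -> exists N, forall m n, (N <= m)%N -> (N <= n)%N ->
        energy_form (fn m - fn n) (fn m - fn n) < e].

Definition closed_form_dom : set (X -> R) :=
  [set f | exists fn, form_approx fn f].

(* The closure of [energy_form] takes the value [q] at [(f, g)]. *)
Definition closed_form (f g : X -> R) (q : R) : Prop :=
  exists fn gn, [/\ form_approx fn f, form_approx gn g &
    energy_form (fn n) (gn n) @[n --> \oo] --> q].

(* Graph of the operator associated with the closed form: [f] is in the domain
   of L and [L f = g]. *)
Definition form_operator (f g : X -> R) : Prop :=
  [/\ closed_form_dom f, l2 g &
      forall h, closed_form_dom h -> closed_form f h (l2_inner g h)].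

(* [P t] is e^{-tL} on l^2(X, mu): [P] is the strongly continuous semigroup of
   bounded operators whose infinitesimal generator is exactly -L.  It is
   unique (on [0 <= t] and l^2(X, mu)), as a strongly continuous semigroup is
   determined by its generator, and exists because L is self-adjoint and
   positive.  Other values of [P] are irrelevant. *)
Record is_heat_semigroup (P : R -> (X -> R) -> (X -> R)) : Prop := {
  heat_l2 : forall t f, 0 <= t -> l2 f -> l2 (P t f);
  heat_linear : forall t (a : R) f g, 0 <= t -> l2 f -> l2 g ->
    P t (a *: f + g) = a *: P t f + P t g;
  heat_bounded : forall t, 0 <= t ->
    exists C : R, forall f, l2 f -> l2_norm (P t f) <= C * l2_norm f;
  heat_0 : forall f, l2 f -> P 0 f = f;
  heat_add : forall s t f, 0 <= s -> 0 <= t -> l2 f ->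
    P (s + t) f = P s (P t f);
  heat_continuous : forall f, l2 f ->
    l2_norm (P t f - f) @[t --> 0^'+] --> (0 : R);
  heat_generator : forall f g, l2 f -> l2 g ->
    form_operator f g <->
    l2_norm (t^-1 *: (P t f - f) + g) @[t --> 0^'+] --> (0 : R) }.

(* Finitely supported exhaustion of [f]; it increases to [f] when [f >= 0]. *)
Definition fin_trunc (f : X -> R) (n : nat) : X -> R :=
  fun x => if (pickle x < n)%N then f x else 0.

(* Extension of the semigroup to [f >= 0], with values in [0, +oo].  As the
   semigroup is positivity preserving, the sequence is nondecreasing and its
   limit does not depend on the exhaustion. *)
Definition heat_ext (P : R -> (X -> R) -> (X -> R)) (t : R) (f : X -> R)
  (x : X) : \bar R := limn (fun n => (P t (fin_trunc f n) x)%:E).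

(* The quantification over [P] only names the unique semigroup e^{-tL}; in
   particular incompleteness provides that semigroup. *)
Definition stochastically_complete_at_infinity : Prop :=
  forall P, is_heat_semigroup P ->
  exists t : R, 0 < t /\ forall x : X,
    (heat_ext P t (fun=> 1%R) x
     + \int[lebesgue_measure]_(s in `[0%R, t])
         heat_ext P s (fun y => kappa y / mu y)%R x = 1)%E.

End HeatSemigroup.

Section GPME.
Variables (R : realType) (X : countType) (G : graph R X).

Definition nonlinearity : set (R -> R) :=
  [set phi : R -> R | [/\ continuous phi,
                 forall s1 s2, s1 < s2 -> phi s1 <= phi s2,
                 ~ (exists c, forall s, phi s = c)
               & phi 0 = 0]].

Definition ell_infty : set (X -> R) :=
  [set f | exists M : R, forall x, `|f x| <= M].

(* Functions on [0, T] x X (or [0, oo) x X) are represented by total functions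
   [R -> X -> R], of which only the values at those times matter. *)
Definition pointwise_solution (phi : R -> R) (u0 : X -> R) (T : R)
  (u : R -> X -> R) : Prop :=
  [/\ forall t, t \in `]0, T[ -> lap_dom G (phi \o u t),
      forall x, {within `[0, T], continuous (u ^~ x)},
      forall x, (forall t, t \in `]0, T[ -> derivable (u ^~ x) t 1)
        /\ {in `]0, T[, continuous (derive1 (u ^~ x))},
      forall t x, t \in `]0, T[ ->
        derive1 (u ^~ x) t + lap G (phi \o u t) x = 0
    & forall x, u 0 x = u0 x].

Definition bounded_pointwise_solution (phi : R -> R) (u0 : X -> R) (T : R)
  (u : R -> X -> R) : Prop :=
  pointwise_solution phi u0 T u /\
  exists M : R, forall t x, t \in `[0, T] -> `|u t x| <= M.

Definition global_bounded_pointwise_solution (phi : R -> R) (u0 : X -> R)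
  (u : R -> X -> R) : Prop :=
  (forall T, 0 < T -> pointwise_solution phi u0 T u) /\
  exists M : R, forall t x, 0 <= t -> `|u t x| <= M.

(* The restriction of [u] to [0, T] x X, encoded by its extension by zero. *)
Definition restr_time (T : R) (u : R -> X -> R) : R -> X -> R :=
  fun t x => if t \in `[0, T] then u t x else 0.

End GPME.

(* Main.v *)
(* If [G] is incomplete then for every [K > 0] there is [0 <= W <= 1], [W <> 0],
   with [lap W = - K W]: otherwise the limits of the resolvents of
   [1 + lam * kappa / mu] are all [1], and implicit Euler schemes carry this over
   to the semigroup, giving completeness.  Cutting [W] off near its supremum
   yields a barrier [0 <= g <= 1] with [lap g <= - K] where [g > 0].

   Solve the explicit Euler scheme of the equation on the first [n] vertices,
   with the constant value [a] outside and with [phi] replaced by a Lipschitz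
   Yosida regularisation.  The scheme is monotone, so it is bounded, and an
   ultrafilter limit [n -> oo] gives a bounded solution [u^a] on all of
   [[0, oo)] with datum [u0].  For [b <= a], the time integral [v] up to [S] of
   the difference of the regularised [phi o u^a] and [phi o u^b] equals a constant
   [c], close to [S (phi a - phi b)], outside the first [n] vertices, while
   [lap v = u^b - u^a >= - 2 A] inside.  If [c K > 2 A], comparison
   gives [v >= c g], hence [u^a] and [u^b] differ before time [S] as soon as
   [phi a <> phi b]. *)
From HB Require Import structures.
From mathcomp Require Import all_boot all_order all_algebra.
From mathcomp Require Import all_classical all_reals all_analysis.
From mathcomp Require Import ring lra.
Require Import Defs.
Import Order.TTheory GRing.Theory Num.Theory.
Import numFieldNormedType.Exports.
Set Implicit Arguments.
Unset Strict Implicit.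
Unset Printing Implicit Defensive.
Local Open Scope classical_set_scope.
Local Open Scope ring_scope.

(** [is_heat_semigroup] records boundedness of each operator, strong continuity and the generator.
    Positivity and a norm bound uniform in time are not part of it and must be extracted through the
    generator. The bridge is the exponential formula: resolvents arise by minimising over finitely
    supported functions, where truncation yields the maximum principles, and their iterates converge
    to the semigroup. Completeness asks for equality at one time only, so it is tested at [lam / 2],
    where [lam = 1 / K] is the resolvent parameter. Degrees may be unbounded over [X] and [phi] need
    not be Lipschitz. Regularisation, number of active vertices and time step are therefore tied to
    one index [n], so that the stability condition of the explicit scheme concerns finitely many
    vertices. The ultrafilter gives limits at all vertices and all times at once; regularity in time
    is then recovered from the scheme. Since [K] is arbitrary, taking it of order
    [A / (S * (phi a - phi b))] separates two solutions on any time interval, however short. *)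

Lemma ler_cvg (R : realType) (T : Type) (F : set_system T)
  {FF : ProperFilter F} (f g : T -> R) (a b : R) :
  f t @[t --> F] --> a -> g t @[t --> F] --> b ->
  (\forall t \near F, f t <= g t) -> a <= b.
Proof.
move=> fa gb fg; rewrite -subr_le0.
have h : (f t - g t) @[t --> F] --> a - b by exact: cvgB.
rewrite -(cvg_lim (@Rhausdorff R) h).
apply: limr_le; first by apply/cvg_ex; exists (a - b); exact: h.
by apply: filterS fg => t; rewrite /= subr_le0.
Qed.

(** * Unordered real sums as limits of partial sums; dominated convergence and Fatou *)

Section RealSums.
Variables (R : realType) (I : countType).
Implicit Types (f g : I -> R).

(** Indices that code no element contribute [0], which turns a sum over [I] into an ordinary series
    in [pickle] order. *)
Definition fnat f (k : nat) : R :=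
  if @pickle_inv I k is Some i then f i else 0.

Definition psum f (n : nat) : R := \sum_(k < n) fnat f k.

Lemma fnat_pickle f i : fnat f (pickle i) = f i.
Proof. by rewrite /fnat pickleK_inv. Qed.

Lemma esum_fnat f : (forall i, 0 <= f i) ->
  (\esum_(i in [set: I]) (f i)%:E = \sum_(k <oo) (fnat f k)%:E)%E.
Proof.
move=> f0; rewrite nneseries_esumT; last first.
  by move=> n; rewrite lee_fin /fnat; case: pickle_inv.
have -> : (\esum_(i in [set: I]) (f i)%:E =
           \esum_(i in [set: I]) (fnat f (pickle i))%:E)%E.
  by apply: eq_esum => i _; rewrite fnat_pickle.
rewrite -(esum_image setT (@pickle I) (fun k => (fnat f k)%:E)); last first.
  by move=> x y _ _; exact: (pcan_inj (@pickleK_inv I)).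
rewrite esum_mkcond; apply: eq_esum => k _; case: ifPn => // /negP kI.
rewrite /fnat; have := @pickle_invK I k; case: pickle_inv => //= i ik.
by case: kI; rewrite inE; exists i.
Qed.

Lemma psum_ge0 f n : (forall i, 0 <= f i) -> 0 <= psum f n.
Proof.
by move=> f0; apply: sumr_ge0 => k _; rewrite /fnat; case: pickle_inv.
Qed.

Lemma psumE f n : (forall i, 0 <= f i) ->
  (\sum_(0 <= k < n) (fnat f k)%:E)%E = (psum f n)%:E.
Proof. by move=> f0; rewrite sumEFin big_mkord. Qed.

Lemma ge0_psum_cvg f (C : R) : (forall i, 0 <= f i) ->
  (forall n, psum f n <= C) ->
  (\esum_(i in [set: I]) (f i)%:E)%E \is a fin_num /\
  psum f n @[n --> \oo] --> fine (\esum_(i in [set: I]) (f i)%:E)%E.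
Proof.
move=> f0 fC; rewrite esum_fnat //.
have fk0 k : (0 <= (fnat f k)%:E)%E.
  by rewrite lee_fin /fnat; case: pickle_inv.
have cv := is_cvg_nneseries (fun k (_ : (0 <= k)%N) (_ : true) => fk0 k).
set l := (\sum_(k <oo) _)%E.
have lf : l \is a fin_num.
  rewrite ge0_fin_numE; last by apply: nneseries_ge0.
  apply: (@le_lt_trans _ _ C%:E); last by rewrite ltry.
  by apply: lime_le => //; apply: nearW => n; rewrite psumE // lee_fin.
split => //.
have : (\sum_(0 <= k < n) (fnat f k)%:E)%E @[n --> \oo] --> (fine l)%:E.
  by rewrite fineK //; exact: cv.
move=> /fine_cvg; apply: cvg_trans; apply: near_eq_cvg.
by apply: nearW => n /=; rewrite psumE.
Qed.

Lemma abs_summableP f :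
  abs_summable f <-> exists C, forall n, psum (fun i => `|f i|) n <= C.
Proof.
have f0 i : 0 <= `|f i| by [].
split => [|[C fC]].
  rewrite /abs_summable /summable.
  have -> : (\esum_(i in [set: I]) `|(EFin \o f) i| =
             \esum_(i in [set: I]) `|f i|%:E)%E by [].
  rewrite esum_fnat // => fs.
  have fk0 k : (0 <= (fnat (fun i => `|f i|) k)%:E)%E.
    by rewrite lee_fin /fnat; case: pickle_inv.
  set l := (\sum_(k <oo) _)%E in fs.
  have lf : l \is a fin_num by rewrite ge0_fin_numE //; apply: nneseries_ge0.
  exists (fine l) => n; rewrite -lee_fin fineK // -psumE //.
  by apply: nneseries_lim_ge.
have [fin _] := ge0_psum_cvg f0 fC.
rewrite /abs_summable /summable.
have -> : (\esum_(i in [set: I]) `|(EFin \o f) i| =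
           \esum_(i in [set: I]) `|f i|%:E)%E by [].
by rewrite -ge0_fin_numE //; apply: esum_ge0.
Qed.

Lemma ler_psum f g n : (forall i, f i <= g i) -> psum f n <= psum g n.
Proof.
move=> fg; apply: ler_sum => k _; rewrite /fnat.
by case: pickle_inv => // i; exact: fg.
Qed.

Lemma psum_cat f m n : (m <= n)%N ->
  psum f n = psum f m + \sum_(m <= k < n) fnat f k.
Proof. by move=> mn; rewrite /psum -!(big_mkord xpredT (fnat f)) -big_cat_nat. Qed.

Lemma psumD f g n : psum (fun i => f i + g i) n = psum f n + psum g n.
Proof.
rewrite /psum -big_split /=; apply: eq_bigr => k _; rewrite /fnat.
by case: pickle_inv => //; rewrite addr0.
Qed.

Lemma psumZ a f n : psum (fun i => a * f i) n = a * psum f n.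
Proof.
rewrite /psum mulr_sumr; apply: eq_bigr => k _; rewrite /fnat.
by case: pickle_inv => //; rewrite mulr0.
Qed.

Lemma psum_cvg f : abs_summable f -> psum f n @[n --> \oo] --> rsum f.
Proof.
move=> /abs_summableP[C fC].
have p0 (g : I -> R) i : 0 <= Num.max (g i) 0 by rewrite le_max lexx orbT.
have pC n : psum (fun i => Num.max (f i) 0) n <= C.
  apply: le_trans (fC n); apply: ler_psum => i.
  by rewrite ge_max ler_norm normr_ge0.
have nC n : psum (fun i => Num.max (- f i) 0) n <= C.
  apply: le_trans (fC n); apply: ler_psum => i.
  by rewrite ge_max -normrN ler_norm normr_ge0.
have [pf pcv] := ge0_psum_cvg (p0 f) pC.
have [nf ncv] := ge0_psum_cvg (p0 (fun i => - f i)) nC.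
rewrite /rsum fineB //.
have -> : psum f = fun n => psum (fun i => Num.max (f i) 0) n -
                            psum (fun i => Num.max (- f i) 0) n.
  apply/funext => n; rewrite -[X in _ - X]mul1r -mulNr -psumZ -psumD.
  congr (psum _ n); apply/funext => i; rewrite mulN1r.
  have [h|h] := leP (f i) 0.
    by rewrite max_l ?oppr_ge0 // opprK add0r.
  by rewrite max_r ?oppr_le0 ?subr0 // ltW.
exact: cvgB.
Qed.

Lemma rsum_lim f l : abs_summable f -> psum f n @[n --> \oo] --> l ->
  rsum f = l.
Proof. by move=> /psum_cvg fl; apply: cvg_unique fl. Qed.

Lemma abs_summable_le f g : abs_summable g -> (forall i, `|f i| <= `|g i|) ->
  abs_summable f.
Proof.
move=> /abs_summableP[C gC] fg; apply/abs_summableP; exists C => n.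
exact: le_trans (ler_psum n fg) (gC n).
Qed.

Lemma abs_summableD f g : abs_summable f -> abs_summable g ->
  abs_summable (fun i => f i + g i).
Proof.
move=> /abs_summableP[C fC] /abs_summableP[D gD]; apply/abs_summableP.
exists (C + D) => n; apply: (le_trans _ (lerD (fC n) (gD n))).
by rewrite -psumD; apply: ler_psum => i; exact: ler_normD.
Qed.

Lemma abs_summableZ a f : abs_summable f -> abs_summable (fun i => a * f i).
Proof.
move=> /abs_summableP[C fC]; apply/abs_summableP; exists (`|a| * C) => n.
have -> : (fun i => `|a * f i|) = (fun i => `|a| * `|f i|).
  by apply/funext => i; rewrite normrM.
by rewrite psumZ ler_wpM2l.
Qed.

Lemma abs_summableN f : abs_summable f -> abs_summable (fun i => - f i).
Proof. by move=> fs; apply: (abs_summable_le fs) => i; rewrite normrN. Qed.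

Lemma abs_summable0 : abs_summable (fun _ : I => 0 : R).
Proof.
apply/abs_summableP; exists 0 => n.
by rewrite /psum big1 // => k _; rewrite /fnat; case: pickle_inv; rewrite // normr0.
Qed.

Lemma rsumD f g : abs_summable f -> abs_summable g ->
  rsum (fun i => f i + g i) = rsum f + rsum g.
Proof.
move=> fs gs; apply: rsum_lim; first exact: abs_summableD.
have -> : psum (fun i => f i + g i) = fun n => psum f n + psum g n.
  by apply/funext => n; rewrite psumD.
by apply: cvgD; exact: psum_cvg.
Qed.

Lemma rsumZ a f : abs_summable f -> rsum (fun i => a * f i) = a * rsum f.
Proof.
move=> fs; apply: rsum_lim; first exact: abs_summableZ.
have -> : psum (fun i => a * f i) = fun n => a * psum f n.
  by apply/funext => n; rewrite psumZ.
by apply: cvgM; [exact: cvg_cst|exact: psum_cvg].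
Qed.

Lemma rsumN f : abs_summable f -> rsum (fun i => - f i) = - rsum f.
Proof.
move=> fs; rewrite -mulN1r -rsumZ //; congr rsum.
by apply/funext => i; rewrite mulN1r.
Qed.

Lemma rsumB f g : abs_summable f -> abs_summable g ->
  rsum (fun i => f i - g i) = rsum f - rsum g.
Proof.
by move=> fs gs; rewrite rsumD ?rsumN //; exact: abs_summableN.
Qed.

Lemma rsum0 : rsum (fun _ : I => 0 : R) = 0.
Proof.
apply: rsum_lim; first exact: abs_summable0.
have -> : psum (fun=> 0) = (fun=> 0).
  apply/funext => n; rewrite /psum big1 // => k _.
  by rewrite /fnat; case: pickle_inv.
exact: cvg_cst.
Qed.

Lemma ler_rsum f g : abs_summable f -> abs_summable g ->
  (forall i, f i <= g i) -> rsum f <= rsum g.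
Proof.
move=> /psum_cvg fs /psum_cvg gs fg; apply: (ler_cvg fs gs).
by apply: nearW => n; exact: ler_psum.
Qed.

Lemma rsum_ge0 f : abs_summable f -> (forall i, 0 <= f i) -> 0 <= rsum f.
Proof. by move=> fs f0; rewrite -rsum0 ler_rsum //; exact: abs_summable0. Qed.

Lemma abs_summable_norm f : abs_summable f -> abs_summable (fun i => `|f i|).
Proof. by move=> fs; apply: (abs_summable_le fs) => i; rewrite normr_id. Qed.

Lemma ler_norm_rsum f : abs_summable f -> `|rsum f| <= rsum (fun i => `|f i|).
Proof.
move=> fs; have ns := abs_summable_norm fs; rewrite ler_norml -rsumN //.
by rewrite !ler_rsum //; try (by move=> i; rewrite ?lerNnormlW ?ler_norm);
  exact: abs_summableN.
Qed.

Lemma ge0_psum_ubound f n : abs_summable f -> (forall i, 0 <= f i) ->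
  psum f n <= rsum f.
Proof.
move=> fs f0; rewrite -(cvg_lim (@Rhausdorff R) (psum_cvg fs)).
apply: nondecreasing_cvgn_le; last first.
  by apply/cvg_ex; exists (rsum f); exact: psum_cvg.
move=> m k mk; rewrite (psum_cat f mk) lerDl sumr_ge0 // => i _.
by rewrite /fnat; case: pickle_inv.
Qed.

Lemma ge0_rsum_bound f (C : R) : (forall i, 0 <= f i) ->
  (forall n, psum f n <= C) -> abs_summable f /\ rsum f <= C.
Proof.
move=> f0 fC.
have fs : abs_summable f.
  apply/abs_summableP; exists C => n; apply: le_trans (fC n).
  by apply: ler_psum => i; rewrite ger0_norm.
split=> //; apply: (ler_cvg (psum_cvg fs) (cvg_cst C)).
by apply: nearW => n; exact: fC.
Qed.

Lemma ge0_le_rsum f i : abs_summable f -> (forall j, 0 <= f j) ->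
  f i <= rsum f.
Proof.
move=> fs f0; apply: le_trans (ge0_psum_ubound (pickle i).+1 fs f0).
rewrite /psum big_ord_recr /= fnat_pickle lerDr sumr_ge0 // => k _.
by rewrite /fnat; case: pickle_inv.
Qed.

Lemma ler_rsum_bound f b : abs_summable b -> (forall i, `|f i| <= b i) ->
  abs_summable f /\ `|rsum f| <= rsum b.
Proof.
move=> bs fb; have fs : abs_summable f.
  apply: (abs_summable_le bs) => i; apply: le_trans (fb i) _.
  exact: ler_norm.
split=> //; apply: le_trans (ler_norm_rsum fs) _.
by apply: ler_rsum => //; exact: abs_summable_norm.
Qed.

Lemma psum_near_cvg (T : Type) (F : set_system T) {FF : Filter F}
  (f : T -> I -> R) (l : I -> R) n :
  (forall i, f t i @[t --> F] --> l i) -> psum (f t) n @[t --> F] --> psum l n.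
Proof.
move=> fl; rewrite /psum; apply: cvg_big => [|k _]; last first.
  by rewrite /fnat; case: pickle_inv => [i|]; [exact: fl|exact: cvg_cst].
by move=> x; exact: (@add_continuous R^o x).
Qed.

(** Stated for any proper filter because it is applied along an ultrafilter and along [grid_filter].
    The tail of [b] controls the tails of all dominated functions at once, which leaves a finite
    sum. *)
Lemma dominated_rsum (T : Type) (F : set_system T) {FF : ProperFilter F}
  (f : T -> I -> R) (l b : I -> R) :
  (forall i, f t i @[t --> F] --> l i) -> abs_summable b ->
  (\forall t \near F, forall i, `|f t i| <= b i) ->
  abs_summable l /\ rsum (f t) @[t --> F] --> rsum l.
Proof.
move=> fl bs fb.
have lb i : `|l i| <= b i.
  apply: (ler_cvg (cvg_norm (fl i)) (cvg_cst (b i))).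
  by near=> t; move: i; near: t.
have [ls _] := ler_rsum_bound bs lb; split=> //.
apply/cvgrPdist_le => e e0.
have e4 : 0 < e / 4 by rewrite divr_gt0.
have /cvgrPdist_le/(_ _ e4)[N _ /(_ N (leqnn N)) /= bN] := psum_cvg bs.
have tail (g : I -> R) : (forall i, `|g i| <= b i) ->
    `|rsum g - psum g N| <= e / 4.
  move=> gb; have [gs _] := ler_rsum_bound bs gb.
  have gd : `|psum g n - psum g N| @[n --> \oo] --> `|rsum g - psum g N|.
    by apply: cvg_norm; apply: cvgB; [exact: psum_cvg|exact: cvg_cst].
  have bd : (psum b n - psum b N) @[n --> \oo] --> rsum b - psum b N.
    by apply: cvgB; [exact: psum_cvg|exact: cvg_cst].
  apply: le_trans (le_trans (ler_norm _) bN).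
  apply: (ler_cvg gd bd); near=> n.
  have Nn : (N <= n)%N by near: n; exists N.
  rewrite !(psum_cat _ Nn) !(addrC (psum _ N)) !addrK.
  apply: le_trans (ler_norm_sum _ _ _) _; apply: ler_sum => k _.
  by rewrite /fnat; case: pickle_inv => //; rewrite normr0.
near=> t.
have ftb : forall i, `|f t i| <= b i by near: t.
have h1 := tail _ lb; have h2 := tail _ ftb.
have h3 : `|psum l N - psum (f t) N| <= e / 4.
  near: t; apply: cvgr_dist_le => //; exact: psum_near_cvg.
have -> : rsum l - rsum (f t) = (rsum l - psum l N)
   + (psum l N - psum (f t) N) - (rsum (f t) - psum (f t) N) by ring.
apply: le_trans (ler_normB _ _) _.
have := ler_normD (rsum l - psum l N) (psum l N - psum (f t) N).
lra.
Unshelve. all: by end_near. Qed.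

(** Every finite partial sum passes to the limit and stays below [C]. *)
Lemma ge0_fatou_rsum (T : Type) (F : set_system T) {FF : ProperFilter F}
  (f : T -> I -> R) (l : I -> R) (C : R) :
  (forall i, f t i @[t --> F] --> l i) -> (forall t i, 0 <= f t i) ->
  (\forall t \near F, abs_summable (f t) /\ rsum (f t) <= C) ->
  abs_summable l /\ rsum l <= C.
Proof.
move=> fl f0 fC; apply: ge0_rsum_bound => [i|n].
  by apply: (ler_cvg (cvg_cst 0) (fl i)); apply: nearW => t; exact: f0.
apply: (ler_cvg (psum_near_cvg (n := n) fl) (cvg_cst C)); near=> t.
have [fs fr] : abs_summable (f t) /\ rsum (f t) <= C by near: t.
by apply: le_trans fr; exact: ge0_psum_ubound.
Unshelve. all: by end_near. Qed.

End RealSums.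

Lemma rsum_inj (R : realType) (I J : countType) (e : I -> J) (F : J -> R) :
  injective e -> (forall j, ~ range e j -> F j = 0) ->
  abs_summable (F \o e) -> abs_summable F /\ rsum F = rsum (F \o e).
Proof.
move=> ei F0.
have reindex (a : J -> \bar R) : (forall j, ~ range e j -> a j = 0%E) ->
    (\esum_(j in [set: J]) a j = \esum_(i in [set: I]) a (e i))%E.
  move=> a0; rewrite -(esum_image setT e a); last by move=> x y _ _; exact: ei.
  rewrite [RHS]esum_mkcond; apply: eq_esum => j _; case: ifPn => // /negP je.
  by rewrite a0 // => je'; apply: je; rewrite inE.
rewrite /abs_summable /summable /rsum => s; split.
  by rewrite reindex // => j je /=; rewrite F0 // normr0.
by rewrite !reindex // => j je; rewrite F0 // ?oppr0 maxxx.
Qed.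

(** Discriminant argument allowing [c = 0]; it serves as Cauchy-Schwarz for forms that are only
    semidefinite. *)
Lemma quadratic_ge0 (R : realType) (a b c : R) :
  0 <= c -> (forall t, 0 <= a + 2 * t * b + t ^+ 2 * c) -> b ^+ 2 <= a * c.
Proof.
rewrite le_eqVlt => /orP[/eqP c0 h|c0 h]; last first.
  have := h (- b / c); rewrite -(pmulr_lge0 _ c0).
  have -> : (a + 2 * (- b / c) * b + (- b / c) ^+ 2 * c) * c = a * c - b ^+ 2.
    by field; exact: lt0r_neq0.
  by rewrite subr_ge0.
have [->|b0] := eqVneq b 0; first by rewrite -c0 mulr0 expr0n.
(* With [c = 0] the polynomial is affine, and at this point it takes the value [-1]. *)
have := h (- (a + 1) / (2 * b)); rewrite -c0 mulr0 addr0.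
have -> : a + 2 * (- (a + 1) / (2 * b)) * b = -1 by field.
by rewrite oppr_ge0 ler10.
Qed.

(** * The weighted space [l2]: norm, Cauchy-Schwarz, completeness *)

Section HilbertSpace.
Variables (R : realType) (X : countType) (G : graph R X).
Local Notation mu := (vmeas G).
Local Notation l2 := (l2 G).
Local Notation ip := (l2_inner G).
Local Notation nm := (l2_norm G).
Implicit Types (f g h : X -> R).

Lemma mu_ge0 x : 0 <= mu x. Proof. exact/ltW/vmeas_gt0. Qed.

Lemma l2_prod f g : l2 f -> l2 g -> abs_summable (fun x => f x * g x * mu x).
Proof.
move=> fs gs; have h := abs_summableD fs gs.
apply: (abs_summable_le h) => x; rewrite -mulrDl !normrM ler_wpM2r //.
rewrite -normrM [leRHS]ger0_norm ?addr_ge0 ?sqr_ge0 // ler_norml.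
have := sqr_ge0 (f x + g x); have := sqr_ge0 (f x - g x).
have := sqr_ge0 (f x); have := sqr_ge0 (g x); nra.
Qed.

Lemma l2Z a f : l2 f -> l2 (a *: f).
Proof.
move=> fs; have h := abs_summableZ (a ^+ 2) fs.
apply: (abs_summable_le h) => x; rewrite /= /GRing.scale /=.
by rewrite exprMn mulrA.
Qed.

Lemma l2D f g : l2 f -> l2 g -> l2 (f + g).
Proof.
move=> fs gs; have h := abs_summableD (abs_summableZ 2 fs) (abs_summableZ 2 gs).
apply: (abs_summable_le h) => x; rewrite !fctE.
rewrite [leLHS]ger0_norm; last exact: mulr_ge0 (sqr_ge0 _) (mu_ge0 _).
apply: le_trans (ler_norm _); rewrite !mulrA -mulrDl ler_wpM2r ?mu_ge0 //.
by have := sqr_ge0 (f x - g x); nra.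
Qed.

Lemma l2N f : l2 f -> l2 (- f).
Proof. by move=> fs; rewrite -scaleN1r; exact: l2Z. Qed.

Lemma l2B f g : l2 f -> l2 g -> l2 (f - g).
Proof. by move=> fs gs; apply: l2D => //; exact: l2N. Qed.

Lemma l2_0 : l2 0.
Proof.
have h := abs_summable0 R X.
by apply: (abs_summable_le h) => x; rewrite [X in X ^+ 2]/= expr0n mul0r.
Qed.

Lemma ipC f g : ip f g = ip g f.
Proof. by congr rsum; apply/funext => x; ring. Qed.

Lemma ipZl a f g : l2 f -> l2 g -> ip (a *: f) g = a * ip f g.
Proof.
move=> fs gs; rewrite /l2_inner -rsumZ; last exact: l2_prod.
by congr rsum; apply/funext => x; rewrite /GRing.scale /= /GRing.scale /=; ring.
Qed.

Lemma ipDl f g h : l2 f -> l2 g -> l2 h -> ip (f + g) h = ip f h + ip g h.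
Proof.
move=> fs gs hs; rewrite /l2_inner -rsumD; try exact: l2_prod.
by congr rsum; apply/funext => x; rewrite fctE; ring.
Qed.

Lemma ipBl f g h : l2 f -> l2 g -> l2 h -> ip (f - g) h = ip f h - ip g h.
Proof.
move=> fs gs hs; rewrite ipDl //; last exact: l2N.
by rewrite -scaleN1r ipZl // mulN1r.
Qed.

Lemma ip_ge0 f : l2 f -> 0 <= ip f f.
Proof.
move=> fs; apply: rsum_ge0 => [|x]; first exact: l2_prod.
by rewrite -expr2 mulr_ge0 ?sqr_ge0 // mu_ge0.
Qed.

Lemma nm_ge0 f : 0 <= nm f. Proof. exact: sqrtr_ge0. Qed.

Lemma nm_sqr f : l2 f -> nm f ^+ 2 = ip f f.
Proof. by move=> fs; rewrite sqr_sqrtr // ip_ge0. Qed.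

Lemma ip_quad f g t : l2 f -> l2 g ->
  ip (f + t *: g) (f + t *: g) = ip f f + 2 * t * ip f g + t ^+ 2 * ip g g.
Proof.
move=> fs gs; have tgs := l2Z t gs.
rewrite ipDl //; last exact: l2D.
rewrite ipZl //; last exact: l2D.
rewrite !(ipC _ (_ + _)) !ipDl // !ipZl // (ipC g f); ring.
Qed.

Lemma ip_cs f g : l2 f -> l2 g -> `|ip f g| <= nm f * nm g.
Proof.
move=> fs gs; rewrite -(@ler_pXn2r _ 2) //; last by rewrite nnegrE mulr_ge0 ?nm_ge0.
rewrite -normrX ger0_norm ?sqr_ge0 // exprMn !nm_sqr //.
apply: quadratic_ge0 => [|t]; first exact: ip_ge0.
by rewrite -ip_quad //; apply: ip_ge0; apply: l2D => //; exact: l2Z.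
Qed.

Lemma nmZ a f : l2 f -> nm (a *: f) = `|a| * nm f.
Proof.
move=> fs; rewrite /l2_norm ipZl //; last exact: l2Z.
by rewrite ipC ipZl // mulrA -expr2 sqrtrM ?sqr_ge0 // sqrtr_sqr.
Qed.

Lemma nmN f : l2 f -> nm (- f) = nm f.
Proof. by move=> fs; rewrite -scaleN1r nmZ // normrN1 mul1r. Qed.

Lemma nmD f g : l2 f -> l2 g -> nm (f + g) <= nm f + nm g.
Proof.
move=> fs gs; have fgs := l2D fs gs.
rewrite -(@ler_pXn2r _ 2) //; last first.
- by rewrite nnegrE addr_ge0 ?nm_ge0.
- by rewrite nnegrE nm_ge0.
rewrite nm_sqr // -[in f + g](scale1r g) ip_quad // sqrrD !nm_sqr //.
have := ip_cs fs gs; have := ler_norm (ip f g); lra.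
Qed.

Lemma nmBC f g : l2 f -> l2 g -> nm (f - g) = nm (g - f).
Proof. by move=> fs gs; rewrite -opprB nmN //; exact: l2B. Qed.

Lemma nmB_le f g : l2 f -> l2 g -> nm (f - g) <= nm f + nm g.
Proof. by move=> fs gs; rewrite -(nmN gs); apply: nmD => //; exact: l2N. Qed.

Lemma nm_triangle f g h : l2 f -> l2 g -> l2 h ->
  nm (f - h) <= nm (f - g) + nm (g - h).
Proof.
move=> fs gs hs; have -> : f - h = (f - g) + (g - h) by rewrite addrA subrK.
by apply: nmD; exact: l2B.
Qed.

(** Positivity of [mu x] makes evaluation at [x] continuous; this is how norm estimates become
    pointwise ones. *)
Lemma l2_pointwise f x : l2 f -> `|f x| <= (Num.sqrt (mu x))^-1 * nm f.
Proof.
move=> fs; have s0 : 0 < Num.sqrt (mu x) by rewrite sqrtr_gt0 vmeas_gt0.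
rewrite ler_pdivlMl // -(@ler_pXn2r _ 2) //; last first.
- by rewrite nnegrE nm_ge0.
- by rewrite nnegrE mulr_ge0 // ltW.
rewrite exprMn sqr_sqrtr ?mu_ge0 // nm_sqr // -normrX ger0_norm ?sqr_ge0 //.
rewrite mulrC expr2.
apply: (@ge0_le_rsum _ _ (fun x => f x * f x * mu x)); first exact: l2_prod.
by move=> y; rewrite -expr2 mulr_ge0 ?sqr_ge0 ?mu_ge0.
Qed.

Lemma l2_cvg_pointwise (T : Type) (F : set_system T) {FF : Filter F}
  (u : T -> X -> R) (v : X -> R) x : (forall t, l2 (u t)) -> l2 v ->
  nm (u t - v) @[t --> F] --> (0 : R) -> u t x @[t --> F] --> v x.
Proof.
move=> us vs uv; apply/cvgrPdist_le => e e0.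
have s0 : 0 < Num.sqrt (mu x) by rewrite sqrtr_gt0 vmeas_gt0.
have es : 0 < e * Num.sqrt (mu x) by rewrite mulr_gt0.
have /cvgrPdist_le/(_ _ es) := uv; apply: filterS => t.
rewrite sub0r normrN ger0_norm ?nm_ge0 // -ler_pdivrMr // => h.
rewrite distrC; apply: le_trans h; rewrite mulrC.
by have := l2_pointwise x (l2B (us t) vs); rewrite fctE.
Qed.

Lemma l2_fatou (T : Type) (F : set_system T) {FF : ProperFilter F}
  (u : T -> X -> R) (v : X -> R) (C : R) :
  (forall x, u t x @[t --> F] --> v x) ->
  (\forall t \near F, l2 (u t) /\ nm (u t) <= C) -> l2 v /\ nm v <= C.
Proof.
move=> uv uC.
have C0 : 0 <= C.
  have [t [_ h]] := filter_ex uC; exact: le_trans (nm_ge0 _) h.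
have cv x : u t x ^+ 2 * mu x @[t --> F] --> v x ^+ 2 * mu x.
  by apply: cvgM; [exact: cvgM|exact: cvg_cst].
have p0 t x : 0 <= u t x ^+ 2 * mu x by rewrite mulr_ge0 ?sqr_ge0 ?mu_ge0.
have b : \forall t \near F, abs_summable (fun x => u t x ^+ 2 * mu x) /\
    rsum (fun x => u t x ^+ 2 * mu x) <= C ^+ 2.
  apply: filterS uC => t [us un]; split => //.
  have -> : rsum (fun x => u t x ^+ 2 * mu x) = nm (u t) ^+ 2.
    by rewrite nm_sqr //; congr rsum; apply/funext => x; rewrite expr2.
  by rewrite ler_pXn2r // nnegrE nm_ge0.
have [vs vC] := ge0_fatou_rsum cv p0 b; split => //.
by rewrite -(@ler_pXn2r _ 2) // ?nnegrE ?nm_ge0 // nm_sqr.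
Qed.

(** The pointwise limit is the candidate, and [l2_fatou] applied to [u n - u m] as [m] grows gives
    both its membership and the rate. *)
Lemma l2_complete (u : nat -> X -> R) : (forall n, l2 (u n)) ->
  (forall e : R, 0 < e -> exists N, forall m n, (N <= m)%N -> (N <= n)%N ->
     nm (u m - u n) <= e) ->
  exists2 v, l2 v & nm (u n - v) @[n --> \oo] --> (0 : R).
Proof.
move=> us uC.
have pc x : cvgn (fun n => u n x).
  apply: R_complete; apply/cauchyP => e e0.
  have s0 : 0 < Num.sqrt (mu x) by rewrite sqrtr_gt0 vmeas_gt0.
  have es : 0 < e / 2 * Num.sqrt (mu x) by rewrite mulr_gt0 // divr_gt0.
  have [N hN] := uC _ es; exists (u N x).
  exists N => // n Nn /=; rewrite /ball /=.
  have h := l2_pointwise x (l2B (us N) (us n)); rewrite fctE in h.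
  apply: (le_lt_trans h); rewrite mulrC ltr_pdivrMr //.
  apply: le_lt_trans (hN _ _ (leqnn N) Nn) _; rewrite ltr_pM2r //; lra.
pose v x := limn (fun n => u n x).
have uv x : u n x @[n --> \oo] --> v x by exact: pc.
have key (e : R) : 0 < e -> exists N, forall n, (N <= n)%N ->
    l2 (u n - v) /\ nm (u n - v) <= e.
  move=> /uC[N hN]; exists N => n Nn.
  apply: (@l2_fatou _ \oo _ (fun m => u n - u m)) => [x|].
    by rewrite !fctE; apply: cvgB; [exact: cvg_cst|exact: uv].
  by exists N => // m Nm; split; [exact: l2B|exact: hN].
have vs : l2 v.
  have [N /(_ N (leqnn N))[h _]] := key 1 ltr01.
  by have := l2B (us N) h; rewrite opprB addrC subrK.
exists v => //; apply/cvgrPdist_le => e /key[N hN].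
exists N => // n Nn /=; rewrite sub0r normrN ger0_norm ?nm_ge0 //.
exact: (hN n Nn).2.
Qed.

End HilbertSpace.

(** * The closed energy form *)

Section Energy.
Variables (R : realType) (X : countType) (G : graph R X).
Local Notation w := (weight G).
Local Notation kappa := (killing G).
Local Notation l2 := (l2 G).
Local Notation E := (energy_form G).
Implicit Types (f g h : X -> R).

Lemma fin_supp_comp (phi : R -> R -> R) f g : phi 0 0 = 0 ->
  fin_supp f -> fin_supp g -> fin_supp (fun x => phi (f x) (g x)).
Proof.
move=> phi0 ff fg; apply: (@sub_finite_set _ _
  ([set x | f x != 0] `|` [set x | g x != 0])); last by rewrite finite_setU.
move=> x /=; apply: contraPP => /not_orP[/negP/negPn/eqP-> /negP/negPn/eqP->].
by rewrite phi0 eqxx.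
Qed.

Lemma fin_suppD f g : fin_supp f -> fin_supp g -> fin_supp (f + g).
Proof. by move=> ff fg; apply: (fin_supp_comp (phi := +%R)); rewrite ?addr0. Qed.

Lemma fin_suppB f g : fin_supp f -> fin_supp g -> fin_supp (f - g).
Proof.
by move=> ff fg; apply: (fin_supp_comp (phi := fun a b => a - b)); rewrite ?subr0.
Qed.

Lemma fin_suppZ a f : fin_supp f -> fin_supp (a *: f).
Proof.
move=> ff; apply: (fin_supp_comp (phi := fun b _ => a * b)) (ff) (ff).
exact: mulr0.
Qed.

Lemma fin_suppP f : fin_supp f <->
  exists N, forall x, (N <= pickle x)%N -> f x = 0.
Proof.
split=> [/finite_seqP[s fs]|[N hN]].
  exists (\max_(x <- s) pickle x).+1 => x; apply: contraTeq => fx.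
  have : [set x | f x != 0] x by [].
  by rewrite fs /= -leqNgt => xs; exact: leq_bigmax_seq.
apply: (@sub_finite_set _ _ [set x | (pickle x < N)%N]).
  by move=> x /=; rewrite ltnNge; apply: contra_neqN => /hN.
have -> : [set x : X | (pickle x < N)%N] = pickle @^-1` `I_N by [].
apply: finite_preimage; last exact: finite_II.
by move=> x y _ _; exact: (pcan_inj pickleK_inv).
Qed.

Lemma fin_trunc_fin_supp f n : fin_supp (fin_trunc f n).
Proof.
by apply/fin_suppP; exists n => x nx; rewrite /fin_trunc ltnNge nx.
Qed.

Lemma abs_summable_sum (I : countType) N (F : nat -> I -> R) :
  (forall k, abs_summable (F k)) -> abs_summable (fun i => \sum_(k < N) F k i).
Proof.
move=> Fs; elim: N => [|N IH].
  have h := abs_summable0 R I.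
  by apply: (abs_summable_le h) => i; rewrite big_ord0.
apply: (abs_summable_le (abs_summableD IH (Fs N))) => i.
by rewrite big_ord_recr.
Qed.

Lemma abs_summable_fin_supp f : fin_supp f -> abs_summable f.
Proof.
move=> /fin_suppP[N fN]; apply/abs_summableP.
exists (psum (fun x => `|f x|) N) => n.
have [nN|Nn] := leqP n N.
  rewrite (psum_cat _ nN) lerDl sumr_ge0 // => k _.
  by rewrite /fnat; case: pickle_inv.
rewrite (psum_cat _ (ltnW Nn)) big_nat_cond big1 ?addr0 // => k.
rewrite andbT => /andP[Nk _]; rewrite /fnat.
have := @pickle_invK X k; case: pickle_inv => //= x xk.
by rewrite fN ?normr0 // xk.
Qed.

Lemma l2_fin_supp f : fin_supp f -> l2 f.
Proof.
move=> ff; apply: abs_summable_fin_supp; apply: sub_finite_set ff => x /=.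
by apply: contra_neq => ->; rewrite expr0n mul0r.
Qed.

Lemma weight_sum x : abs_summable (w x).
Proof.
rewrite /abs_summable /summable; apply: le_lt_trans (weight_summable G x).
by apply: le_esum => y _ /=; rewrite lee_fin ger0_norm ?weight_ge0.
Qed.

Lemma energy_sum1 f : fin_supp f ->
  abs_summable (fun p : X * X => w p.1 p.2 * f p.1 ^+ 2).
Proof.
move=> /fin_suppP[N fN].
(* The double sum splits into the finitely many rows [k < N], each a multiple of a summable row of
   weights. *)
pose F k (p : X * X) := if pickle p.1 == k then w p.1 p.2 * f p.1 ^+ 2 else 0.
have Fs k : abs_summable (F k).
  case e : (@pickle_inv X k) => [x|]; last first.
    have h := abs_summable0 R (X * X)%type; apply: (abs_summable_le h) => p.
    rewrite /F; case: eqP => // pk; by rewrite -pk pickleK_inv in e.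
  have kx : pickle x = k by have := @pickle_invK X k; rewrite e.
  have [|||//] := @rsum_inj R X (X * X)%type (fun y => (x, y)) (F k).
  - by move=> y z [].
  - move=> [a b] nr; rewrite /F /=; case: eqP => // ak; case: nr.
    have -> : a = x by apply: (pcan_inj pickleK_inv); rewrite ak.
    by exists b.
  have h := abs_summableZ (f x ^+ 2) (weight_sum x).
  apply: (abs_summable_le h) => y; rewrite /F /= kx eqxx mulrC; exact: lexx.
apply: (abs_summable_le (abs_summable_sum N Fs)) => p.
have [pN|Np] := ltnP (pickle p.1) N; last first.
  by rewrite fN // expr0n mulr0 normr0.
rewrite (bigD1 (Ordinal pN)) //= /F eqxx big1 ?addr0 // => k /eqP kp.
by case: eqP => // pk; case: kp; apply: val_inj.
Qed.

Lemma energy_sum2 f : fin_supp f ->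
  abs_summable (fun p : X * X => w p.1 p.2 * f p.2 ^+ 2).
Proof.
move=> ff; have h := energy_sum1 ff.
have [|||//] := @rsum_inj R _ _ (fun p : X * X => (p.2, p.1))
   (fun p : X * X => w p.1 p.2 * f p.2 ^+ 2).
- by move=> [a b] [c d] [-> ->].
- by move=> [a b] nr; case: nr; exists (b, a).
by apply: (abs_summable_le h) => p /=; rewrite weight_sym.
Qed.

(** The product of differences is dominated by the sum of the four squares. *)
Lemma energy_sum f g : fin_supp f -> fin_supp g ->
  abs_summable (fun p : X * X => w p.1 p.2 * (f p.1 - f p.2) * (g p.1 - g p.2)).
Proof.
move=> ff fg.
have h := abs_summableD (abs_summableD (energy_sum1 ff) (energy_sum2 ff))
  (abs_summableD (energy_sum1 fg) (energy_sum2 fg)).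
apply: (abs_summable_le h) => p; rewrite -!mulrDr -mulrA !normrM.
rewrite ler_wpM2l // -normrM.
set a := f _; set b := f _; set c := g _; set d := g _.
have a2 := sqr_ge0 a; have b2 := sqr_ge0 b; have c2 := sqr_ge0 c.
have d2 := sqr_ge0 d.
rewrite [leRHS]ger0_norm ?addr_ge0 // ler_norml.
have := sqr_ge0 (a - b + (c - d)); have := sqr_ge0 (a - b - (c - d)).
by have := sqr_ge0 (a + b); have := sqr_ge0 (c + d); nra.
Qed.

Lemma killing_sum f g : fin_supp f -> fin_supp g ->
  abs_summable (fun x => kappa x * f x * g x).
Proof.
move=> ff fg; apply: abs_summable_fin_supp; apply: sub_finite_set ff => x /=.
by apply: contra_neq => ->; rewrite mulr0 mul0r.
Qed.

Lemma energyC f g : E f g = E g f.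
Proof.
rewrite /energy_form; congr (_ * _ + _); congr rsum; apply/funext => p; ring.
Qed.

Lemma energyDl f g h : fin_supp f -> fin_supp g -> fin_supp h ->
  E (f + g) h = E f h + E g h.
Proof.
move=> ff fg fh; rewrite /energy_form.
rewrite [RHS]addrACA -mulrDr -!rsumD; try exact: energy_sum; try exact: killing_sum.
by congr (_ * _ + _); congr rsum; apply/funext => p; rewrite !fctE; ring.
Qed.

Lemma energyZl a f h : fin_supp f -> fin_supp h -> E (a *: f) h = a * E f h.
Proof.
move=> ff fh; rewrite /energy_form mulrDr mulrCA.
rewrite -(rsumZ a (energy_sum ff fh)) -(rsumZ a (killing_sum ff fh)).
congr (_ * _ + _); congr rsum; apply/funext => p;
  rewrite /GRing.scale /= /GRing.scale /=; ring.
Qed.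

Lemma energyBl f g h : fin_supp f -> fin_supp g -> fin_supp h ->
  E (f - g) h = E f h - E g h.
Proof.
move=> ff fg fh; rewrite -scaleN1r energyDl // ?energyZl ?mulN1r //.
exact: fin_suppZ.
Qed.

Lemma energy_pos_part f (p : X * X) :
  0 <= w p.1 p.2 * (f p.1 - f p.2) * (f p.1 - f p.2).
Proof. by rewrite -mulrA mulr_ge0 ?weight_ge0 // -expr2 sqr_ge0. Qed.

Lemma killing_pos_part f x : 0 <= kappa x * f x * f x.
Proof. by rewrite -mulrA mulr_ge0 ?killing_ge0 // -expr2 sqr_ge0. Qed.

Lemma energy_ge0 f : fin_supp f -> 0 <= E f f.
Proof.
move=> ff; rewrite addr_ge0 ?mulr_ge0 // rsum_ge0 //.
- exact: energy_sum.
- exact: energy_pos_part.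
- exact: killing_sum.
- exact: killing_pos_part.
Qed.

Lemma energy_quad f g t : fin_supp f -> fin_supp g ->
  E (f + t *: g) (f + t *: g) = E f f + 2 * t * E f g + t ^+ 2 * E g g.
Proof.
move=> fs gs; have tgs := fin_suppZ t gs.
rewrite energyDl //; last exact: fin_suppD.
rewrite energyZl //; last exact: fin_suppD.
rewrite !(energyC _ (_ + _)) !energyDl // !energyZl // (energyC g f); ring.
Qed.

Lemma energy_cs f g : fin_supp f -> fin_supp g ->
  E f g ^+ 2 <= E f f * E g g.
Proof.
move=> fs gs; apply: quadratic_ge0 => [|t]; first exact: energy_ge0.
rewrite -energy_quad //; apply: energy_ge0; apply: fin_suppD => //.
exact: fin_suppZ.
Qed.

Lemma energyD_le f g : fin_supp f -> fin_supp g ->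
  E (f + g) (f + g) <= 2 * (E f f + E g g).
Proof.
move=> ff fg.
have h := energy_ge0 (fin_suppB ff fg).
have e1 := energy_quad 1 ff fg; have e2 := energy_quad (-1) ff fg.
rewrite scale1r in e1; rewrite scaleN1r in e2; rewrite e1; rewrite e2 in h; lra.
Qed.

Lemma energyN f : fin_supp f -> E (- f) (- f) = E f f.
Proof.
move=> ff; rewrite -scaleN1r energyZl //; last exact: fin_suppZ.
by rewrite energyC energyZl // mulrA mulrNN mulr1 mul1r.
Qed.

Lemma energyB_le f g : fin_supp f -> fin_supp g ->
  E (f - g) (f - g) <= 2 * (E f f + E g g).
Proof.
move=> ff fg; rewrite -(energyN fg); apply: energyD_le => //.
by rewrite -scaleN1r; exact: fin_suppZ.
Qed.

(** Fatou is applied separately to the edge sum and to the killing sum, each bounded by the whole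
    energy; this costs the factor [2], harmless for closability. *)
Lemma energy_fatou (T : Type) (F : set_system T) {FF : ProperFilter F}
  (u : T -> X -> R) (v : X -> R) (C : R) : fin_supp v ->
  (forall x, u t x @[t --> F] --> v x) ->
  (\forall t \near F, fin_supp (u t) /\ E (u t) (u t) <= C) -> E v v <= 2 * C.
Proof.
move=> fv uv uC.
have cv1 (p : X * X) : w p.1 p.2 * (u t p.1 - u t p.2) * (u t p.1 - u t p.2)
   @[t --> F] --> w p.1 p.2 * (v p.1 - v p.2) * (v p.1 - v p.2).
  by do 2 (apply: cvgM; last exact: cvgB); exact: cvg_cst.
have cv2 x : kappa x * u t x * u t x @[t --> F] --> kappa x * v x * v x.
  by do 2 (apply: cvgM; last exact: uv); exact: cvg_cst.
have [||_ h1] := @ge0_fatou_rsum R _ T F _ _ _ (2 * C) cv1.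
- by move=> t; exact: energy_pos_part.
- apply: filterS uC => t [fu]; rewrite /energy_form => h.
  split; first exact: energy_sum.
  have := rsum_ge0 (killing_sum fu fu) (killing_pos_part (u t)); lra.
have [||_ h2] := @ge0_fatou_rsum R _ T F _ _ _ C cv2.
- by move=> t; exact: killing_pos_part.
- apply: filterS uC => t [fu]; rewrite /energy_form => h.
  split; first exact: killing_sum.
  have := rsum_ge0 (energy_sum fu fu) (energy_pos_part (u t)); lra.
rewrite /energy_form; lra.
Qed.

End Energy.

Lemma cvg0_sqr (R : realType) (a : nat -> R) :
  a n ^+ 2 @[n --> \oo] --> (0 : R) -> a n @[n --> \oo] --> (0 : R).
Proof.
move=> a2; apply/cvgrPdist_le => e e0.
have e2 : 0 < e ^+ 2 by rewrite exprn_gt0.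
have /cvgrPdist_le/(_ _ e2) := a2; apply: filterS => n.
rewrite !sub0r !normrN normrX ler_pXn2r // nnegrE //; exact: ltW.
Qed.

Lemma squeeze0 (R : realType) (T : Type) (F : set_system T) {FF : Filter F}
  (a b : T -> R) : b t @[t --> F] --> (0 : R) ->
  (\forall t \near F, `|a t| <= b t) -> a t @[t --> F] --> (0 : R).
Proof.
move=> b0 ab; apply/cvgrPdist_le => e e0.
have /cvgrPdist_le/(_ _ e0) := b0; apply: filterS2 ab => t h1.
by rewrite !sub0r !normrN => h2; apply: le_trans h1 (le_trans (ler_norm _) h2).
Qed.

Lemma harmonic_lt (R : realType) (e : R) : 0 < e ->
  exists N, forall n, (N <= n)%N -> n.+1%:R^-1 <= e.
Proof.
move=> e0; have /cvgrPdist_le/(_ _ e0)[N _ hN] := @cvg_harmonic R.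
exists N => n /hN /=; by rewrite sub0r normrN ger0_norm.
Qed.

(** * Closability of the energy form and accretivity of its operator *)

Section ClosedForm.
Variables (R : realType) (X : countType) (G : graph R X).
Local Notation l2 := (l2 G).
Local Notation ip := (l2_inner G).
Local Notation nm := (l2_norm G).
Local Notation E := (energy_form G).
Local Notation approx := (form_approx G).
Implicit Types (f g h u v : X -> R) (fn gn : nat -> X -> R).

Lemma approx_l2 fn f n : approx fn f -> l2 (fn n).
Proof. by move=> [_ ff _ _]; exact: l2_fin_supp. Qed.

Lemma approx_pointwise fn f x : approx fn f -> fn n x @[n --> \oo] --> f x.
Proof.
move=> fa; have [lf _ fc _] := fa; apply: l2_cvg_pointwise (lf) fc => n.
exact: approx_l2 fa.
Qed.

Lemma approx_energy_bounded fn f : approx fn f ->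
  exists2 C, 0 <= C & \forall n \near \oo, E (fn n) (fn n) <= C.
Proof.
move=> [_ ff _ /(_ 1 ltr01)[N hN]].
exists (2 * (1 + E (fn N) (fn N))).
  by have := energy_ge0 G (ff N); lra.
exists N => // n Nn /=; have := hN n N Nn (leqnn N) => h.
have := energyD_le G (fin_suppB (ff n) (ff N)) (ff N); rewrite subrK; lra.
Qed.

(* Closability: by Fatou, [E (v n) (v n) <= 2 * liminf_m E (v n - v m) (v n - v m)]
   when [v m] tends to [0] pointwise. *)
Lemma approx_uniq fn gn f : approx fn f -> approx gn f ->
  E (fn n - gn n) (fn n - gn n) @[n --> \oo] --> (0 : R).
Proof.
move=> fa ga; have [_ ff _ fC] := fa; have [_ fg _ gC] := ga.
apply/cvgrPdist_le => e e0; have e8 : 0 < e / 8 by rewrite divr_gt0.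
have [N hN] := fC _ e8; have [M hM] := gC _ e8.
exists (maxn N M) => // n; rewrite /= geq_max => /andP[Nn Mn].
have fv : fin_supp (fn n - gn n) by exact: fin_suppB.
rewrite sub0r normrN ger0_norm; last exact: energy_ge0.
have -> : e = 2 * (e / 2) by field.
apply: (@energy_fatou _ _ _ nat \oo _
  (fun m => (fn n - gn n) - (fn m - gn m))) => // [x|].
  rewrite !fctE -[X in _ --> X]subr0 -(subrr (f x)).
  apply: cvgB; first exact: cvg_cst.
  by apply: cvgB; exact: approx_pointwise.
exists (maxn N M) => // m; rewrite /= geq_max => /andP[Nm Mm].
split; first by apply: fin_suppB => //; exact: fin_suppB.
have -> : (fn n - gn n) - (fn m - gn m) = (fn n - fn m) - (gn n - gn m).
  by apply/funext => x; rewrite !fctE; ring.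
apply: le_trans (energyB_le _ _ _) _; try exact: fin_suppB.
have := hN n m Nn Nm; have := hM n m Mn Mm; lra.
Qed.

(** [closed_form] is existential in the approximating sequences; this shows that its value can be
    computed along any of them, the differences vanishing by Cauchy-Schwarz and [approx_uniq]. *)
Lemma closed_form_cvg fn gn f g q : approx fn f -> approx gn g ->
  closed_form G f g q -> E (fn n) (gn n) @[n --> \oo] --> q.
Proof.
move=> fa ga [fn' [gn' [fa' ga' hq]]].
have [_ ff _ _] := fa; have [_ fg _ _] := ga.
have [_ ff' _ _] := fa'; have [_ fg' _ _] := ga'.
suff h : E (fn n) (gn n) - E (fn' n) (gn' n) @[n --> \oo] --> (0 : R).
  rewrite -[q]add0r; have -> : (fun n => E (fn n) (gn n)) =
    (fun n => (E (fn n) (gn n) - E (fn' n) (gn' n)) + E (fn' n) (gn' n)).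
    by apply/funext => n; rewrite subrK.
  exact: cvgD.
have -> : (fun n => E (fn n) (gn n) - E (fn' n) (gn' n)) =
  (fun n => E (fn n - fn' n) (gn n) + E (gn n - gn' n) (fn' n)).
  apply/funext => n; rewrite !energyBl // !(energyC _ _ (fn' n)); ring.
have key an a bn bn' b : approx an a -> approx bn b -> approx bn' b ->
    E (bn n - bn' n) (an n) @[n --> \oo] --> (0 : R).
  move=> aa ba ba'; have [_ fa1 _ _] := aa; have [_ fb _ _] := ba.
  have [_ fb' _ _] := ba'.
  apply: cvg0_sqr; have [C C0 hC] := approx_energy_bounded aa.
  apply: (@squeeze0 _ _ _ _ _ (fun n => E (bn n - bn' n) (bn n - bn' n) * C)).
    by rewrite -[X in _ --> X](mul0r C); apply: cvgM;
      [exact: approx_uniq ba ba'|exact: cvg_cst].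
  apply: filterS hC => n hn; rewrite ger0_norm ?sqr_ge0 //.
  apply: le_trans (energy_cs _ _ _) _ => //; first exact: fin_suppB.
  by rewrite ler_wpM2l // energy_ge0 //; exact: fin_suppB.
by rewrite -[X in _ --> X]addr0; apply: cvgD; apply: key; eassumption.
Qed.

Lemma approx_lin fn gn f g a : approx fn f -> approx gn g ->
  approx (fun n => a *: fn n + gn n) (a *: f + g).
Proof.
move=> fa ga; have [lf ff fc fC] := fa; have [lg fg gc gC] := ga.
have ln n : l2 (fn n) := approx_l2 n fa; have lm n : l2 (gn n) := approx_l2 n ga.
split.
- by apply: l2D => //; exact: l2Z.
- by move=> n; apply: fin_suppD => //; exact: fin_suppZ.
- apply: (@squeeze0 _ _ _ _ _
    (fun n => `|a| * nm (fn n - f) + nm (gn n - g))).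
    rewrite -[X in _ --> X]addr0 -[X in X + _](mulr0 `|a|).
    by apply: cvgD => //; apply: cvgM => //; exact: cvg_cst.
  apply: nearW => n; rewrite ger0_norm ?nm_ge0 //.
  have -> : a *: fn n + gn n - (a *: f + g) = a *: (fn n - f) + (gn n - g).
    by rewrite scalerBr opprD addrACA.
  rewrite -nmZ; last exact: l2B.
  by apply: nmD; [apply: l2Z|]; exact: l2B.
- move=> e e0; pose d := e / (4 * (1 + a ^+ 2)).
  have a0 : 0 < 1 + a ^+ 2 by rewrite ltr_wpDr ?sqr_ge0.
  have d0 : 0 < d by rewrite divr_gt0 // mulr_gt0.
  have [N hN] := fC _ d0; have [M hM] := gC _ d0.
  exists (maxn N M) => m n; rewrite !geq_max => /andP[Nm Mm] /andP[Nn Mn].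
  have -> : a *: fn m + gn m - (a *: fn n + gn n) =
            a *: (fn m - fn n) + (gn m - gn n).
    by rewrite scalerBr opprD addrACA.
  have f1 : fin_supp (fn m - fn n) by exact: fin_suppB.
  apply: le_lt_trans (energyD_le _ _ _) _.
  + exact: fin_suppZ.
  + exact: fin_suppB.
  rewrite energyZl //; last exact: fin_suppZ.
  rewrite energyC energyZl // mulrA -expr2.
  have h1 := hN m n Nm Nn; have h2 := hM m n Mm Mn.
  have de : e = 4 * d * (1 + a ^+ 2).
    by rewrite /d; field; rewrite lt0r_neq0.
  have := sqr_ge0 a; have := energy_ge0 G f1; rewrite de; nra.
Qed.

Lemma form_operator_l2 u g : form_operator G u g -> l2 u /\ l2 g.
Proof. by move=> [[fn [lf _ _ _]] lg _]. Qed.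

Lemma form_operator_lin u v g k a : form_operator G u g ->
  form_operator G v k -> form_operator G (a *: u + v) (a *: g + k).
Proof.
move=> [[un ua] lg ug] [[vn va] lk vk].
have uva := approx_lin a ua va.
have [_ fu _ _] := ua; have [_ fv _ _] := va.
split=> [||h [hn ha]].
- by exists (fun n => a *: un n + vn n).
- by apply: l2D => //; exact: l2Z.
have [lh fh _ _] := ha; exists (fun n => a *: un n + vn n), hn; split => //.
have dh : closed_form_dom G h by exists hn.
have -> : (fun n => E (a *: un n + vn n) (hn n)) =
          (fun n => a * E (un n) (hn n) + E (vn n) (hn n)).
  by apply/funext => n; rewrite energyDl ?energyZl //; exact: fin_suppZ.
rewrite ipDl ?ipZl //; last exact: l2Z.
apply: cvgD; last exact: closed_form_cvg va ha (vk _ dh).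
by apply: cvgM; [exact: cvg_cst|exact: closed_form_cvg ua ha (ug _ dh)].
Qed.

Lemma form_operator_accretive u g : form_operator G u g -> 0 <= ip g u.
Proof.
move=> [[un ua] lg ug].
have h := closed_form_cvg ua ua (ug u (ex_intro _ un ua)).
have [_ fu _ _] := ua.
apply: (ler_cvg (cvg_cst 0) h); apply: nearW => n; exact: energy_ge0.
Qed.

(** Expanding the square of the right-hand norm, the cross term is nonnegative by accretivity. *)
Lemma form_operator_contr u g s : 0 <= s -> form_operator G u g ->
  nm u <= nm (u + s *: g).
Proof.
move=> s0 ug; have [lu lg] := form_operator_l2 ug.
have := form_operator_accretive ug => h.
rewrite -(@ler_pXn2r _ 2) // ?nnegrE ?nm_ge0 // !nm_sqr //; last first.
  by apply: l2D => //; exact: l2Z.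
rewrite ip_quad // (ipC G u g); have := ip_ge0 lg; have := sqr_ge0 s; nra.
Qed.

(** The difference of two solutions is annihilated by [1 + s L], so [form_operator_contr] bounds its
    norm by [0]. *)
Lemma form_operator_uniq u v s f : 0 < s ->
  form_operator G u (s^-1 *: (f - u)) -> form_operator G v (s^-1 *: (f - v)) ->
  u = v.
Proof.
move=> s0 hu hv; have h := form_operator_lin (-1) hu hv.
have [lu _] := form_operator_l2 hu; have [lv _] := form_operator_l2 hv.
have := form_operator_contr (ltW s0) h.
have -> : -1 *: u + v + s *: (-1 *: (s^-1 *: (f - u)) + s^-1 *: (f - v)) = 0.
  apply/funext => x; rewrite !fctE /GRing.scale /= /GRing.scale /=.
  rewrite [RHS](_ : _ = 0) //; field; exact: lt0r_neq0.
have l0 : l2 0 by exact: l2_0.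
have -> : nm 0 = 0.
  by rewrite -(scale0r (0 : X -> R)) nmZ // normr0 mul0r.
move=> n0; apply/funext => x; have := l2_pointwise x (l2D (l2Z (-1) lu) lv).
have -> : nm (-1 *: u + v) = 0 by apply/eqP; rewrite eq_le n0 nm_ge0.
rewrite mulr0 normr_le0 fctE scaleN1r addrC subr_eq0 => /eqP.
by move=> /esym.
Qed.

Lemma nm_cvg_bounded (T : Type) (F : set_system T) {FF : Filter F}
  (u : T -> X -> R) v : (forall t, l2 (u t)) -> l2 v ->
  nm (u t - v) @[t --> F] --> (0 : R) ->
  \forall t \near F, nm (u t) <= nm v + 1.
Proof.
move=> lu lv /cvgrPdist_le/(_ _ ltr01); apply: filterS => t.
rewrite sub0r normrN ger0_norm ?nm_ge0 // => h.
have := nmD (l2B (lu t) lv) lv; rewrite subrK; lra.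
Qed.

Lemma ip_cvg (T : Type) (F : set_system T) {FF : Filter F}
  (u v : T -> X -> R) f g : (forall t, l2 (u t)) -> (forall t, l2 (v t)) ->
  l2 f -> l2 g -> nm (u t - f) @[t --> F] --> (0 : R) ->
  nm (v t - g) @[t --> F] --> (0 : R) -> ip (u t) (v t) @[t --> F] --> ip f g.
Proof.
move=> lu lv lf lg uf vg.
suff h : ip (u t) (v t) - ip f g @[t --> F] --> (0 : R).
  rewrite -[ip f g]add0r; have -> : (fun t => ip (u t) (v t)) =
    (fun t => (ip (u t) (v t) - ip f g) + ip f g).
    by apply/funext => t; rewrite subrK.
  by apply: cvgD => //; exact: cvg_cst.
apply: (@squeeze0 _ _ _ _ _
  (fun t => nm (u t - f) * (nm g + 1) + nm (v t - g) * nm f)).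
  rewrite [X in _ --> X](_ : 0 = 0 * (nm g + 1) + 0 * nm f);
    last by rewrite !mul0r addr0.
  by apply: cvgD; apply: cvgM => //; exact: cvg_cst.
apply: filterS (nm_cvg_bounded lv lg vg) => t vb.
have -> : ip (u t) (v t) - ip f g = ip (u t - f) (v t) + ip (v t - g) f.
  by rewrite !ipBl // (ipC G (v t) f) (ipC G g f); ring.
apply: le_trans (ler_normD _ _) (lerD _ _); last first.
  by apply: ip_cs => //; exact: l2B.
apply: le_trans (ip_cs (l2B (lu t) lf) (lv t)) _.
by rewrite ler_wpM2l // nm_ge0.
Qed.

End ClosedForm.

(** * Resolvents *)

Section Resolvent.
Variables (R : realType) (X : countType) (G : graph R X).
Local Notation w := (weight G).
Local Notation kappa := (killing G).
Local Notation mu := (vmeas G).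
Local Notation l2 := (l2 G).
Local Notation ip := (l2_inner G).
Local Notation nm := (l2_norm G).
Local Notation E := (energy_form G).
Local Notation approx := (form_approx G).

Lemma ipZZ a f : l2 f -> ip (a *: f) (a *: f) = a ^+ 2 * ip f f.
Proof.
by move=> lf; have laf := l2Z a lf; rewrite ipZl // ipC ipZl // mulrA expr2.
Qed.

Lemma energyZZ a f : fin_supp f -> E (a *: f) (a *: f) = a ^+ 2 * E f f.
Proof.
move=> ff; have faf := fin_suppZ a ff.
by rewrite energyZl // energyC energyZl // mulrA expr2.
Qed.

Lemma bounded_weight_sum (f : X -> R) (C : R) x : (forall y, `|f y| <= C) ->
  abs_summable (fun y => w x y * f y).
Proof.
move=> fC; have h := abs_summableZ C (weight_sum G x).
apply: (abs_summable_le h) => y; rewrite !normrM mulrC ler_wpM2r //.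
exact: le_trans (fC y) (ler_norm C).
Qed.

Lemma bounded_diff_sum (f : X -> R) (C : R) x : (forall y, `|f y| <= C) ->
  abs_summable (fun y => w x y * (f x - f y)).
Proof.
move=> fC; apply: (@bounded_weight_sum _ (C + C)) => y.
apply: le_trans (ler_normB _ _) _; exact: lerD.
Qed.

Definition delta (x y : X) : R := if y == x then 1 else 0.

Lemma delta_fin_supp x : fin_supp (delta x).
Proof.
apply: (@sub_finite_set _ _ [set x]); last exact: finite_set1.
by move=> y /=; rewrite /delta; case: (eqVneq y x) => // _; rewrite eqxx.
Qed.

Lemma l2_delta x : l2 (delta x).
Proof. by apply: l2_fin_supp; exact: delta_fin_supp. Qed.

Lemma ip_delta f x : l2 f -> ip f (delta x) = f x * mu x.
Proof.
move=> lf.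
apply: rsum_lim; first by apply: l2_prod; [exact: lf|exact: l2_delta].
apply: cvg_near_cst; exists (pickle x).+1 => // n /= xn.
rewrite /psum (bigD1 (Ordinal xn)) //= fnat_pickle /delta eqxx mulr1.
rewrite big1 ?addr0 // => k kx; rewrite /fnat.
have := @pickle_invK X k; case: pickle_inv => //= y yk.
case: eqP => [yx|_]; last by rewrite mulr0 mul0r.
by case/eqP: kx; apply: val_inj; rewrite /= -yk yx.
Qed.

(** Green's formula against a point mass: only the row and the column of [x] survive in the double
    sum, and by symmetry they are equal, which absorbs the factor one half. *)
Lemma energy_delta (f : X -> R) C x : fin_supp f -> (forall y, `|f y| <= C) ->
  E f (delta x) = rsum (fun y => w x y * (f x - f y)) + kappa x * f x.
Proof.
move=> ff fC; rewrite /energy_form.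
have sy := bounded_diff_sum x fC.
pose A (p : X * X) := if p.1 == x then w p.1 p.2 * (f p.1 - f p.2) else 0.
pose B (p : X * X) := if p.2 == x then w p.1 p.2 * (f p.2 - f p.1) else 0.
have [||| sA rA] := @rsum_inj R X (X * X)%type (fun y => (x, y)) A.
- by move=> y z [].
- by move=> [a b] np; rewrite /A /=; case: eqP => // ax; case: np; exists b => //; rewrite ax.
- by apply: (abs_summable_le sy) => y; rewrite /A /= eqxx.
have [||| sB rB] := @rsum_inj R X (X * X)%type (fun y => (y, x)) B.
- by move=> y z [].
- by move=> [a b] np; rewrite /B /=; case: eqP => // ax; case: np; exists a => //; rewrite ax.
- by apply: (abs_summable_le sy) => y; rewrite /B /= eqxx weight_sym.
have -> : rsum (fun p : X * X => w p.1 p.2 * (f p.1 - f p.2) *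
    (delta x p.1 - delta x p.2)) = rsum (fun p => A p + B p).
  congr rsum; apply/funext => -[a b]; rewrite /A /B /delta /=.
  by case: eqP => [->|_]; case: eqP => [->|_]; ring.
rewrite rsumD // rA rB.
have -> : rsum (A \o (fun y => (x, y))) = rsum (fun y => w x y * (f x - f y)).
  by congr rsum; apply/funext => y; rewrite /A /= eqxx.
have -> : rsum (B \o (fun y => (y, x))) = rsum (fun y => w x y * (f x - f y)).
  by congr rsum; apply/funext => y; rewrite /B /= eqxx weight_sym.
congr (_ + _); first by field.
(* Dividing by [mu] turns the killing sum into an inner product with [delta x], already computed by
   [ip_delta]. *)
have lk : l2 (fun y => (mu y)^-1 * kappa y * f y).
  apply: l2_fin_supp; apply: sub_finite_set ff => y /=.
  by apply: contra_neq => ->; rewrite mulr0.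
have := ip_delta x lk; rewrite /l2_inner => h.
transitivity ((mu x)^-1 * kappa x * f x * mu x); last first.
  by field; rewrite lt0r_neq0 ?vmeas_gt0.
rewrite -h; congr rsum; apply/funext => y; field.
by rewrite lt0r_neq0 ?vmeas_gt0.
Qed.

(** * The resolvent as minimiser of a quadratic functional *)

Section Minimization.
Variables (s : R) (f : X -> R).
Hypotheses (s0 : 0 < s) (lf : l2 f).

Let N v := s * E v v + ip v v.
Let Jf v := s * E v v + ip (v - f) (v - f).
Let m := inf [set Jf v | v in (@fin_supp R X)].

Let Jf_ge0 v : fin_supp v -> 0 <= Jf v.
Proof.
move=> fv; rewrite addr_ge0 ?mulr_ge0 ?energy_ge0 ?(ltW s0) //.
by apply: ip_ge0; apply: l2B => //; exact: l2_fin_supp.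
Qed.

Let m_le v : fin_supp v -> m <= Jf v.
Proof.
move=> fv; apply: ge_inf; last by exists v.
by exists 0 => _ [u fu <-]; exact: Jf_ge0.
Qed.

Let N_ge0 v : fin_supp v -> 0 <= N v.
Proof.
move=> fv; rewrite addr_ge0 ?mulr_ge0 ?energy_ge0 ?(ltW s0) //.
by apply: ip_ge0; exact: l2_fin_supp.
Qed.

Let Jf_quad u v t : fin_supp u -> fin_supp v ->
  Jf (u + t *: v) = Jf u + 2 * t * (s * E u v + ip (u - f) v) + t ^+ 2 * N v.
Proof.
move=> fu fv; rewrite /Jf energy_quad //.
have -> : u + t *: v - f = (u - f) + t *: v by rewrite addrAC.
rewrite ip_quad.
- by rewrite /N; ring.
- by apply: l2B => //; exact: l2_fin_supp.
- exact: l2_fin_supp.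
Qed.

(** Parallelogram law with the midpoint [c]: [Jf u + Jf v = 2 * Jf c + 2 * N d], where
    [N (u - v) = 4 * N d] and [Jf c] is at least [m]. *)
Let N_sub u v a b : fin_supp u -> fin_supp v ->
  Jf u <= m + a -> Jf v <= m + b -> N (u - v) <= 2 * (a + b).
Proof.
move=> fu fv ua vb.
pose c := 2^-1 *: (u + v); pose d := 2^-1 *: (u - v).
have fc : fin_supp c by apply: fin_suppZ; exact: fin_suppD.
have fd : fin_supp d by apply: fin_suppZ; exact: fin_suppB.
have eu : u = c + 1 *: d.
  by apply/funext => x; rewrite /c /d !fctE /GRing.scale /= /GRing.scale /=; field.
have ev : v = c + (-1) *: d.
  by apply/funext => x; rewrite /c /d !fctE /GRing.scale /= /GRing.scale /=; field.
have e2 : u - v = 2 *: d by rewrite scalerA divff // scale1r.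
have e4 : N (u - v) = 4 * N d.
  by rewrite e2 /N energyZZ // ipZZ; [ring|exact: l2_fin_supp].
have ju : Jf u = Jf c + 2 * 1 * (s * E c d + ip (c - f) d) + 1 ^+ 2 * N d.
  by rewrite [in LHS]eu Jf_quad.
have jv : Jf v = Jf c + 2 * (-1) * (s * E c d + ip (c - f) d) + (-1) ^+ 2 * N d.
  by rewrite [in LHS]ev Jf_quad.
by have := m_le fc; rewrite e4; lra.
Qed.

(** The explicit rate makes any two minimising sequences close term by term. Their terms are
    finitely supported, so once convergent they are admissible in [form_approx]. *)
Let minim (u : nat -> X -> R) := (forall n, fin_supp (u n)) /\
  forall n, Jf (u n) <= m + n.+1%:R^-1.

Let minim_ex : exists u, minim u.
Proof.
have hi : has_inf [set Jf v | v in (@fin_supp R X)].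
  split; first by exists (Jf 0), 0 => //; apply/fin_suppP; exists 0%N.
  by exists 0 => _ [u fu <-]; exact: Jf_ge0.
have h n : exists u, fin_supp u /\ Jf u <= m + n.+1%:R^-1.
  have n0 : 0 < n.+1%:R^-1 :> R by rewrite invr_gt0.
  have [_ [u fu <-] hu] := inf_adherent n0 hi.
  by exists u; split=> //; exact: ltW.
have [u hu] := choice h.
by exists u; split=> n; have [] := hu n.
Qed.

Let minim_close u v n k : minim u -> minim v -> N (u n - v k) <=
  2 * (n.+1%:R^-1 + k.+1%:R^-1).
Proof. by move=> [fu ju] [fv jv]; apply: N_sub. Qed.

Let minim_approx u v : minim u -> l2 v -> nm (u n - v) @[n --> \oo] --> (0 : R) ->
  approx u v.
Proof.
move=> mu lv uv; have [fu ju] := mu; split => // e e0.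
have [M hM] := harmonic_lt (divr_gt0 (mulr_gt0 s0 e0) (ltr0n R 8)).
exists M => i j /hM hi /hM hj; have h := minim_close i j mu mu.
have := ip_ge0 (l2_fin_supp G (fin_suppB (fu i) (fu j))) => p.
rewrite -(ltr_pM2l s0); apply: (@le_lt_trans _ _ (N (u i - u j))).
  by rewrite lerDl.
apply: le_lt_trans h _; have := mulr_gt0 s0 e0.
set a := _^-1 in hi *; set b := _^-1 in hj *; lra.
Qed.

Let minim_cvg u : minim u -> exists2 v, l2 v & nm (u n - v) @[n --> \oo] --> (0 : R).
Proof.
move=> mu; have [fu ju] := mu.
apply: l2_complete => [n|e e0]; first exact: l2_fin_supp.
have [M hM] := harmonic_lt (divr_gt0 (exprn_gt0 2 e0) (ltr0n R 4)).
exists M => i j /hM hi /hM hj; have h := minim_close i j mu mu.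
have fd := fin_suppB (fu i) (fu j).
rewrite -(@ler_pXn2r _ 2) // ?nnegrE ?nm_ge0 ?(ltW e0) //.
rewrite nm_sqr; last exact: l2_fin_supp.
apply: (@le_trans _ _ (N (u i - u j))).
  by rewrite lerDr mulr_ge0 ?(ltW s0) ?energy_ge0.
apply: le_trans h _.
set a := _^-1 in hi *; set b := _^-1 in hj *; lra.
Qed.

Let minim_operator u v : minim u -> approx u v ->
  form_operator G v (s^-1 *: (f - v)).
Proof.
move=> mu ua; have [fu ju] := mu; have [lv _ uv _] := ua.
have lfv : l2 (f - v) by exact: l2B.
split=> [||h [hn ha]]; first by exists u.
  exact: l2Z.
exists u, hn; split => //; have [lh fh hh _] := ha.
have lu n : l2 (u n) by exact: l2_fin_supp.
have lhn n : l2 (hn n) by exact: l2_fin_supp.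
(* Half the first variation of [Jf] at [u n] in the direction [hn n]. Near-minimality makes a
   quadratic polynomial nonnegative, hence its square is at most [N (hn n) / (n + 1)]. *)
pose B n := s * E (u n) (hn n) + ip (u n - f) (hn n).
have B0 : B n @[n --> \oo] --> (0 : R).
  have [C C0 hC] := approx_energy_bounded ha.
  pose D := s * C + (nm h + 1) ^+ 2.
  apply: cvg0_sqr; apply: (@squeeze0 _ _ _ _ _ (fun n => n.+1%:R^-1 * D)).
    rewrite -[X in _ --> X](mul0r D); apply: cvgM; last exact: cvg_cst.
    exact: cvg_harmonic.
  apply: filterS2 hC (nm_cvg_bounded lhn lh hh) => n h1 h2.
  rewrite ger0_norm ?sqr_ge0 //.
  apply: (@le_trans _ _ (n.+1%:R^-1 * N (hn n))); last first.
    rewrite ler_wpM2l ?invr_ge0 // lerD //; first by rewrite ler_pM2l.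
    by rewrite -nm_sqr // ler_pXn2r // ?nnegrE ?addr_ge0 ?nm_ge0.
  apply: quadratic_ge0 => [|t]; first exact: N_ge0.
  have := m_le (fin_suppD (fu n) (fin_suppZ t (fh n))).
  rewrite Jf_quad //; have := ju n; rewrite -/(B n).
  by set p := t ^+ 2 * _; set q := 2 * t * _; set a := _^-1; lra.
have I0 : ip (u n - f) (hn n) @[n --> \oo] --> ip (v - f) h.
  apply: ip_cvg => // [n||]; try exact: l2B.
  have -> : (fun n => nm (u n - f - (v - f))) = (fun n => nm (u n - v)).
    by apply/funext => n; congr nm; apply/funext => x; rewrite !fctE; ring.
  exact: uv.
have -> : (fun n => E (u n) (hn n)) =
          (fun n => s^-1 * (B n - ip (u n - f) (hn n))).
  by apply/funext => n; rewrite /B; field; exact: lt0r_neq0.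
rewrite ipZl //; apply: cvgM; first exact: cvg_cst.
have -> : ip (f - v) h = 0 - ip (v - f) h.
  by rewrite !ipBl //; ring.
exact: cvgB.
Qed.

(** Markov property: a contraction fixing [0] does not increase the edge energy, so only the
    zero-order terms need the pointwise hypothesis. *)
Let minim_trunc (phi : R -> R) u : phi 0 = 0 ->
  (forall a b, `|phi a - phi b| <= `|a - b|) ->
  (forall x a, (s * kappa x) * phi a ^+ 2 + mu x * (phi a - f x) ^+ 2 <=
               (s * kappa x) * a ^+ 2 + mu x * (a - f x) ^+ 2) ->
  minim u -> minim (fun n x => phi (u n x)).
Proof.
move=> phi0 phi1 phif [fu ju].
have fp n : fin_supp (fun x => phi (u n x)).
  exact: (fin_supp_comp (phi := fun a _ => phi a)) (fu n) (fu n).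
split=> // n; apply: le_trans (ju n); rewrite /Jf /energy_form.
set v := fun x => phi (u n x).
have fv : fin_supp v := fp n.
have lu : l2 (u n - f) by apply: l2B => //; exact: l2_fin_supp.
have lv : l2 (v - f) by apply: l2B => //; exact: l2_fin_supp.
have h1 : rsum (fun p : X * X => w p.1 p.2 * (v p.1 - v p.2) * (v p.1 - v p.2)) <=
  rsum (fun p : X * X => w p.1 p.2 * (u n p.1 - u n p.2) * (u n p.1 - u n p.2)).
  apply: ler_rsum => [||p]; try exact: energy_sum.
  rewrite -!mulrA ler_wpM2l ?weight_ge0 // -!expr2.
  rewrite -[leLHS]ger0_norm ?sqr_ge0 // -[leRHS]ger0_norm ?sqr_ge0 // !normrX.
  by rewrite ler_pXn2r ?nnegrE ?phi1.
have h2 : s * rsum (fun x => kappa x * v x * v x) + ip (v - f) (v - f) <=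
  s * rsum (fun x => kappa x * u n x * u n x) + ip (u n - f) (u n - f).
  rewrite -(rsumZ s (killing_sum G fv fv)) -(rsumZ s (killing_sum G (fu n) (fu n))).
  have zv := abs_summableZ s (killing_sum G fv fv).
  have zu := abs_summableZ s (killing_sum G (fu n) (fu n)).
  rewrite /l2_inner -!rsumD //; try exact: l2_prod.
  apply: ler_rsum => [||x]; try (apply: abs_summableD => //; exact: l2_prod).
  by have := phif x (u n x); rewrite !fctE /v; lra.
rewrite !mulrDr -!addrA; apply: lerD h2.
by rewrite ler_pM2l // ler_pM2l.
Qed.

(** The second clause compares the minimum with [Jf f = s * E f f]. The bound on [f] says that the
    constant [c] is a supersolution, since [c + s * lap c = c * (1 + s * kappa / mu)]. Uniformly
    bounded approximants are provided so that the Laplacian can be identified pointwise by dominated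
    convergence. *)
Lemma resolvent_exists : exists v,
  [/\ form_operator G v (s^-1 *: (f - v)),
      (fin_supp f -> nm (v - f) ^+ 2 <= s * E f f),
      (forall c, 0 <= c -> (forall x, f x <= c * (1 + s * kappa x / mu x)) ->
         forall x, v x <= c)
    & forall c, 0 <= c -> (forall x, f x <= c * (1 + s * kappa x / mu x)) ->
        (forall x, 0 <= f x) ->
        exists2 u, approx u v & forall n x, 0 <= u n x <= c].
Proof.
have [u mu_] := minim_ex; have [fu ju] := mu_.
have [v lv uv] := minim_cvg mu_.
have ua := minim_approx mu_ lv uv.
(* Minimising sequences approach each other, so truncated ones still converge to the same [v]. *)
have other u' : minim u' -> approx u' v.
  move=> mu'; have [fu' _] := mu'; apply: (minim_approx mu') => //.
  apply: (@squeeze0 _ _ _ _ _ (fun n => nm (u' n - u n) + nm (u n - v))).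
    rewrite -[X in _ --> X]addr0; apply: cvgD => //.
    apply: cvg0_sqr; apply: (@squeeze0 _ _ _ _ _ (fun n => 4 * n.+1%:R^-1)).
      rewrite -[X in _ --> X](mulr0 4); apply: cvgM; first exact: cvg_cst.
      exact: cvg_harmonic.
    apply: nearW => n; rewrite ger0_norm ?sqr_ge0 // nm_sqr; last first.
      by apply: l2_fin_supp; exact: fin_suppB.
    have := minim_close n n mu' mu_.
    have := energy_ge0 G (fin_suppB (fu' n) (fu n)); rewrite /N.
    set a := _^-1; have := s0; nra.
  apply: nearW => n; rewrite ger0_norm ?nm_ge0 //.
  by apply: nm_triangle => //; exact: l2_fin_supp.
have kp x : 0 <= s * kappa x by rewrite mulr_ge0 ?killing_ge0 // ltW.
have truncc c : 0 <= c -> (forall x, f x <= c * (1 + s * kappa x / mu x)) ->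
    forall u', minim u' -> minim (fun n x => Num.min (u' n x) c).
  move=> c0 fc u' mu'; apply: (minim_trunc (phi := fun a => Num.min a c)) mu'.
  - by rewrite min_l.
  - move=> a b; wlog ab : a b / a <= b => [H|].
      have [ab|/ltW ba] := leP a b; first exact: H.
      by rewrite distrC (distrC a); exact: H.
    rewrite (distrC a) (distrC (Num.min a c)).
    by case: (leP a c) => ac; case: (leP b c) => bc; rewrite ?subrr ?normr0 //;
      rewrite ?(@ger0_norm _ (b - a)) ?subr_ge0 // ?ler_norml; try apply/andP; try split; lra.
  - move=> x a; case: (leP a c) => // ca.
    have := fc x; have m0 := vmeas_gt0 G x.
    have -> : c * (1 + s * kappa x / mu x) = c * (mu x + s * kappa x) / mu x.
      by field; rewrite lt0r_neq0.
    rewrite ler_pdivlMr // => h; have k0 := kp x.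
    rewrite -subr_ge0; set k := s * kappa x in h k0 *.
    (* Truncating at [c < a] saves this product; its last term is nonnegative by the bound on [f x]
       multiplied by [mu x]. *)
    have -> : k * a ^+ 2 + mu x * (a - f x) ^+ 2 -
        (k * c ^+ 2 + mu x * (c - f x) ^+ 2) =
        (a - c) * ((k + mu x) * (a - c) + 2 * (c * (mu x + k) - f x * mu x)).
      by ring.
    rewrite mulr_ge0 ?subr_ge0 ?(ltW ca) // addr_ge0 //.
        apply: mulr_ge0; first exact: addr_ge0 k0 (ltW m0).
      by rewrite subr_ge0 ltW.
    by rewrite mulr_ge0 // subr_ge0.
have trunc0 : (forall x, 0 <= f x) ->
    forall u', minim u' -> minim (fun n x => Num.max (u' n x) 0).
  move=> f0 u' mu'; apply: (minim_trunc (phi := fun a => Num.max a 0)) mu'.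
  - by rewrite max_l.
  - move=> a b; wlog ab : a b / a <= b => [H|].
      have [ab|/ltW ba] := leP a b; first exact: H.
      by rewrite distrC (distrC a); exact: H.
    rewrite (distrC a) (distrC (Num.max a 0)).
    by case: (leP a 0) => ac; case: (leP b 0) => bc; rewrite ?subrr ?normr0 //;
      rewrite ?(@ger0_norm _ (b - a)) ?subr_ge0 // ?ler_norml; try apply/andP; try split; lra.
  - move=> x a; case: (leP a 0) => // a0.
    have m0 := vmeas_gt0 G x.
    have a1 : 0 <= mu x * (- a * f x) by rewrite !mulr_ge0 ?oppr_ge0 // ltW.
    have a2 : 0 <= (s * kappa x + mu x) * a ^+ 2.
      by rewrite mulr_ge0 ?sqr_ge0 // addr_ge0 // ltW.
    by lra.
exists v; split.
- exact: minim_operator ua.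
- move=> ff; have lvf : l2 (v - f) by exact: l2B.
  have ln n : l2 (u n - f) by apply: l2B => //; exact: l2_fin_supp.
  have h : ip (u n - f) (u n - f) @[n --> \oo] --> ip (v - f) (v - f).
    have uvf : nm (u n - f - (v - f)) @[n --> \oo] --> (0 : R).
      have -> : (fun n => nm (u n - f - (v - f))) = (fun n => nm (u n - v)).
        by apply/funext => n; congr nm; apply/funext => x; rewrite !fctE; ring.
      exact: uv.
    exact: ip_cvg.
  rewrite nm_sqr // -[X in _ <= X]addr0.
  have h2 : s * E f f + n.+1%:R^-1 @[n --> \oo] --> s * E f f + 0.
    by apply: cvgD; [exact: cvg_cst|exact: cvg_harmonic].
  apply: (ler_cvg h h2); apply: nearW => n.
  have := ju n; have := m_le ff; rewrite /Jf subrr.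
  have -> : ip 0 0 = 0.
    have l0 : l2 0 by exact: l2_0.
    by rewrite -[X in ip X](scale0r (0 : X -> R)) ipZl // mul0r.
  have := mulr_ge0 (ltW s0) (energy_ge0 G (fu n)).
  set a := _^-1; lra.
- move=> c c0 fc x; have h := approx_pointwise (x := x) (other _ (truncc c c0 fc u mu_)).
  apply: (ler_cvg h (cvg_cst c)); apply: nearW => n.
  by rewrite ge_min lexx orbT.
- move=> c c0 fc f0; exists (fun n x => Num.max (Num.min (u n x) c) 0).
    by apply: other; exact/trunc0/truncc.
  by move=> n x; rewrite le_max lexx orbT ge_max c0 ge_min lexx orbT.
Qed.

End Minimization.

(** Testing the weak equation with [delta x] gives the pointwise one; the bounds on [u n] dominate
    the possibly infinite sum over neighbours. *)
Lemma form_operator_lap v k (u : nat -> X -> R) (c : R) x : form_operator G v k ->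
  approx u v -> (forall n x, 0 <= u n x <= c) -> lap G v x = k x.
Proof.
move=> vk ua uc; have [lv lk] := form_operator_l2 vk; have [_ _ vf] := vk.
have fd := delta_fin_supp x; have [_ fu _ _] := ua.
have da : approx (fun=> delta x) (delta x).
  split=> // [||e e0]; first exact: l2_delta.
    rewrite subrr (_ : nm 0 = 0); first exact: cvg_cst.
    have l0 : l2 0 by exact: l2_0.
    by rewrite -[X in nm X](scale0r (0 : X -> R)) nmZ // normr0 mul0r.
  exists 0%N => m n _ _; rewrite subrr -[X in E X](scale0r (0 : X -> R)) energyZl.
  - by rewrite mul0r.
  - by apply/fin_suppP; exists 0%N.
  - by apply/fin_suppP; exists 0%N.
have h := closed_form_cvg ua da (vf _ (ex_intro _ (fun=> delta x) da)).
have ub n y : `|u n y| <= c.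
  by have /andP[h1 h2] := uc n y; rewrite ger0_norm.
have hp y : u n y @[n --> \oo] --> v y by exact: approx_pointwise ua.
have c0 : 0 <= c by have /andP[h1 h2] := uc 0%N x; exact: le_trans h2.
have [vs hs] : abs_summable (fun y => w x y * (v x - v y)) /\
    rsum (fun y => w x y * (u n x - u n y)) @[n --> \oo] -->
    rsum (fun y => w x y * (v x - v y)).
  apply: (@dominated_rsum _ _ nat \oo _ _ _ (fun y => (c + c) * w x y)).
  - by move=> y; apply: cvgM; [exact: cvg_cst|exact: cvgB].
  - exact/abs_summableZ/weight_sum.
  - apply: nearW => n y; rewrite normrM ger0_norm ?weight_ge0 // mulrC.
    rewrite ler_wpM2r ?weight_ge0 //.
    apply: le_trans (ler_normB _ _) _; exact: lerD.
have e : rsum (fun y => w x y * (v x - v y)) + kappa x * v x = k x * mu x.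
  rewrite -(ip_delta x lk); apply: (@cvg_unique _ (@Rhausdorff R)) h.
  have -> : (fun n => E (u n) (delta x)) =
    (fun n => rsum (fun y => w x y * (u n x - u n y)) + kappa x * u n x).
    by apply/funext => n; rewrite (@energy_delta _ c).
  by apply: cvgD => //; apply: cvgM => //; exact: cvg_cst.
rewrite /lap; have m0 := vmeas_gt0 G x.
apply: (mulIf (lt0r_neq0 m0)); rewrite -e; field; exact: lt0r_neq0.
Qed.

End Resolvent.

(** * The resolvent as a function, and its maximum principles *)

Section ResolventFunction.
Variables (R : realType) (X : countType) (G : graph R X).
Local Notation kappa := (killing G).
Local Notation mu := (vmeas G).
Local Notation l2 := (l2 G).
Local Notation nm := (l2_norm G).
Local Notation E := (energy_form G).
Implicit Types (f g u v : X -> R) (s : R).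

(** The default [0] never occurs for [0 < s] and [l2 f], by [resolvent_exists]. *)
Definition resolvent s f : X -> R :=
  if pselect (exists v, form_operator G v (s^-1 *: (f - v))) is left H
  then sval (cid H) else 0.
Local Notation res := resolvent.

Lemma res_op s f : 0 < s -> l2 f ->
  form_operator G (res s f) (s^-1 *: (f - res s f)).
Proof.
move=> s0 lf; rewrite /res; case: pselect => [H|]; first by case: cid.
by have [v [h _ _ _]] := resolvent_exists s0 lf; case; exists v.
Qed.

Lemma res_eq s f v : 0 < s -> l2 f ->
  form_operator G v (s^-1 *: (f - v)) -> res s f = v.
Proof. by move=> s0 lf; apply: form_operator_uniq => //; exact: res_op. Qed.

Lemma res_l2 s f : 0 < s -> l2 f -> l2 (res s f).
Proof. by move=> s0 lf; have [] := form_operator_l2 (res_op s0 lf). Qed.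

Lemma res_uniq s u g : 0 < s -> form_operator G u g -> res s (u + s *: g) = u.
Proof.
move=> s0 ug; have [lu lg] := form_operator_l2 ug.
apply: res_eq => //; first by apply: l2D => //; exact: l2Z.
by rewrite addrAC subrr add0r scalerA mulVf ?scale1r // lt0r_neq0.
Qed.

Lemma res_lin s a f g : 0 < s -> l2 f -> l2 g ->
  res s (a *: f + g) = a *: res s f + res s g.
Proof.
move=> s0 lf lg; apply: res_eq => //; first by apply: l2D => //; exact: l2Z.
have := form_operator_lin a (res_op s0 lf) (res_op s0 lg).
congr form_operator; apply/funext => x.
by rewrite !fctE /GRing.scale /= /GRing.scale /=; ring.
Qed.

Lemma res_contr s f : 0 < s -> l2 f -> nm (res s f) <= nm f.
Proof.
move=> s0 lf; have := form_operator_contr (ltW s0) (res_op s0 lf).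
by rewrite scalerA divff ?lt0r_neq0 // scale1r addrC subrK.
Qed.

Lemma res_le s f c : 0 < s -> l2 f -> 0 <= c ->
  (forall x, f x <= c * (1 + s * kappa x / mu x)) -> forall x, res s f x <= c.
Proof.
move=> s0 lf c0 fc; have [v [h _ hc _]] := resolvent_exists s0 lf.
by rewrite (res_eq s0 lf h); exact: hc.
Qed.

Lemma res_ge0 s f : 0 < s -> l2 f -> (forall x, 0 <= f x) ->
  forall x, 0 <= res s f x.
Proof.
move=> s0 lf f0 x.
(* This is [- f] in the shape required by [res_lin]; the upper bound with [c = 0] then yields
   positivity. *)
have h : res s (-2 *: f + f) x <= 0.
  apply: res_le => // [|y]; first by apply: l2D => //; exact: l2Z.
  rewrite mul0r fctE /GRing.scale /= /GRing.scale /=; have := f0 y; lra.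
move: h; rewrite res_lin // [X in X <= 0 -> _](_ : _ = - res s f x).
  by rewrite oppr_le0.
by rewrite !fctE /GRing.scale /= /GRing.scale /=; ring.
Qed.

Lemma res_lap s f c : 0 < s -> l2 f -> 0 <= c ->
  (forall x, f x <= c * (1 + s * kappa x / mu x)) -> (forall x, 0 <= f x) ->
  forall x, res s f x + s * lap G (res s f) x = f x.
Proof.
move=> s0 lf c0 fc f0 x; have [v [h _ _ hc]] := resolvent_exists s0 lf.
rewrite (res_eq s0 lf h); have [u uv ub] := hc c c0 fc f0.
rewrite (form_operator_lap x h uv ub) /GRing.scale /= /GRing.scale /=.
by rewrite !fctE; field; exact: lt0r_neq0.
Qed.

Lemma res_near s f : 0 < s -> fin_supp f -> nm (res s f - f) ^+ 2 <= s * E f f.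
Proof.
move=> s0 ff; have lf := l2_fin_supp G ff.
have [v [h hf _ _]] := resolvent_exists s0 lf.
by rewrite (res_eq s0 lf h); exact: hf.
Qed.

(** Closure of the domain of the operator. On the domain the generator controls the Euler error; the
    remaining data are reached through uniform bounds. *)
Definition approximable f := l2 f /\ forall e : R, 0 < e ->
  exists u g, form_operator G u g /\ nm (f - u) <= e.

Lemma approximable_operator u g : form_operator G u g -> approximable u.
Proof.
move=> ug; have [lu _] := form_operator_l2 ug; split=> // e e0.
exists u, g; split => //; rewrite subrr.
have l0 : l2 0 by exact: l2_0.
rewrite -[X in nm X](scale0r (0 : X -> R)) nmZ // normr0 mul0r; exact: ltW.
Qed.

(** The resolvents [res s f] lie in the domain and, by [res_near], tend to [f] at rate [sqrt s];
    this dictates the choice of [s]. *)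
Lemma approximable_fin_supp f : fin_supp f -> approximable f.
Proof.
move=> ff; have lf := l2_fin_supp G ff; split=> // e e0.
have E0 := energy_ge0 G ff.
pose s := e ^+ 2 / (1 + E f f).
have s0 : 0 < s by rewrite divr_gt0 ?exprn_gt0 // ltr_wpDr.
exists (res s f), (s^-1 *: (f - res s f)); split; first exact: res_op.
rewrite nmBC //; last exact: res_l2.
rewrite -(@ler_pXn2r _ 2) // ?nnegrE ?nm_ge0 ?(ltW e0) //.
apply: le_trans (res_near s0 ff) _; rewrite /s mulrAC ler_pdivrMr ?ltr_wpDr //.
by rewrite ler_wpM2l ?sqr_ge0 // lerDr.
Qed.

End ResolventFunction.

(** * The heat semigroup *)

Section HeatSemigroup.
Variables (R : realType) (X : countType) (G : graph R X).
Variables (P : R -> (X -> R) -> (X -> R)) (hP : is_heat_semigroup G P).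
Local Notation l2 := (l2 G).
Local Notation nm := (l2_norm G).
Local Notation res := (resolvent G).
Implicit Types (f g u v : X -> R) (s t : R).

Lemma heatB t f g : 0 <= t -> l2 f -> l2 g -> P t (f - g) = P t f - P t g.
Proof.
move=> t0 lf lg; have := heat_linear hP (-1) t0 lg lf.
by rewrite !scaleN1r addrC (addrC (- P t g)).
Qed.

Lemma heatD t f g : 0 <= t -> l2 f -> l2 g -> P t (f + g) = P t f + P t g.
Proof.
by move=> t0 lf lg; have := heat_linear hP 1 t0 lf lg; rewrite !scale1r.
Qed.

Lemma heatZ t a f : 0 <= t -> l2 f -> P t (a *: f) = a *: P t f.
Proof.
move=> t0 lf; have := heat_linear hP (a - 1) t0 lf lf.
rewrite scalerBl scale1r subrK => ->.
by rewrite scalerBl scale1r subrK.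
Qed.

Let p3 n : R := (3^-1) ^+ n.

Let p3_gt0 n : 0 < p3 n. Proof. by rewrite exprn_gt0 // invr_gt0. Qed.

Let p3S n : p3 n.+1 = p3 n / 3. Proof. by rewrite /p3 exprSr. Qed.

Lemma heat_opnorm t : 0 <= t -> exists c : R,
  [/\ 0 <= c, forall f, l2 f -> nm (P t f) <= c * nm f &
   forall b, b < c -> exists2 f, l2 f & nm f <= 1 /\ b < nm (P t f)].
Proof.
move=> t0; have [C hC] := heat_bounded hP t0.
pose S := [set nm (P t f) | f in [set f | l2 f /\ nm f <= 1]].
have l0 : l2 0 by exact: l2_0.
have n0 : nm 0 = 0.
  by rewrite -[X in nm X](scale0r (0 : X -> R)) nmZ // normr0 mul0r.
have S0 : S 0.
  exists 0; first by split; rewrite ?n0.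
  apply/eqP; rewrite eq_le nm_ge0 andbT.
  by apply: le_trans (hC 0 l0) _; rewrite n0 mulr0.
have hs : has_sup S.
  split; first by exists 0.
  exists `|C| => _ [f [lf nf] <-]; apply: le_trans (hC f lf) _.
  apply: le_trans (ler_wpM2r (nm_ge0 _ _) (ler_norm C)) _.
  by rewrite -[leRHS]mulr1 ler_wpM2l.
have ub f : l2 f -> nm f <= 1 -> nm (P t f) <= sup S.
  by move=> lf nf; apply: sup_ubound; [exact: hs.2|exists f].
exists (sup S); split.
- by apply: sup_ubound; [exact: hs.2|exact: S0].
- move=> f lf; have := nm_ge0 G f; rewrite le_eqVlt => /orP[/eqP h|h].
    by rewrite -h mulr0; apply: le_trans (hC f lf) _; rewrite -h mulr0.
  rewrite -ler_pdivrMr //.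
  have := ub ((nm f)^-1 *: f) (l2Z _ lf).
  rewrite nmZ // ger0_norm ?invr_ge0 ?(ltW h) // mulVf ?lt0r_neq0 // lexx.
  move=> /(_ isT); rewrite heatZ // nmZ; last exact: heat_l2.
  by rewrite ger0_norm ?invr_ge0 ?(ltW h) // mulrC.
- move=> b bS; have d0 : 0 < sup S - b by rewrite subr_gt0.
  have [_ [f [lf nf] <-] h] := sup_adherent d0 hs.
  by exists f => //; split=> //; move: h; rewrite opprB addrC subrK.
Qed.

(* Uniform boundedness near time [0], by the gliding hump argument of Sokal:
   [x] is a sum of terms [+- 3^-n f_n] where [f_n] almost realises the norm of
   [P (t n)]. *)
Lemma heat_bounded_near0 : exists d C : R, [/\ 0 < d, 0 <= C &
  forall t f, 0 <= t <= d -> l2 f -> nm (P t f) <= C * nm f].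
Proof.
apply: contrapT => H.
have step n : exists a : R * R * (X -> R),
  [/\ 0 <= a.1.1 <= n.+1%:R^-1, 0 <= a.1.2, 6 * 3 ^+ n * n%:R <= a.1.2,
      forall f, l2 f -> nm (P a.1.1 f) <= a.1.2 * nm f &
      [/\ l2 a.2, nm a.2 <= p3 n & 2 / 3 * a.1.2 * p3 n <= nm (P a.1.1 a.2)]].
  have [t [t0 [f lf hf]]] : exists t, 0 <= t <= n.+1%:R^-1 /\ exists2 f, l2 f &
      6 * 3 ^+ n * n%:R * nm f < nm (P t f).
    apply: contrapT => H2; apply: H.
    exists n.+1%:R^-1, (6 * 3 ^+ n * n%:R); split => //.
    move=> t f tn lf; rewrite leNgt; apply/negP => h; apply: H2.
    by exists t; split => //; exists f.
  have /andP[tp tn] := t0.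
  have [c [c0 hc1 hc2]] := heat_opnorm tp.
  have cK : 6 * 3 ^+ n * n%:R < c.
    rewrite ltNge; apply/negP => cK.
    have := lt_le_trans hf (hc1 f lf).
    by rewrite ltNge ler_wpM2r // nm_ge0.
  have cp : 0 < c.
    by apply: le_lt_trans cK; rewrite !mulr_ge0 // exprn_ge0.
  have [|g lg [ng hg]] := hc2 (2 / 3 * c); first by lra.
  exists (t, c, p3 n *: g); split => //=; first exact: ltW.
  split; first exact: l2Z.
    by rewrite nmZ // gtr0_norm // ler_piMr // ltW.
  rewrite heatZ // nmZ; last exact: heat_l2.
  by rewrite gtr0_norm // mulrC ler_pM2l // ltW.
have [a ha] := choice step.
pose t n := (a n).1.1; pose c n := (a n).1.2; pose g n := (a n).2.
have lg n : l2 (g n) by have [_ _ _ _ []] := ha n.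
have t0 n : 0 <= t n by have [/andP[]] := ha n.
(* The sign is chosen against cancellation: the images of [x m + g m] and [x m - g m] differ by
   twice that of [g m], so one of them is at least as large as the latter. *)
pose x := fix x n : X -> R := if n is m.+1 then
    if nm (P (t m) (g m)) <= nm (P (t m) (x m + g m)) then x m + g m
    else x m - g m
  else 0.
have lx n : l2 (x n).
  elim: n => [|n IH] /=; first exact: l2_0.
  by case: ifP => _; [exact: l2D|exact: l2B].
have xg n : nm (P (t n) (g n)) <= nm (P (t n) (x n.+1)).
  rewrite /=; case: ifPn => //; rewrite -ltNge => h.
  have l1 := heat_l2 hP (t0 n) (l2D (lx n) (lg n)).
  have l3 := heat_l2 hP (t0 n) (l2B (lx n) (lg n)).
  have lPg := heat_l2 hP (t0 n) (lg n).
  have := nmB_le l1 l3; rewrite -heatB //; try exact: l2D; try exact: l2B.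
  have -> : x n + g n - (x n - g n) = 2 *: g n.
    by apply/funext => y; rewrite !fctE /GRing.scale /= /GRing.scale /=; ring.
  rewrite heatZ // nmZ // ger0_norm //; lra.
have xd n : nm (x n.+1 - x n) <= p3 n.
  have [_ _ _ _ [_ h _]] := ha n; rewrite -/(g n) in h.
  rewrite /=; case: ifP => _; first by rewrite addrAC subrr add0r.
  by rewrite addrAC subrr add0r nmN.
have xc n k : nm (x (n + k)%N - x n) <= 3 / 2 * (p3 n - p3 (n + k)%N).
  elim: k => [|k IH].
    rewrite addn0 !subrr mulr0.
    have l0 : l2 0 by exact: l2_0.
    by rewrite -[X in nm X](scale0r (0 : X -> R)) nmZ // normr0 mul0r.
  rewrite addnS; have := nm_triangle (lx (n + k).+1) (lx (n + k)%N) (lx n).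
  have := xd (n + k)%N; rewrite (p3S (n + k)); lra.
have p3_le e : 0 < e -> exists N, forall n, (N <= n)%N -> p3 n <= e.
  move=> e0; have h : p3 n @[n --> \oo] --> (0 : R).
    by apply: cvg_expr; rewrite ger0_norm ?invr_ge0 // invf_lt1 // ltr1n.
  have /cvgrPdist_le/(_ _ e0)[N _ hN] := h; exists N => n /hN /=.
  by rewrite sub0r normrN ger0_norm // ltW.
have xc2 n m : (n <= m)%N -> nm (x m - x n) <= 3 / 2 * p3 n.
  move=> nm_; have := xc n (m - n)%N; rewrite subnKC //.
  by have := p3_gt0 m; lra.
have [|y ly xy] := l2_complete lx.
  move=> e e0; have e3 : 0 < e / 3 by rewrite divr_gt0.
  have [N hN] := p3_le _ e3; exists N => m n Nm Nn.
  have [mn|/ltnW nm_] := leqP m n.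
    rewrite nmBC //; have := xc2 _ _ mn; have := hN _ Nm; lra.
  have := xc2 _ _ nm_; have := hN _ Nn; lra.
have yx n : nm (x n.+1 - y) <= p3 n / 2.
  have h1 : nm (x m - y) + 3 / 2 * p3 n.+1 @[m --> \oo] --> 0 + 3 / 2 * p3 n.+1.
    by apply: cvgD => //; exact: cvg_cst.
  have -> : p3 n / 2 = 0 + 3 / 2 * p3 n.+1 by rewrite p3S; field.
  apply: (ler_cvg (cvg_cst _) h1); exists n.+1 => // m /= nm_.
  have := xc2 _ _ nm_; have := nm_triangle (lx n.+1) (lx m) ly.
  rewrite (nmBC (lx m) (lx n.+1)); lra.
have big n : n%:R <= nm (P (t n) y).
  have [_ c0 cn hc [_ _ hg]] := ha n.
  rewrite -/(t n) -/(c n) -/(g n) in c0 cn hc hg.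
  have h := nm_triangle (heat_l2 hP (t0 n) (lx n.+1)) (heat_l2 hP (t0 n) ly)
    (l2_0 G).
  rewrite !subr0 -heatB // in h.
  have h2 := hc _ (l2B (lx n.+1) ly).
  have h3 := ler_wpM2l c0 (yx n).
  have h4 := xg n.
  (* The hump realises a share [2 / 3] of [c n * p3 n] and all later terms can cancel at most
     [1 / 2]. The remaining [1 / 6] explains the threshold [6 * 3 ^+ n * n] imposed on [c n]. *)
  have h5 : c n * p3 n / 6 <= nm (P (t n) y) by lra.
  apply: le_trans h5.
  have e : n%:R = 6 * 3 ^+ n * n%:R * p3 n / 6.
    rewrite /p3 exprVn; field; exact: expf_neq0.
  by rewrite [leLHS]e ler_pM2r ?invr_gt0 // ler_pM2r.
have /cvgrPdist_le/(_ _ ltr01) := heat_continuous hP ly.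
rewrite near_withinE => -[d /= d0 hd].
have [N hN] := harmonic_lt (divr_gt0 d0 (ltr0n R 2)).
have bound n : (N <= n)%N -> nm (P (t n) y) <= nm y + 1.
  move=> Nn; have [/andP[_ tn] _ _ _ _] := ha n; rewrite -/(t n) in tn.
  have := t0 n; rewrite le_eqVlt => /orP[/eqP <-|tp].
    by rewrite (heat_0 hP) // lerDl.
  have := hd (t n); rewrite /= sub0r normrN gtr0_norm // => /(_ _ tp).
  rewrite sub0r normrN ger0_norm ?nm_ge0 // => h.
  have := nmD (l2B (heat_l2 hP (t0 n) ly) ly) ly; rewrite subrK.
  suff /h : t n < d by lra.
  by have := hN _ Nn; set q := _^-1 in tn *; lra.
pose M := Num.truncn (nm y + 1).
have := big (N + M.+1)%N; have := bound (N + M.+1)%N (leq_addr _ _).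
have : nm y + 1 < M.+1%:R by rewrite truncnS_gt.
have : M.+1%:R <= (N + M.+1)%:R :> R by rewrite ler_nat leq_addl.
lra.
Qed.

(** The bound near [0] is propagated by the semigroup law over finitely many steps of length [d]. *)
Lemma heat_bounded_on (T : R) : exists2 C : R, 1 <= C &
  forall t f, 0 <= t <= T -> l2 f -> nm (P t f) <= C * nm f.
Proof.
have [d [C [d0 C0 hC]]] := heat_bounded_near0.
pose D := C + 1; have D1 : 1 <= D by rewrite lerDr.
have hD t f : 0 <= t <= d -> l2 f -> nm (P t f) <= D * nm f.
  move=> td lf; apply: le_trans (hC t f td lf) _.
  by rewrite ler_wpM2r ?nm_ge0 // lerDl.
have it k t f : 0 <= t <= k%:R * d -> l2 f -> nm (P t f) <= D ^+ k * nm f.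
  elim: k t f => [|k IH] t f /andP[t0 tk] lf.
    have -> : t = 0 by apply/eqP; rewrite eq_le t0 andbT -(mul0r d).
    by rewrite (heat_0 hP) // expr0 mul1r.
  have [td|dt] := leP t d.
    apply: le_trans (hD t f _ lf) _; first by rewrite t0.
    by rewrite ler_wpM2r ?nm_ge0 // -[leLHS]expr1 ler_weXn2l.
  have e : t = d + (t - d) by rewrite addrC subrK.
  have td0 : 0 <= t - d by rewrite subr_ge0 ltW.
  rewrite e (heat_add hP) ?(ltW d0) //.
  apply: le_trans (hD d _ _ _) _; first by rewrite (ltW d0) /=.
    exact: heat_l2.
  rewrite exprS -mulrA ler_wpM2l //; first exact: le_trans D1.
  apply: IH => //; rewrite td0 /= lerBlDr; move: tk; rewrite -natr1; lra.
pose k := (Num.truncn (T / d)).+1.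
exists (D ^+ k); first exact: exprn_ege1.
move=> t f /andP[t0 tT] lf; apply: it => //; rewrite t0 /=.
apply: le_trans tT _; rewrite -ler_pdivrMr //; apply: ltW.
by rewrite truncnS_gt.
Qed.

(** For [s < t] the difference is [P s (f - P (t - s) f)], so right continuity at [0] and the
    uniform bound suffice. *)
Lemma heat_ucontinuous (T : R) f : l2 f -> forall e : R, 0 < e ->
  exists2 d : R, 0 < d & forall s t, 0 <= s <= T -> 0 <= t <= T ->
    `|s - t| < d -> nm (P s f - P t f) <= e.
Proof.
move=> lf e e0; have [C C1 hC] := heat_bounded_on T.
have C0 : 0 < C by exact: lt_le_trans C1.
have eC : 0 < e / C by rewrite divr_gt0.
have /cvgrPdist_le/(_ _ eC) := heat_continuous hP lf.
rewrite near_withinE => -[d /= d0 hd]; exists d => //.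
have key s t : 0 <= s -> s < t -> t <= T -> t - s < d ->
    nm (P s f - P t f) <= e.
  move=> s0 st tT ts.
  have ts0 : 0 < t - s by rewrite subr_gt0.
  have -> : t = s + (t - s) by rewrite addrC subrK.
  rewrite (heat_add hP) // ?(ltW ts0) //.
  have lt : l2 (P (t - s) f) by apply: (heat_l2 hP) => //; exact: ltW.
  rewrite -heatB //.
  apply: le_trans (hC _ _ _ (l2B lf lt)) _.
    by rewrite s0 /=; apply: le_trans tT; exact: ltW.
  have := hd (t - s); rewrite /= sub0r normrN gtr0_norm // => /(_ ts ts0).
  rewrite sub0r normrN ger0_norm ?nm_ge0 // => h.
  by rewrite nmBC // mulrC -ler_pdivlMr.
move=> s t /andP[s0 sT] /andP[t0 tT].
case: (ltgtP s t) => [st|ts|->] h.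
- by apply: key => //; move: h; rewrite distrC gtr0_norm // subr_gt0.
- rewrite nmBC; try by apply: (heat_l2 hP).
  by apply: key => //; move: h; rewrite gtr0_norm // subr_gt0.
- rewrite subrr; have l0 : l2 0 by exact: l2_0.
  rewrite -[X in nm X](scale0r (0 : X -> R)) nmZ // normr0 mul0r; exact: ltW.
Qed.

Lemma heat_operator t u g : 0 <= t -> form_operator G u g ->
  form_operator G (P t u) (P t g).
Proof.
move=> t0 ug; have [lu lg] := form_operator_l2 ug.
apply/(heat_generator hP); try exact: heat_l2.
have [C hC] := heat_bounded hP t0.
have h := (heat_generator hP lu lg).1 ug.
apply: (@squeeze0 _ _ _ _ _ (fun s => C * nm (s^-1 *: (P s u - u) + g))).
  rewrite -[X in _ --> X](mulr0 C); apply: cvgM => //; exact: cvg_cst.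
rewrite near_withinE; apply: nearW => s s0; have s0' := ltW s0.
have lsu := heat_l2 hP s0' lu.
rewrite ger0_norm ?nm_ge0 //.
have -> : s^-1 *: (P s (P t u) - P t u) + P t g =
          P t (s^-1 *: (P s u - u) + g).
  have l1 := l2B lsu lu; have l3 := l2Z s^-1 l1.
  rewrite (heatD t0 l3 lg) (heatZ s^-1 t0 l1) (heatB t0 lsu lu).
  by rewrite -(heat_add hP s0' t0 lu) -(heat_add hP t0 s0' lu) (addrC s).
by apply: hC; apply: l2D => //; apply: l2Z; exact: l2B.
Qed.

(** Consistency of implicit Euler: [P s u + s L (P s u) = u + o(s)] for [u] in the domain, with
    [L (P s u) = P s g]. *)
Lemma heat_error u g : form_operator G u g -> forall e : R, 0 < e ->
  exists2 d : R, 0 < d & forall s, 0 < s < d ->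
    nm (P s u + s *: P s g - u) <= e * s.
Proof.
move=> ug e e0; have [lu lg] := form_operator_l2 ug.
have e2 : 0 < e / 2 by rewrite divr_gt0.
have /cvgrPdist_le/(_ _ e2) := (heat_generator hP lu lg).1 ug.
rewrite near_withinE => -[d1 /= d10 h1].
have /cvgrPdist_le/(_ _ e2) := heat_continuous hP lg.
rewrite near_withinE => -[d2 /= d20 h2].
exists (Num.min d1 d2); first by rewrite lt_min d10.
move=> s /andP[s0]; rewrite lt_min => /andP[s1 s2].
have s0' := ltW s0.
have lsu := heat_l2 hP s0' lu; have lsg := heat_l2 hP s0' lg.
have la : l2 (s^-1 *: (P s u - u) + g).
  by apply: l2D => //; apply: l2Z; exact: l2B.
have lb : l2 (P s g - g) by exact: l2B.
have -> : P s u + s *: P s g - u =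
    s *: ((s^-1 *: (P s u - u) + g) + (P s g - g)).
  apply/funext => x; rewrite !fctE /GRing.scale /= /GRing.scale /=.
  by field; exact: lt0r_neq0.
rewrite nmZ; last exact: l2D.
rewrite gtr0_norm // mulrC ler_pM2r //; apply: le_trans (nmD la lb) _.
have := h1 s; rewrite /= sub0r normrN gtr0_norm // => /(_ s1 s0).
rewrite sub0r normrN ger0_norm ?nm_ge0 //.
have := h2 s; rewrite /= sub0r normrN gtr0_norm // => /(_ s2 s0).
rewrite sub0r normrN ger0_norm ?nm_ge0 //; lra.
Qed.

Lemma iter_res_l2 s k f : 0 < s -> l2 f -> l2 (iter k (res s) f).
Proof. by move=> s0 lf; elim: k => //= k; exact: res_l2. Qed.

Lemma resB s f g : 0 < s -> l2 f -> l2 g -> res s (f - g) = res s f - res s g.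
Proof.
move=> s0 lf lg; have := res_lin (-1) s0 lg lf.
by rewrite !scaleN1r addrC (addrC (- res s g)).
Qed.

Lemma iter_resB s k f g : 0 < s -> l2 f -> l2 g ->
  iter k (res s) (f - g) = iter k (res s) f - iter k (res s) g.
Proof.
by move=> s0 lf lg; elim: k => //= k ->; rewrite resB //; exact: iter_res_l2.
Qed.

Lemma iter_res_contr s k f : 0 < s -> l2 f -> nm (iter k (res s) f) <= nm f.
Proof.
move=> s0 lf; elim: k => //= k IH; apply: le_trans IH.
by apply: res_contr => //; exact: iter_res_l2.
Qed.

(** Exponential formula, uniform over grid times up to [T]. Replacing [f] by [u] in the domain costs
    [e / 4] on each side; the consistency errors accumulate to [e / 2] because the resolvent is a
    contraction. *)
Lemma heat_resolvent (T : R) f : approximable G f -> forall e : R, 0 < e ->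
  exists2 d : R, 0 < d & forall s k, 0 < s < d -> k%:R * s <= T ->
    nm (P (k%:R * s) f - iter k (res s) f) <= e.
Proof.
move=> [lf fa] e e0; have [C C1 hC] := heat_bounded_on T.
have C0 : 0 < C by exact: lt_le_trans C1.
have e4 : 0 < e / (4 * C) by rewrite divr_gt0 // mulr_gt0.
have [u [g [ug fu]]] := fa _ e4; have [lu lg] := form_operator_l2 ug.
pose T1 := `|T| + 1; have T10 : 0 < T1 by rewrite ltr_wpDl.
have et : 0 < e / (2 * C * T1) by rewrite divr_gt0 // !mulr_gt0.
have [d d0 hd] := heat_error ug et; exists d => // s k sd ks.
have /andP[s0 _] := sd; have s0' := ltW s0.
have err := hd s sd.
have ks0 j : 0 <= j%:R * s by rewrite mulr_ge0.
have lerr : l2 (P s u + s *: P s g - u).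
  apply: l2B => //; apply: l2D; first exact: heat_l2.
  by apply: l2Z; exact: heat_l2.
have key j : (j <= k)%N ->
    nm (P (j%:R * s) u - iter j (res s) u) <= j%:R * (C * (e / (2 * C * T1) * s)).
  elim: j => [|j IH] jk.
    rewrite !mul0r (heat_0 hP) // subrr.
    have l0 : l2 0 by exact: l2_0.
    by rewrite -[X in nm X](scale0r (0 : X -> R)) nmZ // normr0 mul0r.
  have jT : 0 <= j%:R * s <= T.
    rewrite ks0 /=; apply: le_trans ks.
    by rewrite ler_wpM2r // ler_nat ltnW.
  (* The consistency error at time [0] carried to time [j s]. This makes one rate [d] valid for all
     steps. *)
  pose q := P (j%:R * s) (P s u + s *: P s g - u).
  have lq : l2 q by exact: heat_l2.
  have lju := heat_l2 hP (ks0 j) lu.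
  have -> : P (j.+1%:R * s) u = res s (P (j%:R * s) u + q).
    have -> : P (j%:R * s) u + q = P (j.+1%:R * s) u + s *: P (j.+1%:R * s) g.
      rewrite /q heatB //; last first.
        by apply: l2D; [exact: heat_l2|apply: l2Z; exact: heat_l2].
      rewrite heatD ?heatZ //; try exact: heat_l2; last first.
        by apply: l2Z; exact: heat_l2.
      rewrite addrC subrK -!(heat_add hP) //.
      by rewrite -natr1 mulrDl mul1r.
    by rewrite res_uniq //; exact: heat_operator.
  rewrite iterS -resB //; last 2 first.
  - exact: l2D.
  - exact: iter_res_l2.
  have lit := iter_res_l2 j s0 lu.
  apply: le_trans (res_contr s0 _) _; first by apply: l2B => //; exact: l2D.
  have -> : P (j%:R * s) u + q - iter j (res s) u =
            (P (j%:R * s) u - iter j (res s) u) + q by rewrite addrAC.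
  apply: le_trans (nmD (l2B lju lit) lq) _.
  have := IH (ltnW jk).
  have : nm q <= C * (e / (2 * C * T1) * s).
    apply: le_trans (hC _ _ jT lerr) _; rewrite ler_pM2l //.
  rewrite -natr1; lra.
have kT : 0 <= k%:R * s <= T by rewrite ks0.
have lkf := heat_l2 hP (ks0 k) lf; have lku := heat_l2 hP (ks0 k) lu.
have lif := iter_res_l2 k s0 lf; have liu := iter_res_l2 k s0 lu.
have h1 := nm_triangle lkf lku lif; have h2 := nm_triangle lku liu lif.
have h3 := key k (leqnn k).
have h4 : nm (P (k%:R * s) f - P (k%:R * s) u) <= e / 4.
  rewrite -heatB //; apply: le_trans (hC _ _ kT (l2B lf lu)) _.
  have -> : e / 4 = C * (e / (4 * C)) by field; exact: lt0r_neq0.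
  by rewrite ler_pM2l.
have h5 : nm (iter k (res s) u - iter k (res s) f) <= e / 4.
  rewrite -iter_resB //; apply: le_trans (iter_res_contr _ s0 (l2B lu lf)) _.
  rewrite nmBC //; apply: le_trans fu _.
  rewrite ler_pM2l // lef_pV2 ?posrE ?mulr_gt0 //; lra.
have h6 : k%:R * (C * (e / (2 * C * T1) * s)) <= e / 2.
  have -> : k%:R * (C * (e / (2 * C * T1) * s)) = e / 2 * (k%:R * s / T1).
    by field; rewrite !lt0r_neq0.
  rewrite ler_piMr ?divr_ge0 ?(ltW e0) // ler_pdivrMr // mul1r.
  by apply: le_trans ks _; rewrite /T1; have := ler_norm T; lra.
lra.
Qed.

End HeatSemigroup.

(** * Riemann sums of uniformly continuous functions *)

Section RiemannSums.
Variable R : realType.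
Local Notation leb := (@lebesgue_measure R).

Definition ucont_on (t : R) (F : R -> R) := forall e : R, 0 < e ->
  exists2 d : R, 0 < d & forall s s', 0 <= s <= t -> 0 <= s' <= t ->
    `|s - s'| < d -> `|F s - F s'| <= e.

Lemma ucont_on_within t F : ucont_on t F -> {within `[0, t], continuous F}.
Proof.
move=> uF; apply/(@subspace_continuousP R) => x; rewrite /= in_itv /= => xt.
apply/cvgrPdist_le => e e0; have [d d0 hd] := uF e e0.
rewrite near_withinE; exists d => // y /= xy; rewrite in_itv /= => yt.
exact: hd.
Qed.

Lemma integrable_cst_itv (a b c : R) : leb.-integrable `[a, b] (EFin \o cst c).
Proof.
apply: continuous_compact_integrable; first exact: segment_compact.
by apply: continuous_subspaceT => x; exact: cvg_cst.
Qed.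

Lemma Rintegral_near (a b c e : R) (F : R -> R) : a <= b ->
  leb.-integrable `]a, b] (EFin \o F) ->
  (forall s, a < s <= b -> `|F s - c| <= e) ->
  `|\int[leb]_(s in `]a, b]) F s - (b - a) * c| <= (b - a) * e.
Proof.
move=> ab iF Fc.
have ic k : leb.-integrable `]a, b] (EFin \o cst k).
  apply: (integrableS _ _ _ (integrable_cst_itv a b k)) => //.
  by apply: subset_itvr; rewrite bnd_simp.
have mab : fine (leb `]a, b]) = b - a.
  rewrite lebesgue_measure_itv /=; case: ifP => //.
  rewrite lte_fin => /negbT; rewrite -leNgt => ba.
  by apply/esym/eqP; rewrite subr_eq0 eq_le ba ab.
have Rc k : \int[leb]_(s in `]a, b]) k = (b - a) * k.
  by rewrite Rintegral_cst //= mab mulrC.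
rewrite -(Rc c) -(Rc e) -RintegralB //.
have iFc : leb.-integrable `]a, b] (EFin \o (fun s => F s - c)).
  by apply: integrableB iF (ic c).
apply: le_trans (le_normr_Rintegral _ iFc) _ => //.
apply: le_Rintegral => //.
- exact: (integrable_norm iFc).
- exact: ic.
- exact: (ic c).
Qed.

Lemma ucont_integrable t F : ucont_on t F -> leb.-integrable `[0, t] (EFin \o F).
Proof.
move=> uF; apply: continuous_compact_integrable; first exact: segment_compact.
exact: ucont_on_within.
Qed.

(** Right endpoints are used because they match the powers [i.+1] of the resolvent in [eulerE]. *)
Lemma riemann_sum_cvg t F : 0 < t -> ucont_on t F ->
  t / N.+1%:R * (\sum_(i < N.+1) F (i.+1%:R * (t / N.+1%:R)))
    @[N --> \oo] --> \int[leb]_(s in `[0, t]) F s.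
Proof.
move=> t0 uF; have iF := ucont_integrable uF.
apply/cvgrPdist_le => e e0.
have et : 0 < e / t by rewrite divr_gt0.
have [d d0 hd] := uF _ et.
have [M hM] := harmonic_lt (divr_gt0 d0 (mulr_gt0 (ltr0n R 2) t0)).
exists M => // N /= /hM hN.
pose h := t / N.+1%:R; have h0 : 0 < h by rewrite divr_gt0.
have hdd : h < d.
  rewrite /h; set q := _^-1 in hN *.
  have : t * q <= t * (d / (2 * t)) by rewrite ler_pM2l.
  have -> : t * (d / (2 * t)) = d / 2 by field; exact: lt0r_neq0.
  lra.
have Nh : N.+1%:R * h = t by rewrite /h; field; rewrite addrC natr1 pnatr_eq0.
pose I j := \int[leb]_(s in `[0, j%:R * h]) F s.
suff key j : (j <= N.+1)%N ->
    `|I j - h * (\sum_(i < j) F (i.+1%:R * h))| <= j%:R * (h * (e / t)).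
  have := key N.+1 (leqnn _); rewrite /I Nh mulrA Nh => /le_trans; apply.
  by rewrite mulrCA divff ?mulr1 // lt0r_neq0.
elim: j => [|j IH] jN.
  rewrite /I !mul0r set_itv1 Rintegral_set1 big_ord0 mulr0 subrr normr0 //.
have j0 : 0 <= j%:R * h by rewrite mulr_ge0 // ltW.
have jj : j%:R * h <= j.+1%:R * h by rewrite ler_pM2r // ler_nat.
have jt : j.+1%:R * h <= t by rewrite -Nh ler_pM2r // ler_nat.
have step : j.+1%:R * h - j%:R * h = h by rewrite -mulrBl -natr1 addrAC subrr add0r mul1r.
have i1 : leb.-integrable `[0, j.+1%:R * h] (EFin \o F).
  apply: (integrableS _ _ _ iF) => //.
  by apply: subset_itvl; rewrite bnd_simp.
have i2 : leb.-integrable `]j%:R * h, j.+1%:R * h] (EFin \o F).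
  apply: (integrableS _ _ _ i1) => //.
  by apply: subset_itvr; rewrite bnd_simp.
have e1 : I j.+1 = I j + \int[leb]_(s in `]j%:R * h, j.+1%:R * h]) F s.
  by rewrite -(Rintegral_itvB i1) ?bnd_simp // addrC subrK.
have h1 := Rintegral_near (c := F (j.+1%:R * h)) (e := e / t) jj i2.
rewrite step in h1; rewrite e1 big_ord_recr /= mulrDr opprD addrACA.
apply: le_trans (ler_normD _ _) _.
have -> : j.+1%:R * (h * (e / t)) = j%:R * (h * (e / t)) + h * (e / t).
  by rewrite -natr1 mulrDl mul1r.
apply: lerD; first exact: IH (ltnW jN).
apply: h1 => s /andP[s1 s2]; apply: hd.
- by rewrite (le_trans j0 (ltW s1)) (le_trans s2 jt).
- by rewrite (le_trans j0 jj) jt.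
- by rewrite distrC ger0_norm ?subr_ge0 //; lra.
Qed.

End RiemannSums.

(** Compactness of a segment; it replaces diagonal extraction, with one ultrafilter for all vertices
    and times. *)
Lemma ultra_bounded_cvg (R : realType) (T : Type) (U : set_system T)
  {UU : UltraFilter U} (u : T -> R) (C : R) : (forall t, `|u t| <= C) ->
  exists l : R, u t @[t --> U] --> l.
Proof.
move=> uC; have PU : ProperFilter U by exact: ultra_proper.
have [|l [_ cl]] := @segment_compact R (- C) C (fmap u U) _.
  by apply: (@filterE T U _) => t /=; rewrite in_itv /= -ler_norml.
exists l => V Vl /=; have [//|nV] := in_ultra_setVsetC (u @^-1` V) UU.
have [z [zn zV]] := cl (~` V) V nV Vl.
by case: zn.
Qed.

Lemma ultra_nat (R : realType) : exists2 U : set_system nat, UltraFilter U & \oo `<=` U.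
Proof. by have [U [UU sU]] := @ultraFilterLemma nat \oo _; exists U. Qed.

(** * Implicit Euler schemes and their comparison with constants *)

Section Incompleteness.
Variables (R : realType) (X : countType) (G : graph R X).
Variables (P : R -> (X -> R) -> (X -> R)) (hP : is_heat_semigroup G P).
Local Notation kappa := (killing G).
Local Notation mu := (vmeas G).
Local Notation l2 := (l2 G).
Local Notation nm := (l2_norm G).
Local Notation res := (resolvent G).
Local Notation leb := (@lebesgue_measure R).
Implicit Types (f g k u v : X -> R) (s t : R).

Lemma heat_ucont t f x : l2 f -> ucont_on t (fun s => P s f x).
Proof.
move=> lf e e0; have s0 : 0 < Num.sqrt (mu x) by rewrite sqrtr_gt0 vmeas_gt0.
have es : 0 < e * Num.sqrt (mu x) by rewrite mulr_gt0.
have [d d0 hd] := heat_ucontinuous hP t lf es; exists d => // s s' hs hs' ss.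
have /andP[s0' _] := hs; have /andP[s0'' _] := hs'.
have := l2_pointwise x (l2B (heat_l2 hP s0' lf) (heat_l2 hP s0'' lf)).
rewrite fctE => h; apply: le_trans h _.
by rewrite mulrC ler_pdivrMr //; exact: hd.
Qed.

(* Implicit Euler scheme for [u' + L u = k], [u 0 = f]. *)
Fixpoint euler s k f n : X -> R :=
  if n is m.+1 then res s (euler s k f m + s *: k) else f.

Lemma euler_l2 s k f n : 0 < s -> l2 k -> l2 f -> l2 (euler s k f n).
Proof.
move=> s0 lk lf; elim: n => //= n IH; apply: res_l2 => //.
by apply: l2D => //; exact: l2Z.
Qed.

(** Discrete Duhamel formula; the sum is the one whose Riemann limit is the integral of [P s k]. *)
Lemma eulerE s k f n x : 0 < s -> l2 k -> l2 f ->
  euler s k f n x = iter n (res s) f x +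
    s * (\sum_(i < n) iter i.+1 (res s) k x).
Proof.
move=> s0 lk lf.
pose S := fix S n : X -> R := if n is m.+1 then res s (S m + k) else 0.
have lS m : l2 (S m).
  by elim: m => [|m IH] /=; [exact: l2_0|apply: res_l2 => //; exact: l2D].
have resD f1 f2 : l2 f1 -> l2 f2 -> res s (f1 + f2) = res s f1 + res s f2.
  by move=> l1 l3; have := res_lin 1 s0 l1 l3; rewrite !scale1r.
have res0 : res s 0 = 0.
  have l0 : l2 0 by exact: l2_0.
  by have := res_lin (-1) s0 l0 l0; rewrite !scaleN1r !addNr.
have SS m : S m.+1 = S m + iter m.+1 (res s) k.
  elim: m => [|m IH]; first by rewrite /= !add0r.
  rewrite [LHS]/= -/(S m.+1) [in LHS]IH addrAC resD.
  - by rewrite iterS.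
  - exact: l2D.
  - exact: iter_res_l2.
have SE m : S m x = \sum_(i < m) iter i.+1 (res s) k x.
  by elim: m => [|m IH]; rewrite ?big_ord0 // SS fctE IH big_ord_recr.
have -> : euler s k f n = s *: S n + iter n (res s) f.
  elim: n => [|n IH] /=; first by rewrite scaler0 add0r.
  rewrite IH addrAC -scalerDr res_lin //; first exact: l2D.
  exact: iter_res_l2.
by rewrite addrC !fctE SE.
Qed.

Lemma euler_cvg t k f x : 0 < t -> approximable G k -> approximable G f ->
  euler (t / N.+1%:R) k f N.+1 x @[N --> \oo] -->
    P t f x + \int[leb]_(s in `[0, t]) P s k x.
Proof.
move=> t0 ak af; have [lk _] := ak; have [lf _] := af.
have rs := riemann_sum_cvg t0 (heat_ucont t x lk).
have lim2 : P t f x + t / N.+1%:R * (\sum_(i < N.+1) P (i.+1%:R * (t / N.+1%:R)) k x)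
    @[N --> \oo] --> P t f x + \int[leb]_(s in `[0, t]) P s k x.
  by apply: cvgD => //; exact: cvg_cst.
suff h : (P t f x + t / N.+1%:R * (\sum_(i < N.+1) P (i.+1%:R * (t / N.+1%:R)) k x))
    - euler (t / N.+1%:R) k f N.+1 x @[N --> \oo] --> (0 : R).
  have -> : (fun N => euler (t / N.+1%:R) k f N.+1 x) = (fun N =>
      (P t f x + t / N.+1%:R * (\sum_(i < N.+1) P (i.+1%:R * (t / N.+1%:R)) k x))
      - ((P t f x + t / N.+1%:R *
           (\sum_(i < N.+1) P (i.+1%:R * (t / N.+1%:R)) k x))
        - euler (t / N.+1%:R) k f N.+1 x)).
    by apply/funext => N; rewrite opprB addrC subrK.
  by rewrite -[X in _ --> X]subr0; exact: cvgB.
apply/cvgrPdist_le => e e0.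
have s0 : 0 < Num.sqrt (mu x) by rewrite sqrtr_gt0 vmeas_gt0.
(* The datum contributes one error of size [e / (1 + t)], the source one per unit of time, that is
   [t] of them; [Num.sqrt (mu x)] converts norms into values at [x]. *)
have et : 0 < e * Num.sqrt (mu x) / (1 + t) by rewrite divr_gt0 ?mulr_gt0 ?addr_gt0.
have [d1 d10 h1] := heat_resolvent hP t ak et.
have [d2 d20 h2] := heat_resolvent hP t af et.
pose d := Num.min d1 d2; have d0 : 0 < d by rewrite lt_min d10.
have [M hM] := harmonic_lt (divr_gt0 d0 (mulr_gt0 (ltr0n R 2) t0)).
exists M => // N /hM hN.
change (is_true (`|0 - (P t f x + t / N.+1%:R *
  (\sum_(i < N.+1) P (i.+1%:R * (t / N.+1%:R)) k x) -
  euler (t / N.+1%:R) k f N.+1 x)| <= e)).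
pose h := t / N.+1%:R; rewrite -/h; have h0 : 0 < h by rewrite divr_gt0.
have hdd : h < d.
  rewrite /h; set q := _^-1 in hN *.
  have : t * q <= t * (d / (2 * t)) by rewrite ler_pM2l.
  have -> : t * (d / (2 * t)) = d / 2 by field; exact: lt0r_neq0.
  lra.
move: hdd; rewrite lt_min => /andP[hd1 hd2].
have Nh : N.+1%:R * h = t by rewrite /h; field; rewrite addrC natr1 pnatr_eq0.
pose b := e / (1 + t).
have pw (g : X -> R) j : approximable G g -> (j <= N.+1)%N ->
    nm (P (j%:R * h) g - iter j (res h) g) <= e * Num.sqrt (mu x) / (1 + t) ->
    `|P (j%:R * h) g x - iter j (res h) g x| <= b.
  move=> [lg _] jN hg; have jh : 0 <= j%:R * h by rewrite mulr_ge0 // ltW.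
  have := l2_pointwise x (l2B (heat_l2 hP jh lg) (iter_res_l2 j h0 lg)).
  rewrite fctE => h3; apply: le_trans h3 _.
  rewrite mulrC ler_pdivrMr //; apply: le_trans hg _.
  by rewrite /b mulrAC.
have jt j : (j <= N.+1)%N -> j%:R * h <= t.
  by move=> jN; rewrite -Nh ler_pM2r // ler_nat.
rewrite sub0r normrN eulerE // opprD addrACA -mulrBr -sumrB.
have p1 : `|P t f x - iter N.+1 (res h) f x| <= b.
  rewrite -Nh; apply: pw => //; apply: h2; first by rewrite h0.
  exact: jt.
have p2 : `|\sum_(i < N.+1) (P (i.+1%:R * h) k x - iter i.+1 (res h) k x)| <=
    N.+1%:R * b.
  apply: le_trans (ler_norm_sum _ _ _) _.
  have -> : N.+1%:R * b = \sum_(i < N.+1) b.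
    by rewrite sumr_const card_ord mulr_natl.
  apply: ler_sum => i _.
  apply: pw => //; apply: h1; first by rewrite h0.
  exact: jt.
apply: le_trans (ler_normD _ _) _; rewrite normrM gtr0_norm //.
have : h * `|\sum_(i < N.+1) (P (i.+1%:R * h) k x - iter i.+1 (res h) k x)| <= t * b.
  have -> : t * b = h * (N.+1%:R * b) by rewrite -[in LHS]Nh -mulrA mulrCA.
  by rewrite ler_pM2l.
have -> : e = b + t * b.
  by rewrite /b; field; rewrite lt0r_neq0 // addr_gt0.
lra.
Qed.

(** Positivity is inherited from the resolvents through the scheme with zero source. *)
Lemma heat_ge0 t f x : 0 <= t -> fin_supp f -> (forall y, 0 <= f y) ->
  0 <= P t f x.
Proof.
rewrite le_eqVlt => /orP[/eqP <-|t0] ff f0.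
  by rewrite (heat_0 hP) //; exact: l2_fin_supp.
have f0' : fin_supp (0 : X -> R) by apply/fin_suppP; exists 0%N.
have lf := l2_fin_supp G ff.
have h := euler_cvg (x := x) t0 (approximable_fin_supp G f0') (approximable_fin_supp G ff).
have e0 s : 0 <= s -> P s 0 = 0.
  move=> s0; have l0 : l2 0 by exact: l2_0.
  by rewrite -[in LHS](scale0r (0 : X -> R)) (heatZ hP) // scale0r.
have i0 : \int[leb]_(s in `[0, t]) P s 0 x = 0.
  rewrite (@eq_Rintegral _ _ _ _ _ (cst 0)) ?Rintegral_cst ?mul0r //.
  by move=> s; rewrite inE /= in_itv /= => /andP[s0 _]; rewrite e0.
rewrite i0 addr0 in h; apply: (ler_cvg (cvg_cst 0) h); apply: nearW => N.
have s0 : 0 < t / N.+1%:R by rewrite divr_gt0.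
have l0 : l2 0 by exact: l2_0.
move: (t / N.+1%:R) s0 => q s0; move: x {h i0}; elim: N.+1 => //= n IH x.
rewrite scaler0 addr0; apply: res_ge0 => //; exact: euler_l2.
Qed.

Let one n : X -> R := fin_trunc (fun=> 1) n.
Let kn n : X -> R := fin_trunc (fun y => kappa y / mu y) n.

Let kmu0 y : 0 <= kappa y / mu y.
Proof. by rewrite divr_ge0 ?killing_ge0 // ltW // vmeas_gt0. Qed.

Lemma trunc_le f n x : 0 <= f x -> 0 <= fin_trunc f n x <= f x.
Proof. by rewrite /fin_trunc => f0; case: ifP => _; rewrite ?f0 ?lexx. Qed.

Lemma trunc_mono f n m x : 0 <= f x -> (n <= m)%N ->
  fin_trunc f n x <= fin_trunc f m x.
Proof.
rewrite /fin_trunc => f0 nm_; case: ifP => [xn|_]; last by case: ifP.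
by rewrite (leq_trans xn nm_).
Qed.

Let l2_one n : l2 (one n). Proof. exact/l2_fin_supp/fin_trunc_fin_supp. Qed.
Let lkn n : l2 (kn n). Proof. exact/l2_fin_supp/fin_trunc_fin_supp. Qed.

(** The constant [1] is a supersolution of each step: the truncated source is at most
    [kappa / mu]. *)
Lemma euler_le1 s n N x : 0 < s -> euler s (kn n) (one n) N x <= 1.
Proof.
move=> s0; elim: N x => [|N IH] x /=.
  by have /andP[] := @trunc_le (fun=> 1) n x ler01.
apply: res_le => // [|y].
  by apply: l2D; [exact: euler_l2 s0 (lkn n) (l2_one n)|exact: l2Z].
rewrite mul1r fctE; apply: lerD; first exact: IH.
rewrite /GRing.scale /= /GRing.scale /= -mulrA ler_wpM2l ?(ltW s0) //.
by have /andP[] := @trunc_le (fun y => kappa y / mu y) n y (kmu0 y).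
Qed.

(** Finite approximations of the minimal solution of [y + lam * lap y = 1 + lam * kappa / mu], an
    equation also solved by [1]. *)
Let yn lam n := res lam (one n + lam *: kn n).

Lemma cutoff_data lam n : 0 < lam -> [/\ l2 (one n + lam *: kn n),
  forall x, 0 <= (one n + lam *: kn n) x &
  forall x, (one n + lam *: kn n) x <= 1 * (1 + lam * kappa x / mu x)].
Proof.
move=> l0; split=> [|x|x].
- by apply: l2D => //; exact: l2Z.
- rewrite fctE /GRing.scale /= /GRing.scale /= addr_ge0 //.
    by have /andP[] := @trunc_le (fun=> 1) n x ler01.
  rewrite mulr_ge0 ?(ltW l0) //.
  by have /andP[] := @trunc_le (fun y => kappa y / mu y) n x (kmu0 x).
- rewrite mul1r fctE /GRing.scale /= /GRing.scale /= lerD //.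
    by have /andP[] := @trunc_le (fun=> 1) n x ler01.
  rewrite -mulrA ler_wpM2l ?(ltW l0) //.
  by have /andP[] := @trunc_le (fun y => kappa y / mu y) n x (kmu0 x).
Qed.

Lemma resolvent_cutoff_bounds lam n x : 0 < lam -> 0 <= yn lam n x <= 1.
Proof.
move=> l0; have [ly y0 y1] := cutoff_data n l0.
by rewrite /yn res_ge0 //= res_le.
Qed.

Lemma resolvent_cutoff_lap lam n x : 0 < lam ->
  yn lam n x + lam * lap G (yn lam n) x = (one n + lam *: kn n) x.
Proof.
move=> l0; have [ly y0 y1] := cutoff_data n l0.
exact: (res_lap l0 ly ler01).
Qed.

Lemma resolvent_cutoff_operator lam n : 0 < lam -> form_operator G (yn lam n)
  (lam^-1 *: ((one n + lam *: kn n) - yn lam n)).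
Proof. by move=> l0; have [ly _ _] := cutoff_data n l0; exact: res_op. Qed.

(* [a_N y - euler_N <= a_N - 1] with [a_j = (1 - s / lam)^-j]: both sides solve
   implicit Euler schemes whose data are ordered. *)
Lemma euler_lower_bound lam s n N x : 0 < lam -> 0 < s -> N%:R * s <= lam / 2 ->
  1 - 2 * (1 - yn lam n x) <= euler s (kn n) (yn lam n) N x.
Proof.
move=> l0 s0 Ns; pose y := yn lam n; rewrite -/y.
have yL := resolvent_cutoff_operator n l0; rewrite -/y in yL.
have [ly lL] := form_operator_l2 yL.
have [->|N0] := eqVneq N 0%N.
  by rewrite /=; have /andP[] := resolvent_cutoff_bounds n x l0; rewrite -/y; lra.
pose r := 1 - s / lam.
have sl : s / lam <= 2^-1.
  rewrite ler_pdivrMr //; apply: le_trans (_ : N%:R * s <= _); last by lra.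
  by rewrite ler_peMl ?(ltW s0) // ler1n lt0n.
have r0 : 0 < r by rewrite /r; lra.
pose a j := r^-1 ^+ j.
have a1 j : 1 <= a j.
  apply: exprn_ege1; rewrite invf_ge1 // /r; have := divr_gt0 s0 l0; lra.
have aS j : a j.+1 * r = a j by rewrite /a exprSr mulfVK // lt0r_neq0.
have key j z : a j * y z - euler s (kn n) y j z <= a j - 1.
  elim: j z => [|j IH] z.
    by rewrite /a expr0 mul1r /= !subrr.
  pose g := lam^-1 *: ((one n + lam *: kn n) - y).
  have le_ := euler_l2 j s0 (lkn n) ly.
  have lb : l2 (euler s (kn n) y j + s *: kn n) by apply: l2D => //; exact: l2Z.
  have lyg : l2 (y + s *: g) by apply: l2D => //; exact: l2Z.
  have -> : a j.+1 * y z - euler s (kn n) y j.+1 z =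
      res s (a j.+1 *: (y + s *: g) - (euler s (kn n) y j + s *: kn n)) z.
    rewrite resB //; last exact: l2Z.
    have := res_lin (a j.+1 - 1) s0 lyg lyg.
    rewrite scalerBl scale1r subrK => ->.
    by rewrite (res_uniq s0 yL) scalerBl scale1r subrK.
  apply: res_le => // [||q].
  - by apply: l2B => //; exact: l2Z.
  - by rewrite subr_ge0.
  have := IH q; rewrite !fctE /g !fctE /GRing.scale /= /GRing.scale /=.
  have /andP[u0 u1] := @trunc_le (fun=> 1) n q ler01.
  have /andP[k0 k1] := @trunc_le (fun y => kappa y / mu y) n q (kmu0 q).
  rewrite -/(one n) -/(kn n) in u0 u1 k0 k1.
  set A := a j.+1; set Y := y q; set Z := euler _ _ _ _ q.
  set O := one n q in u0 u1 *; set K := kn n q in k0 k1 *.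
  set M := kappa q / mu q in k1 *.
  have A1 : 1 <= A by exact: a1.
  have -> : a j = A * (1 - s / lam) by rewrite -aS.
  have -> : A * (Y + s * (lam^-1 * (O + lam * K - Y))) - (Z + s * K) =
      (A * (1 - s / lam) * Y - Z) + A * (s / lam) * O + (A - 1) * s * K.
    by field; exact: lt0r_neq0.
  have -> : (A - 1) * (1 + s * kappa q / mu q) = (A * (1 - s / lam) - 1) +
      A * (s / lam) * 1 + (A - 1) * s * M.
    by rewrite -(mulrA s) -/M; ring.
  move=> h; apply: lerD; first apply: lerD => //.
    rewrite ler_wpM2l // mulr_ge0 ?divr_ge0 ?(ltW s0) ?(ltW l0) //; lra.
  by rewrite ler_wpM2l // mulr_ge0 ?subr_ge0 // ltW.
(* Bernoulli's inequality together with the horizon [N s <= lam / 2]; this is what fixes the time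
   [lam / 2]. *)
have aN : a N <= 2.
  have rN : 2^-1 <= r ^+ N.
    apply: le_trans (_ : 1 - N%:R * (s / lam) <= _).
      have : N%:R * (s / lam) <= 2^-1.
        by rewrite mulrA ler_pdivrMr //; move: Ns; lra.
      lra.
    have : 1 - N%:R * (s / lam) <= r ^+ N.
      elim: (N) => [|j IH]; first by rewrite mul0r subr0 expr0.
      rewrite exprSr.
      have p : 0 <= s / lam by rewrite divr_ge0 ?ltW.
      have p2 : 0 <= j%:R * (s / lam) by rewrite mulr_ge0.
      have := ler_wpM2r (ltW r0) IH; rewrite -natr1 /r; nra.
    by [].
  by rewrite /a exprVn -[leRHS]invrK lef_pV2 ?posrE ?exprn_gt0.
have := key N x; have := a1 N; have /andP[y0 y1] := resolvent_cutoff_bounds n x l0.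
by rewrite -/y in y0 y1; nra.
Qed.

End Incompleteness.

(** * A barrier from incompleteness *)

Section IncompletenessLimit.
Variables (R : realType) (X : countType) (G : graph R X).
Local Notation w := (weight G).
Local Notation kappa := (killing G).
Local Notation mu := (vmeas G).
Local Notation l2 := (l2 G).
Local Notation nm := (l2_norm G).
Local Notation res := (resolvent G).
Local Notation leb := (@lebesgue_measure R).
Implicit Types (f g k u v : X -> R) (s t : R).

Let one n : X -> R := fin_trunc (fun=> 1) n.
Let kn n : X -> R := fin_trunc (fun y => kappa y / mu y) n.
Let yn lam n := res lam (one n + lam *: kn n).

Let fone n : fin_supp (one n). Proof. exact: fin_trunc_fin_supp. Qed.
Let fkn n : fin_supp (kn n). Proof. exact: fin_trunc_fin_supp. Qed.
Let kmu0 y : 0 <= kappa y / mu y.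
Proof. by rewrite divr_ge0 ?killing_ge0 // ltW // vmeas_gt0. Qed.

(** * Total mass of the semigroup at time [lam / 2] *)

Section Total.
Variables (P : R -> (X -> R) -> (X -> R)) (hP : is_heat_semigroup G P).

Lemma heat_le t f g x : 0 <= t -> fin_supp f -> fin_supp g ->
  (forall y, f y <= g y) -> P t f x <= P t g x.
Proof.
move=> t0 ff fg fg_; have := @heat_ge0 _ _ _ _ hP t (g - f) x t0 (fin_suppB fg ff).
rewrite (heatB hP) //; try exact: l2_fin_supp.
rewrite fctE subr_ge0; apply => y; by rewrite fctE subr_ge0.
Qed.

Variables (lam : R) (l0 : 0 < lam) (x : X).
Let t := lam / 2.
Let t0 : 0 < t. Proof. by rewrite divr_gt0. Qed.
Let a n := P t (one n) x.
Let b n := \int[leb]_(s in `[0, t]) P s (kn n) x.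

Let aE_nd : {homo (fun n => (a n)%:E) : n m / (n <= m)%N >-> (n <= m)%E}.
Proof.
move=> n m nm_; rewrite lee_fin; apply: heat_le (ltW t0) (fone n) (fone m) _ => y.
by apply: trunc_mono.
Qed.

Let P_int n : leb.-integrable `[0, t] (EFin \o (fun s => P s (kn n) x)).
Proof.
have lk := l2_fin_supp G (fkn n).
exact: ucont_integrable (heat_ucont hP t x lk).
Qed.

Let bE n : ((b n)%:E = \int[leb]_(s in `[0%R, t]) (P s (kn n) x)%:E)%E.
Proof. by rewrite /b /Rintegral fineK //; exact: integrable_fin_num (P_int n). Qed.

Let kn_mono n m y : (n <= m)%N -> kn n y <= kn m y.
Proof. by move=> nm_; apply: trunc_mono. Qed.

Let kn_ge0 n y : 0 <= kn n y.
Proof. by have /andP[] := @trunc_le _ _ (fun y => kappa y / mu y) n y (kmu0 y). Qed.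

Let bE_nd : {homo (fun n => (b n)%:E) : n m / (n <= m)%N >-> (n <= m)%E}.
Proof.
move=> n m nm_; rewrite lee_fin.
apply: le_Rintegral (P_int n) (P_int m) _ => // s.
rewrite /= in_itv /= => /andP[s0 _]; apply: heat_le s0 (fkn n) (fkn m) _ => y.
exact: kn_mono.
Qed.

Let total_le1 n : a n + b n <= 1.
Proof.
have h := euler_cvg hP (x := x) t0 (approximable_fin_supp G (fkn n))
  (approximable_fin_supp G (fone n)).
apply: (ler_cvg h (cvg_cst (1 : R))); apply: nearW => N.
by apply: euler_le1; rewrite divr_gt0.
Qed.

Let total_ge n : 1 - 2 * (1 - yn lam n x) <= P t (yn lam n) x + b n.
Proof.
have h := euler_cvg hP (x := x) t0 (approximable_fin_supp G (fkn n))
  (approximable_operator (resolvent_cutoff_operator G n l0)).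
apply: (ler_cvg (cvg_cst _) h); apply: nearW => N.
apply: euler_lower_bound => //; first by rewrite divr_gt0.
by rewrite mulrC divfK // pnatr_eq0.
Qed.

(** The function [yn lam n] is the [l2] limit of finitely supported functions with values in
    [[0, 1]], each of which lies below a truncation of [1]. *)
Let resolvent_cutoff_le n : ((P t (yn lam n) x)%:E <= limn (fun m => (a m)%:E))%E.
Proof.
have [u [ua ub]] : exists u : nat -> X -> R, form_approx G u (yn lam n) /\
    forall m y, 0 <= u m y <= 1.
  have [ly y0 y1] := cutoff_data G n l0.
  have [v [h _ _ hc]] := resolvent_exists l0 ly.
  have [u ua ub] := hc 1 ler01 y1 y0.
  by exists u; rewrite /yn (res_eq l0 ly h).
have [ly fu uy _] := ua.
have P_cvg : P t (u m) x @[m --> \oo] --> P t (yn lam n) x.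
  have tt := ltW t0; have [C hC] := heat_bounded hP tt.
  have lu m : l2 (u m) by exact: l2_fin_supp.
  apply: (@l2_cvg_pointwise _ _ G nat \oo _ (fun m => P t (u m))
    (P t (yn lam n)) x) => [m||]; try exact: (heat_l2 hP).
  apply: (@squeeze0 _ _ _ _ _ (fun m => C * nm (u m - yn lam n))).
    rewrite -[X in _ --> X](mulr0 C); apply: cvgM => //; exact: cvg_cst.
  apply: nearW => m; rewrite ger0_norm ?nm_ge0 // -(heatB hP) //.
  by apply: hC; exact: l2B.
have cv := ereal_nondecreasing_is_cvgn aE_nd.
have le m : ((P t (u m) x)%:E <= limn (fun m => (a m)%:E))%E.
  have /fin_suppP[M hM] := fu m; apply: lime_ge => //.
  exists M => // k Mk; rewrite /= lee_fin; apply: heat_le => //; first exact: ltW.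
  move=> y; rewrite /one /fin_trunc; case: ltnP => ky.
    by have /andP[] := ub m y.
  by rewrite hM // (leq_trans Mk).
move: le; case: (limn _) => [r| |] le; last 1 first.
- by have := le 0%N.
- rewrite lee_fin; apply: (ler_cvg P_cvg (cvg_cst r)); apply: nearW => m.
  by have := le m; rewrite lee_fin.
- by rewrite leey.
Qed.

(** The total is at most [1] by [total_le1] and, for every [n], at least [1 - 2 * (1 - yn lam n x)].
    As it does not depend on [n], convergence along one filter is enough. *)
Lemma total_eq1 (U : set_system nat) {UU : ProperFilter U} :
  yn lam n x @[n --> U] --> (1 : R) ->
  (heat_ext P t (fun=> 1%R) x + \int[leb]_(s in `[0%R, t])
     heat_ext P s (fun y => kappa y / mu y)%R x = 1)%E.
Proof.
move=> y1; pose A := limn (fun n => (a n)%:E); pose B := limn (fun n => (b n)%:E).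
have -> : (\int[leb]_(s in `[0%R, t])
    heat_ext P s (fun y => kappa y / mu y)%R x = B)%E.
  rewrite /heat_ext (monotone_convergence leb) //.
  - have -> : (fun n => \int[leb]_(s in `[0%R, t]) (P s (kn n) x)%:E)%E =
              (fun n => (b n)%:E) by apply/funext => n; rewrite bE.
    by [].
  - by move=> n; have /integrableP[] := P_int n.
  - move=> n s; rewrite /= in_itv /= => /andP[s0 _]; rewrite lee_fin.
    by apply: (heat_ge0 hP); [|exact: fkn|exact: kn_ge0].
  - move=> s; rewrite /= in_itv /= => /andP[s0 _] n m nm_; rewrite lee_fin.
    by apply: heat_le s0 (fkn n) (fkn m) _ => y; exact: kn_mono.
rewrite -[heat_ext _ _ _ _]/A.
have cA := ereal_nondecreasing_is_cvgn aE_nd.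
have cB := ereal_nondecreasing_is_cvgn bE_nd.
have a0 n : (0 <= (a n)%:E)%E.
  rewrite lee_fin; apply: (heat_ge0 hP) => //; first exact: ltW.
  by move=> y; rewrite /one /fin_trunc; case: ifP.
have b0 n : (0 <= (b n)%:E)%E.
  rewrite lee_fin; apply: Rintegral_ge0 => // s.
  by rewrite /= in_itv /= => /andP[s0 _]; apply: (heat_ge0 hP) => //; exact: kn_ge0.
have A0 : (0 <= A)%E by apply: lime_ge => //; exact: nearW.
have B0 : (0 <= B)%E by apply: lime_ge => //; exact: nearW.
have AB : (A + B <= 1)%E.
  have h : ((a n)%:E + (b n)%:E)%E @[n --> \oo] --> (A + B)%E.
    by apply: cvgeD => //; exact: ge0_adde_def.
  rewrite -(cvg_lim _ h) //; apply: lime_le; first by apply/cvg_ex; exists (A + B)%E.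
  by apply: nearW => n; rewrite -EFinD lee_fin total_le1.
have ABf : (A + B)%E \is a fin_num.
  by rewrite ge0_fin_numE ?adde_ge0 // (le_lt_trans AB) // ltry.
apply/eqP; rewrite eq_le AB /= -(fineK ABf) lee_fin.
have h : 1 - 2 * (1 - yn lam n x) @[n --> U] --> 1 - 2 * (1 - 1 : R).
  apply: cvgB; first exact: cvg_cst.
  by apply: cvgM; [exact: cvg_cst|apply: cvgB => //; exact: cvg_cst].
rewrite subrr mulr0 subr0 in h.
apply: (ler_cvg h (cvg_cst _)); apply: nearW => n.
rewrite -lee_fin fineK //; apply: le_trans (_ : (P t (yn lam n) x)%:E + (b n)%:E <= _)%E.
  by rewrite -EFinD lee_fin total_ge.
apply: leeD; [exact: resolvent_cutoff_le|apply: lime_ge => //].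
by exists n => // m /= nm_; exact: bE_nd.
Qed.

End Total.

Lemma incomplete_eigenfunction : ~ stochastically_complete_at_infinity G ->
  forall K : R, 0 < K -> exists W : X -> R, [/\ forall x, 0 <= W x <= 1,
    exists x, 0 < W x & forall x, lap G W x = - (K * W x)].
Proof.
move=> hG K K0; apply: contrapT => nW; apply: hG => P hP.
(* With this choice [W + lam * lap W = 0] is the required equation. *)
pose lam := K^-1; have l0 : 0 < lam by rewrite invr_gt0.
exists (lam / 2); split; first by rewrite divr_gt0.
have [U UU sU] := ultra_nat R.
have PU : ProperFilter U by exact: ultra_proper.
have yb n x : `|yn lam n x| <= 1.
  by have /andP[y0 y1] := resolvent_cutoff_bounds G n x l0; rewrite ger0_norm.
have lim x : exists l : R, yn lam n x @[n --> U] --> l.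
  by apply: (ultra_bounded_cvg (C := 1)) => n.
have [y hy] := choice lim.
have yb01 x : 0 <= y x <= 1.
  apply/andP; split.
    apply: (ler_cvg (cvg_cst (0 : R)) (hy x)); apply: nearW => n.
    by have /andP[] := resolvent_cutoff_bounds G n x l0.
  apply: (ler_cvg (hy x) (cvg_cst (1 : R))); apply: nearW => n.
  by have /andP[] := resolvent_cutoff_bounds G n x l0.
have near_one z : U [set n | (pickle (z : X) < n)%N].
  by apply: sU; exists (pickle z).+1.
have lapy x : y x + lam * lap G y x = 1 + lam * (kappa x / mu x).
  have [ys hs] : abs_summable (fun z => w x z * (y x - y z)) /\
      rsum (fun z => w x z * (yn lam n x - yn lam n z)) @[n --> U] -->
      rsum (fun z => w x z * (y x - y z)).
    apply: (@dominated_rsum _ _ nat U _ _ _ (fun z => 2 * w x z)).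
    - by move=> z; apply: cvgM; [exact: cvg_cst|exact: cvgB].
    - exact/abs_summableZ/weight_sum.
    - apply: nearW => n z; rewrite normrM ger0_norm ?weight_ge0 // mulrC.
      rewrite ler_wpM2r ?weight_ge0 //; apply: le_trans (ler_normB _ _) _.
      have := yb n x; have := yb n z; lra.
  have h : yn lam n x + lam * lap G (yn lam n) x @[n --> U] -->
      y x + lam * lap G y x.
    apply: cvgD => //; apply: cvgM; first exact: cvg_cst.
    rewrite /lap; apply: cvgD; apply: cvgM => //; exact: cvg_cst.
  apply: (cvg_unique (@Rhausdorff R) h).
  apply: cvg_near_cst; apply: filterS (near_one x) => n xn.
  rewrite (resolvent_cutoff_lap G n x l0) fctE /GRing.scale /= /GRing.scale /=.
  by rewrite /fin_trunc xn.
(* Otherwise [1 - y] is an eigenfunction of the excluded kind, because [1] and [y] solve the same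
   resolvent equation. *)
have W0 x : y x = 1.
  apply: contrapT => yx; apply: nW; exists (fun z => 1 - y z); split.
  - by move=> z; have := yb01 z; lra.
  - by exists x; have /andP[_] := yb01 x; rewrite le_eqVlt subr_gt0 => /orP[/eqP|].
  move=> z; have ly := lapy z.
  have -> : lap G (fun z => 1 - y z) z = kappa z / mu z - lap G y z.
    rewrite /lap.
    have -> : (fun q => w z q * (1 - y z - (1 - y q))) =
              (fun q => - (w z q * (y z - y q))).
      by apply/funext => q; ring.
    rewrite rsumN; first by ring.
    apply: (@bounded_diff_sum _ _ G y 1) => q.
    by have /andP[q0 q1] := yb01 q; rewrite ger0_norm.
  have -> : lap G y z = (1 + lam * (kappa z / mu z) - y z) / lam.
    by rewrite -ly; field; exact: lt0r_neq0.
  by rewrite /lam; field; rewrite !lt0r_neq0 ?vmeas_gt0.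
move=> x; apply: (total_eq1 hP l0 (U := U)).
by have := hy x; rewrite W0.
Qed.

Lemma incomplete_barrier : ~ stochastically_complete_at_infinity G ->
  forall K : R, 0 < K -> exists g : X -> R, [/\ forall x, 0 <= g x <= 1,
    exists x, 0 < g x & forall x, 0 < g x -> lap G g x <= - K].
Proof.
move=> hG K K0; have [W [W01 [x0 Wx0] lapW]] := incomplete_eigenfunction hG K0.
pose s := sup (range W).
have hs : has_sup (range W).
  by split; [exists (W x0), x0|exists 1 => _ [x _ <-]; have /andP[] := W01 x].
have Ws x : W x <= s by apply: sup_ubound; [exact: hs.2|exists x].
have s0 : 0 < s by exact: lt_le_trans (Ws x0).
(* Positivity of [g] means [W > s / 2], which turns [- K W] into [- K] after scaling by [2 / s].
   Cutting at [0] only raises the neighbours, and subtracting [1] only lowers the killing term, so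
   the Laplacian does not increase where [g > 0]. *)
pose g x := Num.max (2 * W x / s - 1) 0.
have g1 x : 0 <= g x <= 1.
  rewrite /g le_max lexx orbT ge_max ler01 andbT /=.
  rewrite lerBlDr ler_pdivrMr //; have := Ws x; lra.
exists g; split => //.
- have s2 : 0 < s / 2 by rewrite divr_gt0.
  have [_ [x _ <-]] := sup_adherent s2 hs; rewrite -/s => h.
  exists x; rewrite lt_max; apply/orP; left.
  rewrite subr_gt0 ltr_pdivlMr //; lra.
move=> x; rewrite lt_max ltxx orbF => gx.
have gxE : g x = 2 * W x / s - 1 by rewrite /g max_l // ltW.
have Wb y : `|W y| <= 1 by have /andP[h1 h2] := W01 y; rewrite ger0_norm.
have gb y : `|g y| <= 1 by have /andP[h1 h2] := g1 y; rewrite ger0_norm.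
have m0 := vmeas_gt0 G x.
have h1 : rsum (fun y => w x y * (g x - g y)) <=
          2 / s * rsum (fun y => w x y * (W x - W y)).
  rewrite -rsumZ; last exact: bounded_diff_sum Wb.
  apply: ler_rsum => [||y].
  - exact: bounded_diff_sum gb.
  - by apply: abs_summableZ; exact: bounded_diff_sum Wb.
  rewrite mulrCA ler_wpM2l ?weight_ge0 // gxE.
  have : 2 * W y / s - 1 <= g y by rewrite /g le_max lexx.
  have -> : 2 / s * (W x - W y) = 2 * W x / s - 2 * W y / s by ring.
  lra.
have h2 : lap G g x <= 2 / s * lap G W x.
  rewrite /lap mulrDr; apply: lerD.
    by rewrite mulrCA ler_wpM2l // invr_ge0 ltW.
  rewrite mulrCA ler_wpM2l ?divr_ge0 ?killing_ge0 ?(ltW m0) // gxE.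
  by rewrite mulrAC; lra.
apply: le_trans h2 _; rewrite lapW mulrN lerN2.
rewrite subr_gt0 ltr_pdivlMr // in gx.
have -> : 2 / s * (K * W x) = K * (2 * W x / s) by ring.
by rewrite ler_peMr ?(ltW K0) // ler_pdivlMr // ltW.
Qed.

End IncompletenessLimit.

(** * The explicit scheme *)

Section BoundedLaplacian.
Variables (R : realType) (X : countType) (G : graph R X).
Local Notation w := (weight G).
Local Notation kappa := (killing G).
Local Notation mu := (vmeas G).
Implicit Types (f g : X -> R) (x y : X).

Definition bounded_by (C : R) f := forall x, `|f x| <= C.

Definition deg x : R := (rsum (w x) + kappa x) / mu x.

Lemma deg_ge0 x : 0 <= deg x.
Proof.
rewrite divr_ge0 ?addr_ge0 ?killing_ge0 ?(ltW (vmeas_gt0 _ _)) //.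
by apply: rsum_ge0; [exact: weight_sum|exact: weight_ge0].
Qed.

Lemma lapE f C x : bounded_by C f ->
  lap G f x = deg x * f x - (mu x)^-1 * rsum (fun y => w x y * f y).
Proof.
move=> fC; rewrite /lap.
have -> : (fun y => w x y * (f x - f y)) = (fun y => f x * w x y - w x y * f y).
  by apply/funext => y; ring.
have ws := weight_sum G x.
rewrite (rsumB (abs_summableZ (f x) ws) (bounded_weight_sum G x fC)).
rewrite (rsumZ (f x) ws).
by rewrite /deg; field; rewrite lt0r_neq0 // vmeas_gt0.
Qed.

Lemma lap_lin f g (c C D : R) x : bounded_by C f -> bounded_by D g ->
  lap G (fun y => f y + c * g y) x = lap G f x + c * lap G g x.
Proof.
move=> fC gD.
have fg : bounded_by (C + `|c| * D) (fun y => f y + c * g y).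
  move=> y; apply: le_trans (ler_normD _ _) _; apply: lerD => //.
  by rewrite normrM ler_wpM2l.
rewrite (lapE x fg) (lapE x fC) (lapE x gD).
have -> : (fun y => w x y * (f y + c * g y)) =
          (fun y => w x y * f y + c * (w x y * g y)).
  by apply/funext => y; ring.
rewrite rsumD ?rsumZ; first by ring.
- exact: bounded_weight_sum gD.
- exact: bounded_weight_sum fC.
- apply: abs_summableZ; exact: bounded_weight_sum gD.
Qed.

Lemma rsum_weight_le f g C D x : bounded_by C f -> bounded_by D g ->
  (forall y, f y <= g y) ->
  rsum (fun y => w x y * f y) <= rsum (fun y => w x y * g y).
Proof.
move=> fC gD fg; apply: ler_rsum => [||y].
- exact: bounded_weight_sum fC.
- exact: bounded_weight_sum gD.
- by rewrite ler_wpM2l ?weight_ge0.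
Qed.

Lemma lap_cst (c : R) x : lap G (fun=> c) x = kappa x / mu x * c.
Proof.
rewrite /lap (_ : (fun y => w x y * (c - c)) = (fun=> 0)) ?rsum0 ?mulr0 ?add0r //.
by apply/funext => y; rewrite subrr mulr0.
Qed.

Lemma lap_bound f C x : bounded_by C f -> `|lap G f x| <= 2 * deg x * C.
Proof.
move=> fC; have C0 : 0 <= C by exact: le_trans (fC x).
have m0 := vmeas_gt0 G x; have ws := weight_sum G x.
have h1 : `|rsum (fun y => w x y * f y)| <= C * rsum (w x).
  rewrite -rsumZ //; apply: (ler_rsum_bound _ _).2.
    exact: abs_summableZ.
  by move=> y; rewrite normrM ger0_norm ?weight_ge0 // mulrC ler_wpM2r ?weight_ge0.
rewrite (lapE x fC); apply: le_trans (ler_normB _ _) _.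
rewrite (normrM (deg x)) (normrM (mu x)^-1) (ger0_norm (deg_ge0 x)).
rewrite [`|(mu x)^-1|]gtr0_norm ?invr_gt0 //.
have h2 : (mu x)^-1 * `|rsum (fun y => w x y * f y)| <= deg x * C.
  rewrite /deg mulrAC mulrC ler_pM2r ?invr_gt0 //; apply: le_trans h1 _.
  by rewrite mulrC ler_wpM2r // lerDl killing_ge0.
have h3 : deg x * `|f x| <= deg x * C by rewrite ler_wpM2l ?deg_ge0.
lra.
Qed.

(** The minimum must be nonpositive for the killing term to have the right sign. *)
Lemma lap_min f C x : bounded_by C f -> (forall y, f x <= f y) -> f x <= 0 ->
  lap G f x <= 0.
Proof.
move=> fC fx fx0; rewrite /lap; have m0 := ltW (vmeas_gt0 G x).
have h1 : rsum (fun y => w x y * (f x - f y)) <= 0.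
  rewrite -[leRHS](rsum0 R X); apply: ler_rsum => [||y].
  - exact: bounded_diff_sum fC.
  - exact: abs_summable0.
  - by rewrite mulr_ge0_le0 ?weight_ge0 // subr_le0.
have h2 : (mu x)^-1 * rsum (fun y => w x y * (f x - f y)) <= 0.
  by rewrite mulr_ge0_le0 // invr_ge0.
have h3 : kappa x / mu x * f x <= 0.
  by rewrite mulr_ge0_le0 // divr_ge0 ?killing_ge0.
lra.
Qed.

End BoundedLaplacian.

Section ExplicitScheme.
Variables (R : realType) (X : countType) (G : graph R X).
Local Notation w := (weight G).
Local Notation kappa := (killing G).
Local Notation mu := (vmeas G).
Variables (psi : R -> R) (Lip h : R) (n : nat) (u0 : X -> R) (A : R).
Hypothesis psi_mono : forall s t, s <= t -> psi s <= psi t.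
Hypothesis psi_lip : forall s t, s <= t -> psi t - psi s <= Lip * (t - s).
Hypothesis psi0 : psi 0 = 0.
Hypothesis h0 : 0 < h.
Hypothesis h_deg : forall x, (pickle x < n)%N -> h * Lip * deg G x <= 1.
Hypothesis A0 : 0 <= A.
Hypothesis u0A : bounded_by A u0.

Definition gpme_step (a : R) (u : X -> R) : X -> R := fun x =>
  if (pickle x < n)%N then u x - h * lap G (psi \o u) x else a.

Fixpoint scheme (a : R) (k : nat) : X -> R :=
  if k is j.+1 then gpme_step a (scheme a j)
  else fun x => if (pickle x < n)%N then u0 x else a.

Lemma psi_bounded (C : R) u : bounded_by C u ->
  bounded_by (Num.max (psi C) (- psi (- C))) (psi \o u : X -> R).
Proof.
move=> uC x /=; have := uC x; rewrite ler_norml => /andP[u1 u2].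
rewrite ler_norml lerNl !le_max; apply/andP; split; apply/orP.
  by right; rewrite lerN2 psi_mono.
by left; rewrite psi_mono.
Qed.

(** By the stability condition [h_deg], what an increase of [u x] makes the vertex lose in one step
    never exceeds the increase itself; the neighbours contribute monotonically. *)
Lemma gpme_step_mono (a b : R) u v (C D : R) : bounded_by C u -> bounded_by D v ->
  a <= b -> (forall x, u x <= v x) -> forall x, gpme_step a u x <= gpme_step b v x.
Proof.
move=> uC vD ab uv x; rewrite /gpme_step; case: ifPn => // xn.
have pu := psi_bounded uC; have pv := psi_bounded vD.
have hw := rsum_weight_le G x pu pv (fun y => psi_mono (uv y)).
rewrite (lapE G x pu) (lapE G x pv) /=.
have hm : h * ((mu x)^-1 * rsum (fun y => w x y * (psi \o u) y)) <=
          h * ((mu x)^-1 * rsum (fun y => w x y * (psi \o v) y)).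
  by rewrite ler_pM2l // ler_pM2l // invr_gt0 vmeas_gt0.
have hl : h * (deg G x * (psi (v x) - psi (u x))) <= v x - u x.
  apply: (@le_trans _ _ (h * (deg G x * (Lip * (v x - u x))))).
    by rewrite ler_pM2l // ler_wpM2l ?deg_ge0 // psi_lip.
  rewrite [leLHS](_ : _ = (h * Lip * deg G x) * (v x - u x)); last by ring.
  by rewrite ler_piMl ?h_deg // subr_ge0.
move: hm hl; rewrite !mulrBr; lra.
Qed.

(** Comparison with the constants [A] and [- A], which killing can only push towards [0] as
    [psi 0 = 0]. *)
Lemma gpme_step_bounded a u : `|a| <= A -> bounded_by A u ->
  bounded_by A (gpme_step a u).
Proof.
rewrite ler_norml => /andP[a1 a2] uA x; rewrite ler_norml.
have cA : bounded_by A (fun _ : X => A) by move=> y; rewrite ger0_norm.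
have cNA : bounded_by A (fun _ : X => - A) by move=> y; rewrite normrN ger0_norm.
have kmu : 0 <= kappa x / mu x.
  by rewrite divr_ge0 ?killing_ge0 // ltW // vmeas_gt0.
apply/andP; split.
  have um y : - A <= u y by have := uA y; rewrite ler_norml => /andP[].
  apply: le_trans (gpme_step_mono cNA uA a1 um x).
  rewrite /gpme_step; case: ifP => // _.
  rewrite [lap _ _ _](lap_cst G (psi (- A)) x) lerDl oppr_ge0.
  rewrite mulr_ge0_le0 ?(ltW h0) // mulr_ge0_le0 // -psi0 psi_mono //.
  by rewrite oppr_le0.
have um y : u y <= A by have := uA y; rewrite ler_norml => /andP[].
apply: le_trans (gpme_step_mono uA cA a2 um x) _.
rewrite /gpme_step; case: ifP => // _.
rewrite [lap _ _ _](lap_cst G (psi A) x) gerDl oppr_le0.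
by rewrite mulr_ge0 ?(ltW h0) // mulr_ge0 // -psi0 psi_mono.
Qed.

Lemma scheme_bounded a k : `|a| <= A -> bounded_by A (scheme a k).
Proof.
move=> aA; elim: k => [|k IH] /=; last exact: gpme_step_bounded.
by move=> x; case: ifP => _ //; exact: u0A.
Qed.

Lemma scheme_mono a b k x : `|a| <= A -> `|b| <= A -> a <= b ->
  scheme a k x <= scheme b k x.
Proof.
move=> aA bA ab; elim: k x => [|k IH] x /=; first by case: ifP.
exact: gpme_step_mono (scheme_bounded k aA) (scheme_bounded k bA) ab IH x.
Qed.

Lemma scheme_out a k x : ~~ (pickle x < n)%N -> scheme a k x = a.
Proof. by case: k => [|k] /negbTE /= xn; rewrite ?/gpme_step xn. Qed.

Definition gap (a b : R) (k : nat) (x : X) : R :=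
  h * \sum_(j < k) (psi (scheme a j x) - psi (scheme b j x)).

Let Phi := Num.max (psi A) (- psi (- A)).

Lemma gap_bounded a b k : `|a| <= A -> `|b| <= A ->
  bounded_by (h * (k%:R * (Phi + Phi))) (gap a b k).
Proof.
move=> aA bA x; rewrite /gap normrM gtr0_norm // ler_pM2l //.
apply: le_trans (ler_norm_sum _ _ _) _.
have -> : k%:R * (Phi + Phi) = \sum_(j < k) (Phi + Phi).
  by rewrite sumr_const card_ord mulr_natl.
apply: ler_sum => j _; apply: le_trans (ler_normB _ _) _; apply: lerD.
  exact: (psi_bounded (scheme_bounded j aA) x).
exact: (psi_bounded (scheme_bounded j bA) x).
Qed.

(** Each step subtracts [h] times a Laplacian, so the sum telescopes; both schemes start from [u0]
    at the inner vertices. *)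
Lemma lap_gap a b k x : `|a| <= A -> `|b| <= A -> (pickle x < n)%N ->
  lap G (gap a b k) x = - (scheme a k x - scheme b k x).
Proof.
move=> aA bA xn; elim: k => [|k IH].
  have -> : gap a b 0 = (fun=> 0).
    by apply/funext => y; rewrite /gap big_ord0 mulr0.
  by rewrite lap_cst mulr0 /= xn subrr oppr0.
have pa := psi_bounded (scheme_bounded k aA).
have pb := psi_bounded (scheme_bounded k bA).
have pab : bounded_by (Phi + Phi)
    (fun y => psi (scheme a k y) - psi (scheme b k y)).
  by move=> y; apply: le_trans (ler_normB _ _) _; apply: lerD; [exact: pa|exact: pb].
have -> : gap a b k.+1 = (fun y => gap a b k y +
    h * (psi (scheme a k y) - psi (scheme b k y))).
  by apply/funext => y; rewrite /gap big_ord_recr /= mulrDr.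
rewrite (lap_lin G h x (gap_bounded k aA bA) pab) IH.
have -> : (fun y => psi (scheme a k y) - psi (scheme b k y)) =
  (fun y => (psi \o scheme a k) y + (-1) * (psi \o scheme b k) y).
  by apply/funext => y; rewrite /= mulN1r.
rewrite (lap_lin G (-1) x pa pb) /= /gpme_step xn; ring.
Qed.

Lemma pickle_argmin (f : X -> R) m : (exists x : X, (pickle x < m)%N) ->
  exists2 x, (pickle x < m)%N & forall y, (pickle y < m)%N -> f x <= f y.
Proof.
elim: m => [[]//|m IH [x xm]].
have [[z zm]|no] := pselect (exists x : X, (pickle x < m)%N).
  have [//|q qm hq] := IH; first by exists z.
  have [[p pm fp]|no] := pselect (exists2 p : X, pickle p = m & f p < f q).
    exists p; first by rewrite pm.
    move=> y; rewrite ltnS leq_eqVlt => /orP[/eqP ym|ym].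
      have -> : y = p by apply: (pcan_inj pickleK_inv); rewrite ym pm.
      exact: lexx.
    by apply: le_trans (ltW fp) (hq _ ym).
  exists q; first exact: ltnW.
  move=> y; rewrite ltnS leq_eqVlt => /orP[/eqP ym|]; last exact: hq.
  by rewrite leNgt; apply/negP => yq; apply: no; exists y.
exists x => // y ym.
have e z : (pickle (z : X) < m.+1)%N -> pickle z = m.
  rewrite ltnS leq_eqVlt => /orP[/eqP//|zm]; case: no; by exists z.
have -> : y = x by apply: (pcan_inj pickleK_inv); rewrite (e _ ym) (e _ xm).
exact: lexx.
Qed.

(* Maximum principle: [gap] is a supersolution of the same problem as
   [k h (psi a - psi b) g], and dominates it outside [pickle x < n]. *)
Lemma gap_lower_bound a b k (g : X -> R) (K : R) :
  `|a| <= A -> `|b| <= A -> b <= a ->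
  (forall x, 0 <= g x <= 1) -> (forall x, 0 < g x -> lap G g x <= - K) ->
  2 * A < k%:R * h * (psi a - psi b) * K ->
  forall x, k%:R * h * (psi a - psi b) * g x <= gap a b k x.
Proof.
move=> aA bA ba g01 gK lamK x.
set lam := k%:R * h * (psi a - psi b) in lamK *.
have lam0 : 0 <= lam.
  by rewrite !mulr_ge0 ?(ltW h0) // subr_ge0 psi_mono.
pose q y := gap a b k y + (- lam) * g y.
suff : 0 <= q x by rewrite /q mulNr subr_ge0.
have gap0 y : 0 <= gap a b k y.
  rewrite mulr_ge0 ?(ltW h0) // sumr_ge0 // => j _.
  by rewrite subr_ge0 psi_mono // scheme_mono.
have out y : ~~ (pickle y < n)%N -> 0 <= q y.
  move=> yn; rewrite /q /gap.
  have -> : \sum_(j < k) (psi (scheme a j y) - psi (scheme b j y)) =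
            k%:R * (psi a - psi b).
    rewrite (eq_bigr (fun=> psi a - psi b)) => [|j _]; last by rewrite !scheme_out.
    by rewrite sumr_const card_ord mulr_natl.
  have -> : h * (k%:R * (psi a - psi b)) = lam by rewrite /lam; ring.
  have /andP[_ g1] := g01 y; have := ler_wpM2l lam0 g1; lra.
rewrite leNgt; apply/negP => qx.
have xn : (pickle x < n)%N by apply: contraTT qx => /out; rewrite -leNgt.
have [z zn hz] := @pickle_argmin q n (ex_intro _ x xn).
have qz : q z < 0 by exact: le_lt_trans (hz x xn) qx.
have gz : 0 < g z.
  rewrite ltNge; apply/negP => gz; have /andP[g0 _] := g01 z.
  have g00 : g z = 0 by apply/eqP; rewrite eq_le gz g0.
  by move: qz; rewrite /q g00 mulr0 addr0 ltNge gap0.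
have gb : bounded_by 1 g by move=> y; have /andP[g0 g1] := g01 y; rewrite ger0_norm.
have qb : bounded_by (h * (k%:R * (Phi + Phi)) + `|- lam| * 1) q.
  move=> y; apply: le_trans (ler_normD _ _) _; apply: lerD.
    exact: gap_bounded.
  by rewrite normrM ler_wpM2l.
have hq : forall y, q z <= q y.
  move=> y; have [yn|yn] := boolP (pickle y < n)%N; first exact: hz.
  exact: le_trans (ltW qz) (out _ yn).
(* At this negative global minimum the Laplacian of [q] would be nonpositive, yet it is at least
   [lam * K - 2 * A], which is positive. *)
have := lap_min G qb hq (ltW qz).
rewrite /q (lap_lin G (- lam) z (gap_bounded k aA bA) gb) lap_gap //.
have := ler_wpM2l lam0 (gK z gz).
have := scheme_bounded k aA z; have := scheme_bounded k bA z.
rewrite !ler_norml => /andP[b1 b2] /andP[a1 a2].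
rewrite mulrN; lra.
Qed.

Lemma scheme_lip a k j x (C : R) :
  (forall i, bounded_by C (psi \o scheme a i : X -> R)) ->
  (pickle x < n)%N -> (j <= k)%N ->
  `|scheme a k x - scheme a j x| <= (k - j)%:R * (h * (2 * deg G x * C)).
Proof.
move=> aC xn; elim: k => [|k IH].
  by rewrite leqn0 => /eqP ->; rewrite subrr normr0 mul0r.
rewrite leq_eqVlt => /orP[/eqP <-|]; first by rewrite subrr normr0 subnn mul0r.
rewrite ltnS => jk; rewrite subSn // -natr1 mulrDl mul1r [leRHS]addrC.
have -> : scheme a k.+1 x - scheme a j x =
   (- (h * lap G (psi \o scheme a k) x)) + (scheme a k x - scheme a j x).
  by rewrite /= /gpme_step xn; ring.
apply: le_trans (ler_normD _ _) (lerD _ (IH jk)).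
by rewrite normrN normrM gtr0_norm // ler_pM2l //; exact: lap_bound.
Qed.

(** This is the discrete form of [strong_derivative]: a bound on the Laplacian along the grid times
    passes to the limit as a bound on increments. *)
Lemma scheme_increment a k j x (c e : R) : (pickle x < n)%N -> (j <= k)%N ->
  (forall i, (j <= i < k)%N -> `|lap G (psi \o scheme a i) x - c| <= e) ->
  `|scheme a k x - scheme a j x + (k - j)%:R * h * c| <= (k - j)%:R * h * e.
Proof.
move=> xn; elim: k => [|k IH].
  by rewrite leqn0 => /eqP -> _; rewrite subrr !mul0r addr0 normr0.
rewrite leq_eqVlt => /orP[/eqP <- _|].
  by rewrite subrr subnn !mul0r addr0 normr0.
rewrite ltnS => jk hc; rewrite subSn //.
have -> : scheme a k.+1 x - scheme a j x + (k - j).+1%:R * h * c =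
  (scheme a k x - scheme a j x + (k - j)%:R * h * c) -
    h * (lap G (psi \o scheme a k) x - c).
  by rewrite /= /gpme_step xn -natr1; ring.
apply: le_trans (ler_normB _ _) _.
have -> : (k - j).+1%:R * h * e = (k - j)%:R * h * e + h * e.
  by rewrite -natr1; ring.
apply: lerD.
  by apply: IH => // i /andP[ji ik]; apply: hc; rewrite ji ltnW.
by rewrite normrM gtr0_norm // ler_pM2l // hc // jk ltnSn.
Qed.

End ExplicitScheme.

(** * Yosida regularisation of the nonlinearity *)

Section Yosida.
Variables (R : realType) (phi : R -> R).
Hypothesis phi_nl : nonlinearity phi.

Lemma nl_mono s t : s <= t -> phi s <= phi t.
Proof.
have [_ h _ _] := phi_nl.
by rewrite le_eqVlt => /orP[/eqP ->|/h].
Qed.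

Lemma nl_continuous : continuous phi. Proof. by have [] := phi_nl. Qed.

Lemma nl0 : phi 0 = 0. Proof. by have [] := phi_nl. Qed.

Lemma nl_bounded (A s : R) : `|s| <= A -> `|phi s| <= Num.max (phi A) (- phi (- A)).
Proof.
rewrite ler_norml => /andP[s1 s2].
rewrite ler_norml lerNl !le_max; apply/andP; split; apply/orP.
  by right; rewrite lerN2 nl_mono.
by left; rewrite nl_mono.
Qed.

(** [J] is the resolvent of [phi], the inverse of [r + e * phi r]. Hence [phi \o J = (id - J) / e]
    is monotone and Lipschitz with constant [1 / e]. *)
Lemma yosida_exists (e : R) : 0 < e -> exists J : R -> R, forall s,
  `|J s| <= `|s| /\ J s + e * phi (J s) = s.
Proof.
move=> e0; suff h (s : R) : exists r : R, `|r| <= `|s| /\ r + e * phi r = s.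
  by have [J hJ] := choice h; exists J.
have ab : - `|s| <= `|s| by exact: le_trans (normr_ge0 s); rewrite ?oppr_le0.
have ct : {within `[- `|s|, `|s|], continuous (fun r => r + e * phi r)}.
  apply: continuous_subspaceT => r; apply: cvgD; first exact: cvg_id.
  by apply: cvgM; [exact: cvg_cst|exact: nl_continuous].
have p1 : 0 <= phi `|s| by rewrite -nl0 nl_mono.
have p2 : phi (- `|s|) <= 0 by rewrite -nl0 nl_mono // oppr_le0.
have [|r] := @IVT R (fun r => r + e * phi r) _ _ s ab ct.
  rewrite ge_min le_max; apply/andP; split; apply/orP; [left|right].
    have h1 : e * phi (- `|s|) <= 0 by rewrite mulr_ge0_le0 // ltW.
    by have := ler_norm (- s); rewrite normrN; lra.
  have h1 : 0 <= e * phi `|s| by rewrite mulr_ge0 // ltW.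
  by have := ler_norm s; lra.
by rewrite in_itv /= -ler_norml => h1 h2; exists r.
Qed.

Variables (e : R) (J : R -> R).
Hypothesis e0 : 0 < e.
Hypothesis JE : forall s, `|J s| <= `|s| /\ J s + e * phi (J s) = s.

Lemma yosida_mono s t : s <= t -> J s <= J t.
Proof.
move=> st; rewrite leNgt; apply/negP => ts.
have [_ hs] := JE s; have [_ ht] := JE t.
have := nl_mono (ltW ts); rewrite -(ler_pM2l e0); lra.
Qed.

Lemma yosida_psi_mono s t : s <= t -> phi (J s) <= phi (J t).
Proof. by move=> st; exact/nl_mono/yosida_mono. Qed.

Lemma yosida_psi_lip s t : s <= t ->
  phi (J t) - phi (J s) <= e^-1 * (t - s).
Proof.
move=> st; rewrite mulrC ler_pdivlMr //.
have [_ hs] := JE s; have [_ ht] := JE t; have := yosida_mono st; lra.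
Qed.

Lemma yosida_psi0 : phi (J 0) = 0.
Proof.
have [h _] := JE 0; rewrite normr0 normr_le0 in h.
by rewrite (eqP h) nl0.
Qed.

Lemma yosida_psi_bounded (A s : R) : `|s| <= A ->
  `|phi (J s)| <= Num.max (phi A) (- phi (- A)).
Proof.
by move=> sA; have [h _] := JE s; apply: nl_bounded; exact: le_trans sA.
Qed.

Lemma yosida_near (A s : R) : `|s| <= A ->
  `|s - J s| <= e * Num.max (phi A) (- phi (- A)).
Proof.
move=> sA; have [_ {1}<-] := JE s.
rewrite addrAC subrr add0r normrM gtr0_norm // ler_pM2l //.
exact: yosida_psi_bounded.
Qed.

End Yosida.

(** * Limits of the schemes *)

Section StrongDerivative.
Variables (R : realType) (u g : R -> R).

(** Strict differentiability, uniform over pairs of times near [t]. It survives limits of schemes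
    and yields at once the derivative, its continuity, and continuity of [u] up to [t = 0]. *)
Definition strong_derivative := forall t e : R, 0 <= t -> 0 < e ->
  exists2 d : R, 0 < d & forall s s', 0 <= s -> 0 <= s' ->
    `|s - t| < d -> `|s' - t| < d ->
    `|u s' - u s - (s' - s) * g t| <= e * `|s' - s|.

Hypothesis ug : strong_derivative.

Lemma strong_derivative_cvg t : 0 < t ->
  (fun r => r^-1 *: (u (r + t) - u t)) @ 0^' --> g t.
Proof.
move=> t0; apply/cvgrPdist_le => e e0; have [d d0 hd] := ug (ltW t0) e0.
have m0 : 0 < Num.min d t by rewrite lt_min d0.
exists (Num.min d t) => // r /=; rewrite sub0r normrN lt_min => /andP[rd rt] r0.
have rt0 : 0 <= r + t by move: rt; rewrite ltr_norml; lra.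
have := hd t (r + t) (ltW t0) rt0; rewrite subrr normr0 addrK => /(_ d0 rd) h.
have nr : 0 < `|r| by rewrite normr_gt0.
rewrite -(ler_pM2l nr) -normrM mulrC (mulrC _ e).
rewrite (_ : (g t - r^-1 *: (u (r + t) - u t)) * r =
   - (u (r + t) - u t - r * g t)) ?normrN //.
by rewrite /GRing.scale /=; field.
Qed.

Lemma strong_derivative_derivable t : 0 < t -> derivable u t 1.
Proof.
move=> t0; apply/cvg_ex; exists (g t); have := strong_derivative_cvg t0.
by under eq_fun do rewrite -[X in u (X + t)]mulr1.
Qed.

Lemma strong_derivative_derive1 t : 0 < t -> derive1 u t = g t.
Proof.
move=> t0; rewrite /derive1; apply: (cvg_lim (@Rhausdorff R)).
exact: strong_derivative_cvg.
Qed.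

Lemma strong_derivative_continuous_derive1 t : 0 < t ->
  {for t, continuous (derive1 u)}.
Proof.
move=> t0; apply/cvgrPdist_le => e e0.
have e2 : 0 < e / 2 by rewrite divr_gt0.
have [d d0 hd] := ug (ltW t0) e2.
have m0 : 0 < Num.min (d / 2) t by rewrite lt_min t0 divr_gt0.
exists (Num.min (d / 2) t) => // s /=; rewrite lt_min => /andP[sd st].
have s0 : 0 < s by move: st; rewrite ltr_norml; lra.
rewrite !strong_derivative_derive1 //.
have [d' d'0 hd'] := ug (ltW s0) e2.
(* Small enough for the increment on [[s, s + r]] to be compared both with [g s] and with [g t]. *)
pose r := Num.min (d / 2) d' / 2.
have r0 : 0 < r by rewrite divr_gt0 // lt_min d'0 divr_gt0.
have rd : r < d / 2 by rewrite ltr_pdivrMr // gt_min; apply/orP; left; lra.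
have rd' : r < d' by rewrite ltr_pdivrMr // gt_min; apply/orP; right; lra.
have sr0 : 0 <= s + r by lra.
have h1 : `|s - t| < d by rewrite distrC; apply: lt_trans sd _; lra.
have h2 : `|s + r - t| < d.
  by move: sd; rewrite !ltr_norml; lra.
have := hd s (s + r) (ltW s0) sr0 h1 h2.
have := hd' s (s + r) (ltW s0) sr0; rewrite subrr normr0.
rewrite [s + r - s]addrAC subrr add0r gtr0_norm // => /(_ d'0 rd') k1 k2.
rewrite -(ler_pM2l r0) -[X in X * `|_|](gtr0_norm r0) -normrM.
rewrite (_ : r * (g t - g s) = (u (s + r) - u s - r * g s) -
  (u (s + r) - u s - r * g t)); last by ring.
by apply: le_trans (ler_normB _ _) _; lra.
Qed.

Lemma strong_derivative_continuous T : {within `[0, T], continuous u}.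
Proof.
apply/(@subspace_continuousP R) => t; rewrite /= in_itv /= => /andP[t0 tT].
apply/cvgrPdist_le => e e0; have [d d0 hd] := ug t0 ltr01.
pose L := 1 + `|g t|; have L0 : 0 < L by rewrite ltr_pwDl.
have m0 : 0 < Num.min d (e / L) by rewrite lt_min d0 divr_gt0.
rewrite near_withinE; exists (Num.min d (e / L)) => // s /=.
rewrite lt_min => /andP[sd sL]; rewrite in_itv /= => /andP[s0 sT].
have := hd s t s0 t0; rewrite subrr normr0 distrC => /(_ sd d0) h.
have h2 : `|(t - s) * g t| = `|t - s| * `|g t| by rewrite normrM.
rewrite -[u t - u s](subrK ((t - s) * g t)).
apply: le_trans (ler_normD _ _) _; rewrite h2.
rewrite ltr_pdivlMr // /L in sL; move: h sL; rewrite mulrDr; lra.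
Qed.

End StrongDerivative.

Lemma cvg_along (T : Type) (S : topologicalType) (F : set_system T)
  (f : nat -> S) (N : T -> nat) (l : S) : f n @[n --> \oo] --> l ->
  (forall V, \oo V -> F (N @^-1` V)) -> f (N q) @[q --> F] --> l.
Proof. by move=> fl NF V Vl; exact: (NF (f @^-1` V) (fl V Vl)). Qed.

(** * Ultrafilter limits of the explicit schemes are solutions *)

Section SolutionLimit.
Variables (R : realType) (X : countType) (G : graph R X).
Local Notation w := (weight G).
Variables (phi : R -> R) (phi_nl : nonlinearity phi).
Variables (u0 : X -> R) (A : R) (A0 : 0 <= A) (u0A : bounded_by A u0).
Variables (J : nat -> R -> R) (h : nat -> R).
Hypothesis JE : forall n s, `|J n s| <= `|s| /\ J n s + n.+1%:R^-1 * phi (J n s) = s.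
Hypothesis h0 : forall n, 0 < h n.
Hypothesis h_le : forall n, h n <= n.+1%:R^-1.
Hypothesis h_deg : forall n x, (pickle x < n)%N ->
  h n * n.+1%:R^-1^-1 * deg G x <= 1.
Variables (U : set_system nat) (UU : UltraFilter U) (sU : \oo `<=` U).

Let Phi := Num.max (phi A) (- phi (- A)).
Let psi n := phi \o J n.
Let un a n k := scheme G (psi n) (h n) n u0 a k.
Let PU : ProperFilter U. Proof. exact: ultra_proper. Qed.

Let eps0 n : 0 < n.+1%:R^-1 :> R. Proof. by rewrite invr_gt0. Qed.

Let psi_mono n s t : s <= t -> psi n s <= psi n t.
Proof. exact: yosida_psi_mono (eps0 n) (JE n) _ _. Qed.

Let psi_lip n s t : s <= t -> psi n t - psi n s <= n.+1%:R^-1^-1 * (t - s).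
Proof. exact: yosida_psi_lip (eps0 n) (JE n) _ _. Qed.

Let psi0 n : psi n 0 = 0.
Proof. by rewrite /psi /=; exact: (yosida_psi0 phi_nl (JE n)). Qed.

Let scheme_seq_bounded a n k : `|a| <= A -> bounded_by A (un a n k).
Proof.
exact: (scheme_bounded (@psi_mono n) (@psi_lip n) (psi0 n) (h0 n) (@h_deg n)
  A0 u0A).
Qed.

Let psi_scheme_seq_bounded a n k : `|a| <= A -> bounded_by Phi (psi n \o un a n k).
Proof.
by move=> aA x; apply: (yosida_psi_bounded phi_nl (JE n)); exact: scheme_seq_bounded.
Qed.

Let h_cvg0 : h n @[n --> \oo] --> (0 : R).
Proof.
apply: (@squeeze0 _ _ _ _ _ (fun n => n.+1%:R^-1)); first exact: cvg_harmonic.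
by apply: nearW => n; rewrite gtr0_norm.
Qed.

Let trunc_step n (t : R) : 0 <= t ->
  (Num.truncn (t / h n))%:R * h n <= t < (Num.truncn (t / h n))%:R * h n + h n.
Proof.
move=> t0; have th : 0 <= t / h n by rewrite divr_ge0 // ltW.
have /andP[k1 k2] := truncn_itv th.
rewrite -ler_pdivlMr // k1 /=; move: k2.
by rewrite -natr1 ltr_pdivrMr // mulrDl mul1r.
Qed.

(** The default [0] is a placeholder: for [|a| <= A] the limit exists by boundedness of the
    scheme. *)
Definition gpme_limit (a t : R) (x : X) : R :=
  xget 0 [set l | un a n (Num.truncn (t / h n)) x @[n --> U] --> l].

Lemma gpme_limit_cvg a t x : `|a| <= A ->
  un a n (Num.truncn (t / h n)) x @[n --> U] --> gpme_limit a t x.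
Proof.
move=> aA; have [l hl] : exists l : R,
    un a n (Num.truncn (t / h n)) x @[n --> U] --> l.
  by apply: (ultra_bounded_cvg (C := A)) => n; exact: scheme_seq_bounded.
rewrite /gpme_limit; case: xgetP => [y _ //|/(_ l)]; by case.
Qed.

Lemma gpme_limit_bounded a t : `|a| <= A -> bounded_by A (gpme_limit a t).
Proof.
move=> aA x; have hn : `|un a n (Num.truncn (t / h n)) x| @[n --> U] -->
    `|gpme_limit a t x|.
  by apply: cvg_norm; exact: gpme_limit_cvg.
apply: (ler_cvg hn (cvg_cst A)); apply: nearW => n; exact: scheme_seq_bounded.
Qed.

Lemma gpme_limit0 a x : `|a| <= A -> gpme_limit a 0 x = u0 x.
Proof.
move=> aA; apply: (cvg_unique (@Rhausdorff R) (@gpme_limit_cvg a 0 x aA)).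
apply: cvg_near_cst; apply: sU; exists (pickle x).+1 => // n /= xn.
by rewrite mul0r truncn0 /un /= xn.
Qed.

(** The regularisation moves its argument by at most [Phi / (N q + 1)], so continuity of [phi] is
    enough. *)
Lemma psi_cvg (T : Type) (F : set_system T) (FF : ProperFilter F)
    (N : T -> nat) (v : T -> R) (l : R) :
  (forall S, U S -> F (N @^-1` S)) -> (forall q, `|v q| <= A) ->
  v q @[q --> F] --> l -> psi (N q) (v q) @[q --> F] --> phi l.
Proof.
move=> NU vA vl; have Jc : J (N q) (v q) @[q --> F] --> l.
  have -> : (fun q => J (N q) (v q)) = (fun q => v q - (v q - J (N q) (v q))).
    by apply/funext => q; rewrite opprB addrC subrK.
  rewrite -[X in _ --> X]subr0; apply: cvgB => //.
  apply: (@squeeze0 _ _ _ _ _ (fun q => (N q).+1%:R^-1 * Phi)).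
    rewrite -[X in _ --> X](mul0r Phi); apply: cvgM; last exact: cvg_cst.
    by apply: (cvg_along (@cvg_harmonic R)) => V VV; apply: NU; exact: sU.
  by apply: nearW => q; exact: (yosida_near phi_nl (eps0 (N q)) (JE (N q))).
by apply: continuous_cvg Jc; exact: nl_continuous.
Qed.

Section Joint.
Variables (T : Type) (F : set_system T) (FF : ProperFilter F).
Variables (N k : T -> nat) (t : R).
Hypothesis t0 : 0 <= t.
Hypothesis NU : forall S, U S -> F (N @^-1` S).
Hypothesis kt : (k q)%:R * h (N q) @[q --> F] --> t.

(** At a fixed vertex the scheme is Lipschitz in time with a constant independent of the level, so
    all grid times tending to [t] produce the limit defined by rounding [t] down. *)
Lemma joint_cvg a x : `|a| <= A ->
  un a (N q) (k q) x @[q --> F] --> gpme_limit a t x.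
Proof.
move=> aA; pose k0 n := Num.truncn (t / h n).
have c0 : un a (N q) (k0 (N q)) x @[q --> F] --> gpme_limit a t x.
  by move=> V /(@gpme_limit_cvg a t x aA) /NU.
suff d0 : un a (N q) (k q) x - un a (N q) (k0 (N q)) x @[q --> F] --> (0 : R).
  have -> : (fun q => un a (N q) (k q) x) = (fun q =>
     (un a (N q) (k q) x - un a (N q) (k0 (N q)) x) + un a (N q) (k0 (N q)) x).
    by apply/funext => q; rewrite subrK.
  by rewrite -[X in _ --> X]add0r; exact: cvgD.
pose L := 2 * deg G x * Phi.
have hN : h (N q) @[q --> F] --> (0 : R).
  by apply: cvg_along h_cvg0 _ => V VV; apply: NU; exact: sU.
apply: (@squeeze0 _ _ _ _ _ (fun q => (`|t - (k q)%:R * h (N q)| + h (N q)) * L)).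
  have -> : (0 : R) = (`|t - t| + 0) * L by rewrite subrr normr0 addr0 mul0r.
  apply: cvgM; last exact: cvg_cst; apply: cvgD => //.
  by apply: cvg_norm; apply: cvgB => //; exact: cvg_cst.
have big : F (N @^-1` [set n | (pickle x < n)%N]).
  by apply: NU; apply: sU; exists (pickle x).+1.
apply: filterS big => q /= xn.
have L0 : 0 <= L.
  have Phi0 : 0 <= Phi by exact: le_trans (psi_scheme_seq_bounded 0 0 aA x).
  by rewrite mulr_ge0 // mulr_ge0 // deg_ge0.
have hq := h0 (N q).
have lip i j : (j <= i)%N -> `|un a (N q) i x - un a (N q) j x| <=
    `|j%:R * h (N q) - i%:R * h (N q)| * L.
  move=> ji; have := scheme_lip (h0 (N q))
    (fun i => @psi_scheme_seq_bounded a (N q) i aA) xn ji.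
  rewrite mulrA natrB // mulrBl => /le_trans; apply.
  by rewrite ler_wpM2r // distrC ler_norm.
have lip2 : `|un a (N q) (k q) x - un a (N q) (k0 (N q)) x| <=
    `|(k0 (N q))%:R * h (N q) - (k q)%:R * h (N q)| * L.
  have [ji|/ltnW ji] := leqP (k0 (N q)) (k q); first exact: lip.
  by rewrite distrC [X in X * L]distrC; exact: lip.
apply: le_trans lip2 _; rewrite ler_wpM2r //.
have /andP[k1 k2] := trunc_step (N q) t0.
have -> : (k0 (N q))%:R * h (N q) - (k q)%:R * h (N q) =
  (t - (k q)%:R * h (N q)) - (t - (k0 (N q))%:R * h (N q)) by ring.
apply: le_trans (ler_normB _ _) _; rewrite lerD2l ger0_norm ?subr_ge0 //.
by rewrite /k0; lra.
Qed.

Lemma joint_psi_cvg a x : `|a| <= A ->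
  psi (N q) (un a (N q) (k q) x) @[q --> F] --> phi (gpme_limit a t x).
Proof.
move=> aA; apply: psi_cvg NU _ (joint_cvg aA) => q; exact: scheme_seq_bounded.
Qed.

Lemma joint_lap_cvg a x : `|a| <= A ->
  lap G (psi (N q) \o un a (N q) (k q)) x @[q --> F] -->
  lap G (phi \o gpme_limit a t) x.
Proof.
move=> aA; have pc y : psi (N q) (un a (N q) (k q) y) @[q --> F] -->
    phi (gpme_limit a t y) by exact: joint_psi_cvg.
have [_ hs] : abs_summable (fun y => w x y *
      (phi (gpme_limit a t x) - phi (gpme_limit a t y))) /\
    rsum (fun y => w x y * (psi (N q) (un a (N q) (k q) x) -
      psi (N q) (un a (N q) (k q) y))) @[q --> F] -->
    rsum (fun y => w x y * (phi (gpme_limit a t x) - phi (gpme_limit a t y))).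
  apply: (@dominated_rsum _ _ T F _ _ _ (fun y => (Phi + Phi) * w x y)).
  - by move=> y; apply: cvgM; [exact: cvg_cst|exact: cvgB].
  - exact/abs_summableZ/weight_sum.
  - apply: nearW => q y; rewrite normrM ger0_norm ?weight_ge0 // mulrC.
    rewrite ler_wpM2r ?weight_ge0 //; apply: le_trans (ler_normB _ _) _.
    by apply: lerD; exact: psi_scheme_seq_bounded.
rewrite /lap; apply: cvgD; apply: cvgM; try exact: cvg_cst.
- exact: hs.
- exact: pc.
Qed.

End Joint.

(* Convergence of a grid point [k * h n] to [t], along [U], uniformly in [k]. *)
Definition grid_filter (t : R) : set_system (nat * nat) :=
  [set S | exists2 d : R, 0 < d &
     U [set n | forall k, `|t - k%:R * h n| < d -> S (n, k)]].

Lemma grid_filter_proper t : 0 <= t -> ProperFilter (grid_filter t).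
Proof.
move=> t0; apply: Build_ProperFilter_ex.
  move=> S [d d0 Ud].
  have hd : U [set n | h n < d].
    apply: sU; have /cvgrPdist_lt/(_ _ d0) := h_cvg0; apply: filterS => n.
    by rewrite sub0r normrN gtr0_norm.
  have [n [hn Sn]] := filter_ex (filterI Ud hd).
  exists (n, Num.truncn (t / h n)); apply: hn.
  have /andP[k1 k2] := trunc_step n t0; rewrite /= in Sn.
  by rewrite ger0_norm ?subr_ge0 //; lra.
split.
- by exists 1 => //; apply: filterE.
- move=> S S' [d d0 Ud] [d' d'0 Ud']; exists (Num.min d d').
    by rewrite lt_min d0.
  apply: filterS2 Ud Ud' => n h1 h2 k; rewrite lt_min => /andP[k1 k2].
  by split; [exact: h1|exact: h2].
- move=> S S' SS' [d d0 Ud]; exists d => //; apply: filterS Ud => n h1 k k1.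
  by apply: SS'; exact: h1.
Qed.

Lemma grid_filter_fst t S : U S -> grid_filter t (fst @^-1` S).
Proof. by move=> US; exists 1 => //; apply: filterS US => n Sn k _. Qed.

Lemma grid_filter_cvg t : 0 <= t ->
  (q.2)%:R * h q.1 @[q --> grid_filter t] --> t.
Proof.
move=> t0; have PF := grid_filter_proper t0.
apply/cvgrPdist_lt => e e0; exists e => //.
by apply: (@filterE _ U _) => n k.
Qed.

(** Convergence along [grid_filter] makes the discrete Laplacian close to its limit at all grid
    times near [t] simultaneously. Summing the increments between two such times and passing to the
    limit gives the estimate. *)
Lemma gpme_limit_strong_derivative a x : `|a| <= A ->
  strong_derivative (fun t => gpme_limit a t x)
    (fun t => - lap G (phi \o gpme_limit a t) x).
Proof.
move=> aA t e t0 e0; have PF := grid_filter_proper t0.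
have := joint_lap_cvg PF t0 (@grid_filter_fst t) (grid_filter_cvg t0) (x := x) aA.
move=> /cvgrPdist_le/(_ _ e0)[d d0 Ud].
(* The other half of [d] absorbs rounding down to the grid, once [h n < d / 2]. *)
exists (d / 2); first by rewrite divr_gt0.
have d20 : 0 < d / 2 by rewrite divr_gt0.
set c := lap G (phi \o gpme_limit a t) x in Ud *.
suff key (s s' : R) : 0 <= s -> s <= s' -> `|s - t| < d / 2 -> `|s' - t| < d / 2 ->
    `|gpme_limit a s' x - gpme_limit a s x + (s' - s) * c| <= e * (s' - s).
  move=> s s' s0 s'0 st s't; rewrite mulrN opprK.
  have [ss'|/ltW ss'] := leP s s'.
    by rewrite [in leRHS]ger0_norm ?subr_ge0 //; exact: key.
  have := key s' s s'0 ss' s't st.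
  rewrite -normrN [`|s' - s|]distrC [`|s - s'|]ger0_norm ?subr_ge0 //.
  by congr (`|_| <= _); ring.
move=> s0 ss' st s't; have s'0 := le_trans s0 ss'.
pose k n r := Num.truncn (r / h n).
have kc (r : R) : 0 <= r -> (k n r)%:R * h n @[n --> U] --> r.
  move=> r0; have -> : (fun n => (k n r)%:R * h n) =
    (fun n => r - (r - (k n r)%:R * h n)).
    by apply/funext => n; rewrite opprB addrC subrK.
  rewrite -[X in _ --> X]subr0; apply: cvgB; first exact: cvg_cst.
  apply: (@squeeze0 _ _ _ _ _ h); first exact: cvg_along h_cvg0 sU.
  apply: nearW => n; have /andP[k1 k2] := trunc_step n r0.
  by rewrite ger0_norm ?subr_ge0 // /k; lra.
have lhs : `|un a n (k n s') x - un a n (k n s) x +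
    ((k n s')%:R * h n - (k n s)%:R * h n) * c| @[n --> U] -->
   `|gpme_limit a s' x - gpme_limit a s x + (s' - s) * c|.
  apply: cvg_norm; apply: cvgD; first by apply: cvgB; exact: gpme_limit_cvg.
  by apply: cvgM; [apply: cvgB; exact: kc|exact: cvg_cst].
have rhs : e * ((k n s')%:R * h n - (k n s)%:R * h n) @[n --> U] --> e * (s' - s).
  by apply: cvgM; [exact: cvg_cst|apply: cvgB; exact: kc].
apply: (ler_cvg lhs rhs).
have hd : U [set n | h n < d / 2].
  apply: sU; have /cvgrPdist_lt/(_ _ d20) := h_cvg0; apply: filterS => n.
  by rewrite sub0r normrN gtr0_norm.
have big : U [set n | (pickle x < n)%N] by apply: sU; exists (pickle x).+1.
apply: filterS3 Ud hd big => n Hn hn xn.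
have kk : (k n s <= k n s')%N.
  by apply: le_truncn; rewrite ler_pM2r ?invr_gt0.
have /andP[s1 s2] := trunc_step n s0; have /andP[s3 s4] := trunc_step n s'0.
have hn0 := h0 n.
rewrite -mulrBl -natrB // (mulrC e).
apply: (scheme_increment hn0 xn kk) => i /andP[i1 i2].
rewrite distrC; apply: Hn.
have {}hn : h n < d / 2 by exact: hn.
have r1 : (k n s)%:R * h n <= i%:R * h n by rewrite ler_pM2r // ler_nat.
have r2 : i.+1%:R * h n <= (k n s')%:R * h n by rewrite ler_pM2r // ler_nat.
move: st s't; rewrite !ltr_norml => /andP[st1 st2] /andP[st3 st4].
rewrite -natr1 mulrDl mul1r in r2; rewrite /k in r1 r2.
apply/andP; split; lra.
Qed.

Lemma gpme_limit_solution a : `|a| <= A ->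
  global_bounded_pointwise_solution G phi u0 (gpme_limit a).
Proof.
move=> aA; have sd x := gpme_limit_strong_derivative x aA.
split; last by exists A => t x _; exact: gpme_limit_bounded.
move=> T T0; split.
- move=> t _ x; apply: (@bounded_weight_sum _ _ G _ Phi) => y.
  by apply: (nl_bounded phi_nl); exact: gpme_limit_bounded.
- by move=> x; exact: (@strong_derivative_continuous _ _ _ (sd x) T).
- move=> x; split=> t; rewrite in_itv /= => /andP[t0 _].
    exact: (@strong_derivative_derivable _ _ _ (sd x) t t0).
  exact: (@strong_derivative_continuous_derive1 _ _ _ (sd x) t t0).
- move=> t x; rewrite in_itv /= => /andP[t0 _].
  by rewrite (strong_derivative_derive1 (sd x) t0) addNr.
- by move=> x; exact: gpme_limit0.
Qed.

(** The lower bound on [gap] forces the schemes apart at [x] at some grid time before [S]. These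
    times may vary with [n]; along the ultrafilter they converge to some [t], and joint convergence
    transfers the separation there. *)
Lemma gpme_limit_neq a b (S : R) : ~ stochastically_complete_at_infinity G ->
  `|a| <= A -> `|b| <= A -> phi b < phi a -> 0 < S ->
  restr_time S (gpme_limit a) <> restr_time S (gpme_limit b).
Proof.
move=> hG aA bA ab S0 e.
have ba : b <= a.
  by rewrite leNgt; apply/negP => /ltW /(nl_mono phi_nl); rewrite leNgt ab.
pose dl := (phi a - phi b) / 2.
have dl0 : 0 < dl by rewrite divr_gt0 // subr_gt0.
(* Eventually the elapsed time is at least [S / 2] and the difference of boundary values at least
   [dl], so their product times [K] exceeds [2 * A]. *)
pose K := (2 * A + 1) / (S / 2 * dl).
have S20 : 0 < S / 2 by rewrite divr_gt0.
have K0 : 0 < K.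
  by apply: divr_gt0; [have := A0; lra|exact: mulr_gt0].
have [g [g01 [x gx] gK]] := incomplete_barrier hG K0.
pose k n := Num.truncn (S / h n).
have psi_cst c : `|c| <= A -> psi n c @[n --> U] --> phi c.
  by move=> cA; apply: (@psi_cvg _ U PU id) => //; exact: cvg_cst.
have Ud : U [set n | dl <= psi n a - psi n b].
  have hc : psi n a - psi n b @[n --> U] --> phi a - phi b.
    by apply: cvgB; exact: psi_cst.
  have /cvgrPdist_le/(_ _ dl0) := hc; apply: filterS => n /=.
  have -> : phi a - phi b = 2 * dl by rewrite /dl; field.
  by have := ler_norm (2 * dl - (psi n a - psi n b)); lra.
have Uh : U [set n | h n < S / 2].
  apply: sU; have /cvgrPdist_lt/(_ _ S20) := h_cvg0; apply: filterS => n.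
  by rewrite sub0r normrN gtr0_norm.
(* Pigeonhole: if the difference stayed below [dl * g x] at every step, its time sum would fall
   below the bound of [gap_lower_bound]. *)
have jex n : exists j, dl <= psi n a - psi n b -> h n < S / 2 ->
    (j <= k n)%N /\ dl * g x <= psi n (un a n j x) - psi n (un b n j x).
  have [h1|h1] := boolP (dl <= psi n a - psi n b); last by exists 0%N.
  have [h2|h2] := boolP (h n < S / 2); last by exists 0%N.
  have /andP[k1 k2] := trunc_step n (ltW S0); rewrite -/(k n) in k1 k2.
  have kS : S / 2 <= (k n)%:R * h n by lra.
  have lam : 2 * A < (k n)%:R * h n * (psi n a - psi n b) * K.
    apply: (@lt_le_trans _ _ (S / 2 * dl * K)).
      rewrite /K mulrCA divff ?mulr1; [lra|by rewrite gt_eqF // mulr_gt0].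
    by rewrite ler_pM2r // ler_pM // ltW.
  have gl := gap_lower_bound (@psi_mono n) (@psi_lip n) (psi0 n) (h0 n)
    (@h_deg n) A0 u0A aA bA ba g01 gK lam x.
  have [[j [jk hj]]|no] := pselect (exists j, (j <= k n)%N /\
      dl * g x <= psi n (un a n j x) - psi n (un b n j x)).
    by exists j.
  exfalso; have k0 : (0 < k n)%N.
    rewrite lt0n; apply/eqP => kn0; move: kS; rewrite kn0 mul0r; lra.
  have : gap G (psi n) (h n) n u0 a b (k n) x <
      (k n)%:R * h n * (psi n a - psi n b) * g x.
    rewrite /gap (mulrC (k n)%:R) -!mulrA ltr_pM2l //.
    apply: (@lt_le_trans _ _ ((k n)%:R * (dl * g x))); last first.
      by rewrite ler_pM2l ?ltr0n // ler_pM2r.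
    have -> : (k n)%:R * (dl * g x) = \sum_(j < k n) (dl * g x).
      by rewrite sumr_const card_ord mulr_natl.
    rewrite -subr_gt0 -sumrB (bigD1 (Ordinal k0)) //=.
    have lt j : (j <= k n)%N ->
        0 < dl * g x - (psi n (un a n j x) - psi n (un b n j x)).
      move=> jk; rewrite subr_gt0 ltNge; apply/negP => hj; apply: no.
      by exists j.
    apply: ltr_wpDr; last exact: (lt 0%N).
    apply: sumr_ge0 => j _; apply: ltW; apply: lt; exact: ltnW.
  by rewrite ltNge gl.
have [j hj] := choice jex.
(* The indices [j n] are controlled only for almost all [n]; capping at [S] bounds the times for
   every [n] and changes nothing along [U]. *)
have jS n : `|Num.min ((j n)%:R * h n) S| <= S.
  have p : 0 <= (j n)%:R * h n by rewrite mulr_ge0 // ltW.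
  rewrite ger0_norm; first by rewrite ge_min lexx orbT.
  by rewrite le_min p ltW.
have [t ht] := ultra_bounded_cvg jS.
have tS : 0 <= t <= S.
  apply/andP; split.
    apply: (ler_cvg (cvg_cst (0 : R)) ht); apply: nearW => n.
    by rewrite le_min (ltW S0) andbT mulr_ge0 // ltW.
  apply: (ler_cvg ht (cvg_cst S)); apply: nearW => n.
  by rewrite ge_min lexx orbT.
have /andP[t0 tS'] := tS.
have hjt : (j n)%:R * h n @[n --> U] --> t.
  apply: cvg_trans ht; apply: near_eq_cvg.
  apply: filterS2 Ud Uh => n h1 h2; have [jk _] := hj n h1 h2.
  rewrite min_l //; have /andP[k1 _] := trunc_step n (ltW S0).
  by apply: le_trans k1; rewrite ler_pM2r // ler_nat.
have ca := joint_psi_cvg PU t0 (fun S US => US) hjt (x := x) aA.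
have cb := joint_psi_cvg PU t0 (fun S US => US) hjt (x := x) bA.
have gt0 : dl * g x <= phi (gpme_limit a t x) - phi (gpme_limit b t x).
  apply: (ler_cvg (cvg_cst (dl * g x)) (cvgB ca cb)).
  by apply: filterS2 Ud Uh => n h1 h2; have [_] := hj n h1 h2.
have := congr1 (fun f => f t x) e; rewrite /restr_time in_itv /= tS => eq.
by move: gt0; rewrite eq subrr leNgt mulr_gt0.
Qed.

End SolutionLimit.

(** * Choice of parameters and of infinitely many boundary values *)

Section Nonuniqueness.
Variables (R : realType) (X : countType) (G : graph R X).

(** The sum [B] of the first [n] degrees dominates each of them, and [n.+1] is the Lipschitz
    constant of the Yosida regularisation at level [n]. *)
Lemma step_size_exists n : exists h : R, [/\ 0 < h, h <= n.+1%:R^-1 &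
  forall x : X, (pickle x < n)%N -> h * n.+1%:R^-1^-1 * deg G x <= 1].
Proof.
pose B := psum (deg G) n.
have B0 : 0 <= B by apply: psum_ge0 => x; exact: deg_ge0.
have n0 : 0 < n.+1%:R :> R by rewrite ltr0n.
have nB : 0 <= n.+1%:R * B by rewrite mulr_ge0 // ltW.
have D0 : 0 < 1 + n.+1%:R * B by rewrite ltr_pwDl.
exists (n.+1%:R * (1 + n.+1%:R * B))^-1; split.
- by rewrite invr_gt0 mulr_gt0.
- by rewrite lef_pV2 ?posrE ?mulr_gt0 // ler_peMr ?lerDl // ltW.
- move=> x xn; rewrite invrK (mulrC n.+1%:R) invfM divfK ?gt_eqF //.
  rewrite mulrC ler_pdivrMr // mul1r.
  have xB : deg G x <= B.
    rewrite /B /psum (bigD1 (Ordinal xn)) //= fnat_pickle lerDl sumr_ge0 // => k _.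
    by rewrite /fnat; case: pickle_inv => // y; exact: deg_ge0.
  apply: le_trans xB _; apply: le_trans (_ : n.+1%:R * B <= _); last first.
    by rewrite lerDr.
  by rewrite ler_peMl // ler1n.
Qed.

(** Since [phi] may have plateaus, distinct boundary values are not enough: infinitely many values
    of [phi] between [phi s1] and [phi s2] are lifted by the intermediate value theorem, which also
    keeps them bounded. *)
Lemma nonlinearity_values (phi : R -> R) : nonlinearity phi ->
  exists (C : R) (a : nat -> R), (forall i, `|a i| <= C) /\
    forall i j, i <> j -> phi (a i) <> phi (a j).
Proof.
move=> phi_nl; have [_ _ nc _] := phi_nl.
have [s1 [s2 s12]] : exists s1 s2, phi s1 < phi s2.
  apply: contrapT => no; apply: nc; exists (phi 0) => s; apply/eqP.
  rewrite eq_le !leNgt; apply/andP; split; apply/negP => ss; apply: no.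
    by exists 0, s.
  by exists s, 0.
have ss : s1 <= s2.
  by rewrite leNgt; apply/negP => /ltW /(nl_mono phi_nl); rewrite leNgt s12.
pose v (i : nat) := phi s1 + (phi s2 - phi s1) * i.+1%:R^-1.
have d0 : 0 < phi s2 - phi s1 by rewrite subr_gt0.
have ex i : exists c : R, s1 <= c <= s2 /\ phi c = v i.
  have [||c cs cv] := @IVT R phi s1 s2 (v i) ss.
  - by apply: continuous_subspaceT => r; exact: nl_continuous.
  - rewrite min_l ?max_r ?(ltW s12) // /v lerDl mulr_ge0 ?(ltW d0) //=.
    by rewrite -lerBrDl ler_piMr ?(ltW d0) // invf_le1 ?ltr0n // ler1n.
  - by exists c; split => //; move: cs; rewrite in_itv.
have [a ha] := choice ex.
exists (`|s1| + `|s2|), a; split=> [i|i j ij].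
  have [/andP[a1 a2] _] := ha i; rewrite ler_norml.
  have := ler_norm s2; have := ler_norm (- s1); rewrite normrN.
  by have := normr_ge0 s1; have := normr_ge0 s2; lra.
have [_ ->] := ha i; have [_ ->] := ha j => /addrI /(mulfI (lt0r_neq0 d0)).
by move=> /invr_inj /eqP; rewrite eqr_nat eqSS => /eqP.
Qed.

Lemma gpme_nonuniqueness (u0 : X -> R) (phi : R -> R) :
  ~ stochastically_complete_at_infinity G ->
  ell_infty u0 -> nonlinearity phi ->
  exists u : nat -> R -> X -> R,
    (forall i, global_bounded_pointwise_solution G phi u0 (u i)) /\
    forall S : R, 0 < S -> forall i j, i <> j ->
      restr_time S (u i) <> restr_time S (u j).
Proof.
move=> hG [M u0M] phi_nl; have [C [a [aC a_neq]]] := nonlinearity_values phi_nl.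
(* One bound for the datum and for all boundary values, so that all schemes share the same steps,
   regularisation and ultrafilter. *)
pose A := `|M| + `|C|; have A0 : 0 <= A by rewrite addr_ge0.
have u0A : bounded_by A u0.
  move=> x; apply: le_trans (u0M x) _; apply: le_trans (ler_norm M) _.
  by rewrite lerDl.
have aA i : `|a i| <= A.
  apply: le_trans (aC i) _; apply: le_trans (ler_norm C) _.
  by rewrite lerDr.
have e0 n : 0 < n.+1%:R^-1 :> R by rewrite invr_gt0 ltr0n.
have [J JE] := choice (fun n => yosida_exists phi_nl (e0 n)).
have [h hh] := choice step_size_exists.
have h0 n : 0 < h n by have [] := hh n.
have h_le n : h n <= n.+1%:R^-1 by have [] := hh n.
have h_deg n x : (pickle x < n)%N -> h n * n.+1%:R^-1^-1 * deg G x <= 1.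
  by have [_ _] := hh n; apply.
have [U UU sU] := ultra_nat R.
exists (fun i => gpme_limit G phi u0 J h U (a i)); split=> [i|S S0 i j ij].
  exact: (gpme_limit_solution phi_nl A0 u0A JE h0 h_le h_deg UU sU).
have neq := gpme_limit_neq phi_nl A0 u0A JE h0 h_le h_deg UU sU hG.
have [lt|lt|eq] := ltgtP (phi (a i)) (phi (a j)).
- by move=> e; apply: (neq (a j) (a i) S) => //; rewrite e.
- exact: neq.
- by case: (a_neq i j ij).
Qed.

End Nonuniqueness.

Theorem theorem5p2 (R : realType) (X : countType) (G : graph R X)
  (hG : ~ stochastically_complete_at_infinity G) :
  forall (u0 : X -> R) (phi : R -> R), ell_infty u0 -> nonlinearity phi ->
    (exists (A : Type) (u : A -> R -> X -> R),
       [/\ infinite_set [set: A],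
           forall a, global_bounded_pointwise_solution G phi u0 (u a)
         & forall S, 0 < S -> forall a b, a <> b ->
             restr_time S (u a) <> restr_time S (u b)]) /\
    (forall T, 0 < T ->
       infinite_set
         [set restr_time T v | v in bounded_pointwise_solution G phi u0 T]).
Proof.
move=> u0 phi u0b phi_nl.
have [u [u_sol u_neq]] := gpme_nonuniqueness hG u0b phi_nl.
split; first by exists nat, u; split => //; exact: infinite_nat.
move=> T T0 fin; apply: infinite_nat.
have inj : {in [set: nat] &, injective (fun i => restr_time T (u i))}.
  move=> i j _ _ /= e; apply/eqP/negPn/negP => /eqP ij; exact: u_neq ij e.
rewrite -(eq_finite_set (inj_card_eq inj)).
apply: sub_finite_set fin => _ [i _ <-].
exists (u i) => //; have [sol [M uM]] := u_sol i; split; first exact: sol.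
by exists M => t x; rewrite in_itv /= => /andP[t0 _]; exact: uM.
Qed.
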